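(* Let $\mathbb{L}=\mathbb{Z}^-=\{\ldots,-2,-1,0\}$, $\Omega=\{-1,1\}^{\mathbb{L}}$, and consider the Ising chain on the half-line with couplings $J(i,j)$, i.e. the Ising LSS $f^{\beta}$ at inverse temperature $\beta>0$ defined in the context. Let $J(r):=\sup\{|J(i,j)|:|i-j|=r\}$ for $r\geq1$. (a) If the chain is ferromagnetic ($J(i,j)\ge0$), with decreasing couplings (that is, $J(i,j)\ge J(k,l)$ whenever $|i-j|\le|k-l|$) such that $$\sum_{r\ge1}\frac{\log\log(r+4)}{r^3J(r)}<\infty,$$ then there are multiple consistent measures at low temperatures and only one at high temperatures; that is, $|\mathcal{G}(f^{\beta})|>1$ for all sufficiently large $\beta$ and $|\mathcal{G}(f^{\beta})|=1$ for all sufficiently small $\beta>0$. (b) If $$\sum_{j\ge1}\exp\Big[-C\sum_{r\ge1}(j\wedge r)\,J(r)\Big]=\infty\qquad\text{for all }C>0,$$ then there is a unique consistent chain at all temperatures, i.e. $|\mathcal{G}(f^{\beta})|=1$ for all $\beta>0$.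
   Context: $\Omega=\{-1,1\}^{\mathbb{L}}$ carries the product topology and product $\sigma$-algebra $\mathcal F$; $\mathcal{F}_{\le i}$ is generated by coordinates $\le i$. $\omega_k^n=\omega_{[k,n]}$, $\Omega_k^n=\{-1,1\}^{[k,n]}$, $\omega_{-\infty}^n=\omega_{(-\infty,n]}$; juxtaposition denotes concatenation. $j\wedge r=\min(j,r)$. The couplings are real numbers $J(i,j)=J(j,i)$, $i\ne j\in\mathbb{L}$, with $\sum_{j}|J(i,j)|<\infty$ for each $i\in\mathbb{L}$. The long-range Ising potential at inverse temperature $\beta$ is $\phi_A(\omega)=-\beta J(i,j)\omega_i\omega_j$ if $A=\{i,j\}$ with $i\neq j$, and $\phi_A=0$ for all other finite $A\subset\mathbb{L}$. The Ising LSS $f^{\beta}=\{f_i\}_{i\in\mathbb{L}}$ is the family of transition probabilities $$f_i(\omega_i\mid\omega_{-\infty}^{i-1})=\frac{\sum_{\sigma_{i+1}^0\in\Omega_{i+1}^0}\exp\big[-\sum_{A\cap[i,0]\neq\emptyset}\phi_A(\sigma_{i+1}^0\,\omega_{-\infty}^i)\big]}{\sum_{\sigma_i^0\in\Omega_i^0}\exp\big[-\sum_{A\cap[i,0]\neq\emptyset}\phi_A(\sigma_i^0\,\omega_{-\infty}^{i-1})\big]}$$ (sums in the exponents over finite $A\subset\mathbb{L}$; for $i=0$ the numerator has the single term with configuration $\omega$). A left singleton-specification (LSS) is a family of probability kernels $f_i:\mathcal{F}_{\le i}\times\Omega\to[0,1]$, $i\in\mathbb{L}$, with $f_i(A\mid\cdot)$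 $\mathcal{F}_{\le i-1}$-measurable for $A\in\mathcal{F}_{\le i}$ and $f_i(B\mid\cdot)=\mathbf{1}_B$ for $B\in\mathcal{F}_{\le i-1}$; it is determined by the single-site probabilities above. $\mathcal{G}(f)$ is the set of consistent measures (''chains''): probability measures $\mu$ on $(\Omega,\mathcal{F})$ with $\mu f_i=\mu$ over $\mathcal{F}_{\le i}$ for every $i\in\mathbb{L}$, where $(\mu f_i)(h)=\int f_i(h\mid\omega)\,\mu(d\omega)$. *)

(* Defs.v *)
From mathcomp Require Import all_boot all_order all_algebra finmap.
From mathcomp Require Import all_classical all_reals all_analysis.

Set Implicit Arguments.
Unset Strict Implicit.
Unset Printing Implicit Defensive.

Import Order.TTheory GRing.Theory Num.Theory.
Import numFieldNormedType.Exports.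

Local Open Scope classical_set_scope.
Local Open Scope ring_scope.

(* The half-line {..., -2, -1, 0} is encoded by nat: [n : site] stands for the
   integer -n.  Distances are unchanged and the order is reversed: "j is to the
   left of or at i" reads [(i <= j)%N], and the interval [i, 0] is
   [{0, ..., i}].  *)
Definition site := nat.

Definition dist (i j : site) : nat := `|i%:Z - j%:Z|%N.

(* [true] encodes the spin +1 and [false] the spin -1. *)
Definition config := site -> bool.

Definition spin {R : pzRingType} (b : bool) : R := if b then 1 else -1.

Definition cylinders (S : set site) : set (set config) :=
  [set B | exists2 j, S j & exists s, B = [set w | w j = s]].

Notation Omega := (g_sigma_algebraType (cylinders setT)).

(* The coordinates j with [(i <= j)%N] are those to the left of or at i. *)
Definition F_le (i : site) : set (set Omega) :=
  <<s cylinders [set j | (i <= j)%N] >>.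

(* The concatenation of [t], living on the n rightmost sites, with the
   restriction of [w] to the sites on their left. *)
Definition concat (n : nat) (t : {ffun 'I_n -> bool}) (w : config) : config :=
  fun j => if insub j is Some k then t k else w j.

Definition set_spin (w : config) (i : site) (s : bool) : config :=
  fun j => if j == i then s else w j.

(* Unconditional sum of a real family over D; meaningful when the family is
   absolutely summable on D. *)
Definition abs_sum {R : realType} {T : choiceType} (D : set T) (u : T -> R) : R :=
  fine (\esum_(x in D) (Num.max (u x) 0)%:E) -
  fine (\esum_(x in D) (Num.max (- u x) 0)%:E).

(* An [{fset site}] is listed without repetition, so the first case is
   A = {i, j} with i != j; the order of the list is immaterial as J is assumed
   symmetric. *)
Definition ising_potential {R : realType} (J : site -> site -> R) (beta : R)
    (A : {fset site}) (w : config) : R :=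
  if enum_fset A is [:: i; j] then - beta * J i j * spin (w i) * spin (w j)
  else 0.

Definition energy {R : realType} (Phi : {fset site} -> config -> R) (i : site)
    (w : config) : R :=
  abs_sum [set A : {fset site} | exists2 j, j \in A & (j <= i)%N]
    (fun A => Phi A w).

Definition boltzmann_sum {R : realType} (Phi : {fset site} -> config -> R)
    (i : site) (n : nat) (w : config) : R :=
  \sum_(t : {ffun 'I_n -> bool}) expR (- energy Phi i (concat t w)).

(* [single_site Phi i w] is the probability of [w i] given the spins of [w] to
   the left of i: there are i sites to the right of i, and i.+1 sites to the
   right of or at i. *)
Definition single_site {R : realType} (Phi : {fset site} -> config -> R)
    (i : site) (w : config) : R :=
  boltzmann_sum Phi i i w / boltzmann_sum Phi i i.+1 w.

(* The kernels determined by single-site probabilities; [kernels g i A w] is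
   to be used for A in [F_le i]. *)
Definition kernels {R : realType} (g : site -> config -> R)
    (i : site) (A : set Omega) (w : Omega) : R :=
  \sum_(s : bool) g i (set_spin w i s) * \1_A (set_spin w i s).

Definition ising_LSS {R : realType} (J : site -> site -> R) (beta : R) :
    site -> set Omega -> Omega -> R :=
  kernels (single_site (ising_potential J beta)).

Definition chains {R : realType} (f : site -> set Omega -> Omega -> R) :
    set (probability Omega R) :=
  [set mu | forall (i : site) (A : set Omega), F_le i A ->
     (\int[mu]_w (f i A w)%:E = mu A)%E].

(* A [probability Omega R] also assigns unspecified values to non-measurable
   sets, so measures are compared on measurable sets only. *)
Definition same_measure {R : realType} (mu nu : probability Omega R) : Prop :=
  forall A : set Omega, measurable A -> mu A = nu A.

Definition unique_chain {R : realType}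
    (f : site -> set Omega -> Omega -> R) : Prop :=
  exists2 mu, chains f mu & forall nu, chains f nu -> same_measure mu nu.

Definition multiple_chains {R : realType}
    (f : site -> set Omega -> Omega -> R) : Prop :=
  exists mu nu, [/\ chains f mu, chains f nu & ~ same_measure mu nu].

(* J(r); possibly +oo when J is not translation invariant. *)
Definition Jsup {R : realType} (J : site -> site -> R) (r : nat) : \bar R :=
  ereal_sup [set x | exists i j, dist i j = r /\ x = `|J i j|%:E].

(* Only the values of J off the diagonal are constrained (and used). *)
Definition couplings {R : realType} (J : site -> site -> R) : Prop :=
  (forall i j, i != j -> J i j = J j i) /\
  (forall i, summable [set j | j != i] (fun j => (J i j)%:E)).

Definition ferromagnetic {R : realType} (J : site -> site -> R) : Prop :=
  forall i j, i != j -> 0 <= J i j.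

Definition decreasing_couplings {R : realType} (J : site -> site -> R) : Prop :=
  forall i j k l, i != j -> k != l -> (dist i j <= dist k l)%N ->
    J k l <= J i j.

(* Extended-real arithmetic: a vanishing J(r) contributes 0^-1 = +oo. *)
Definition Dyson_series {R : realType} (J : site -> site -> R) : \bar R :=
  (\sum_(1 <= r <oo)
     (ln (ln (r%:R + 4)))%:E / ((r%:R ^+ 3)%:E * Jsup J r))%E.

(* J(r) = +oo for some r makes every term [expeR -oo = 0]. *)
Definition exp_series {R : realType} (J : site -> site -> R) (C : R) : \bar R :=
  (\sum_(1 <= j <oo)
     expeR (- (C%:E * \sum_(1 <= r <oo) (minn j r)%:R%:E * Jsup J r)))%E.

(* Main.v *)
(* A measure is a chain of the Ising LSS exactly when it satisfies the DLR
   equations of the Gibbs averages [gam n] of the windows {0, ..., n-1}, so both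
   uniqueness statements follow from the vanishing, as n grows, of the
   oscillation of [gam n h] for every local h.

   (b) Put D j = beta sum_r (j /\ r) J(r), up to a constant.  Exploring the
   window site by site from the left, the relative entropy between the laws
   under two exteriors which agree on the next k sites is controlled by D.  Hence
   these laws keep a common part of order exp (- C D k), and the oscillations p j
   of [gam j h] satisfy a renewal inequality
   exp (- C D N) p 0 <= K sum_l (p l - p (l+1)) exp (- C D (N - l - 1)).
   Summed over N, the divergence of sum_k exp (- C D k) forces p to decrease by
   a fixed factor, and this can be iterated.

   (a) At high temperature a Dobrushin comparison applies.  At low temperature
   the Griffiths inequalities, in Ginibre's form, show that the Gibbs averages
   with plus exterior converge and that their magnetization at 0 dominates the
   two-point functions between 0 and exterior sites of a hierarchical model on
   dyadic blocks, with couplings below J.  In Dyson's model the second moment of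
   the block average loses at most eps p at scale p, where
   eps p = 1 / (2 (p+4)^2) + 20 log (p+4) / t p
   and t p is the interaction strength; the hypothesis on J makes the sum of the
   eps p at most 1/4 for large beta.  The magnetization is then at least 1/2, and
   the spin flip gives a second chain. *)

Require Import Defs.
From mathcomp Require Import all_boot all_order all_algebra finmap.
From mathcomp Require Import all_classical all_reals all_analysis.
From mathcomp Require Import measurable_realfun ring lra zify.
Import Order.TTheory GRing.Theory Num.Theory.
Import numFieldNormedType.Exports.
Local Open Scope classical_set_scope.
Local Open Scope ring_scope.
Set Implicit Arguments.
Unset Strict Implicit.
Unset Printing Implicit Defensive.

(** * Sums over spins *)

(** Part (b): relative entropy bounds only the mean of a log-likelihood ratio, while a common part
    of two laws needs the mean of a concave, truncated function of the ratio. A truncation with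
    bounded curvature is chosen, so that each step of the exploration is paid by the entropy gained
    in that step. Since only the divergence of a series is known, and no rate, volumes are enlarged
    until the tail of the series outweighs its beginning, and each enlargement gains the same
    factor. Part (a): the hierarchical model is invariant under the spin flip and has no
    magnetization of its own. Its two-point functions do carry information: a distant spin acts on
    the window as an exterior, and every exterior is dominated by the plus one. A pair of sites
    feels all the scales at which it shares a block, yet the total has to stay below one coupling of
    J. Hence the interaction strengths may at most double from one scale to the next. Logarithms
    grow more slowly than that, so the summability assumed for J survives the reduction. *)

Section SpinSums.
Context {R : realType}.
Implicit Types (F G h : config -> R) (s : seq site) (w x y : config).

Lemma set_spin_at w i b : set_spin w i b i = b.
Proof. by rewrite /set_spin eqxx. Qed.

Lemma set_spin_neq w i b j : j != i -> set_spin w i b j = w j.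
Proof. by rewrite /set_spin => /negbTE ->. Qed.

Lemma set_spin_id w i : set_spin w i (w i) = w.
Proof. by apply/funext => j; rewrite /set_spin; case: eqP => [->|]. Qed.

Lemma set_spin_twice w i b c : set_spin (set_spin w i b) i c = set_spin w i c.
Proof. by apply/funext => j; rewrite /set_spin; case: eqP. Qed.

Lemma set_spinC w i j b c : i != j ->
  set_spin (set_spin w i b) j c = set_spin (set_spin w j c) i b.
Proof.
move=> ij; apply/funext => k; rewrite /set_spin.
by case: (eqVneq k j) => // ->; rewrite eq_sym (negbTE ij).
Qed.

(** Iterated sums, so that sites can be summed out one at a time and reordered; outside s the
    configuration w is kept. *)
Fixpoint ssum s F w : R :=
  if s is a :: s' then
    ssum s' F (set_spin w a true) + ssum s' F (set_spin w a false)
  else F w.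

Lemma ssum_cat s1 s2 F w : ssum (s1 ++ s2) F w = ssum s1 (ssum s2 F) w.
Proof. by elim: s1 w => //= a s1 IH w; rewrite !IH. Qed.

Lemma ssumD s F G w : ssum s (fun u => F u + G u) w = ssum s F w + ssum s G w.
Proof. by elim: s w => //= a s IH w; rewrite !IH addrACA. Qed.

Lemma ssumZ s c F w : ssum s (fun u => c * F u) w = c * ssum s F w.
Proof. by elim: s w => //= a s IH w; rewrite !IH mulrDr. Qed.

Lemma ssumZr s c F w : ssum s (fun u => F u * c) w = ssum s F w * c.
Proof. by elim: s w => //= a s IH w; rewrite !IH mulrDl. Qed.

Lemma ssumN s F w : ssum s (fun u => - F u) w = - ssum s F w.
Proof. by elim: s w => //= a s IH w; rewrite !IH opprD. Qed.

Lemma ssumB s F G w : ssum s (fun u => F u - G u) w = ssum s F w - ssum s G w.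
Proof. by rewrite ssumD ssumN. Qed.

Lemma ssum_sum (I : Type) (r : seq I) (P : pred I) s (F : I -> config -> R) w :
  ssum s (fun u => \sum_(i <- r | P i) F i u) w =
  \sum_(i <- r | P i) ssum s (F i) w.
Proof.
elim: s w => //= a s IH w; rewrite !IH.
by rewrite -big_split.
Qed.

Lemma ssum_le s F G w :
  (forall u, (forall j, j \notin s -> u j = w j) -> F u <= G u) ->
  ssum s F w <= ssum s G w.
Proof.
elim: s w => [|a s IH] w FG /=; first exact: FG.
have H b : ssum s F (set_spin w a b) <= ssum s G (set_spin w a b).
  apply: IH => u ue; apply: FG => j; rewrite inE negb_or => /andP[ja js].
  by rewrite ue// set_spin_neq.
exact: lerD.
Qed.

Lemma ssum_eq s F G w :
  (forall u, (forall j, j \notin s -> u j = w j) -> F u = G u) ->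
  ssum s F w = ssum s G w.
Proof.
by move=> FG; apply/eqP; rewrite eq_le !ssum_le// => u /FG ->.
Qed.

Lemma eq_ssum s F G w : F =1 G -> ssum s F w = ssum s G w.
Proof. by move=> /funext ->. Qed.

Lemma ssum_ge0 s F w :
  (forall u, (forall j, j \notin s -> u j = w j) -> 0 <= F u) ->
  0 <= ssum s F w.
Proof.
move=> F0; rewrite -(mul0r (ssum s F w)) -ssumZ; apply: ssum_le => u uw.
by rewrite mul0r F0.
Qed.

Lemma ssum_gt0 s F w : (forall u, 0 < F u) -> 0 < ssum s F w.
Proof. by move=> F0; elim: s w => //= a s IH w; rewrite addr_gt0. Qed.

Lemma ssum_off s F w w' :
  (forall j, j \notin s -> w j = w' j) -> ssum s F w = ssum s F w'.
Proof.
elim: s w w' => [|a s IH] w w' ww' /=.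
  by congr F; apply/funext => j; apply: ww'.
have H b : ssum s F (set_spin w a b) = ssum s F (set_spin w' a b).
  apply: IH => j js; rewrite /set_spin; case: eqP => // /eqP ja.
  by apply: ww'; rewrite inE negb_or ja.
by rewrite !H.
Qed.

Lemma ssum_swap a b s F w : ssum (a :: b :: s) F w = ssum (b :: a :: s) F w.
Proof.
case: (eqVneq a b) => [->//|ab] /=.
rewrite !(set_spinC w _ _ ab); rewrite -!addrA; congr (_ + _).
by rewrite addrCA.
Qed.

Lemma ssumC s1 s2 F w : ssum (s1 ++ s2) F w = ssum (s2 ++ s1) F w.
Proof.
have ins a s t G v : ssum (a :: s ++ t) G v = ssum (s ++ a :: t) G v.
  elim: s v => // c s IH v.
  rewrite cat_cons ssum_swap.
  rewrite [LHS]/= [RHS]/=.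
  by rewrite -!IH.
elim: s1 s2 w => [|a s1 IH] s2 w; first by rewrite cats0.
rewrite -ins /=.
by rewrite !IH.
Qed.

Lemma ssum_perm s t F w : perm_eq s t -> ssum s F w = ssum t F w.
Proof.
rewrite perm_sym => ts.
have := @catCA_perm_ind _ (fun s => ssum s F w = ssum t F w) _ t s ts erefl.
by apply=> s1 s2 s3 <-; rewrite !catA !(ssum_cat (_ ++ _)) ssumC.
Qed.

Lemma ssum_exch s t (F : config -> config -> R) w w' :
  ssum s (fun u => ssum t (F u) w') w =
  ssum t (fun v => ssum s (fun u => F u v) w) w'.
Proof.
elim: s w => //= a s IH w; rewrite !IH -ssumD.
by [].
Qed.

Lemma ssum_cst s c w : ssum s (fun=> c) w = c * 2 ^+ size s.
Proof.
elim: s w => [|a s IH] w /=; first by rewrite expr0 mulr1.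
by rewrite !IH exprS; ring.
Qed.

(** Both values of the spin at i occur among the summed configurations. The invariance of Gibbs
    averages under the heat bath at i rests on this. *)
Lemma ssum_avg s F w i : i \in s ->
  ssum s F w =
  ssum s (fun u => (F (set_spin u i true) + F (set_spin u i false)) / 2) w.
Proof.
move=> si; rewrite !(ssum_perm _ _ (perm_to_rem si)).
set t := rem i s; rewrite /=.
have H G : ssum t G (set_spin w i true) + ssum t G (set_spin w i false) =
   ssum (i :: t) G w by [].
pose G u := (F (set_spin u i true) + F (set_spin u i false)) / 2.
have gG u b : G (set_spin u i b) = G u by rewrite /G !set_spin_twice.
have H2 : ssum (i :: t) F w = ssum (i :: t) G w.
  have -> : i :: t = [:: i] ++ t by [].
  rewrite !(ssumC [:: i]) !ssum_cat; apply: eq_ssum => u /=.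
  by rewrite !gG /G; lra.
exact: H2.
Qed.

(** The leftmost site comes first: [ssum] over [vol n.+1] fixes the spin at n before those to its
    right, which is the order of the exploration. *)
Fixpoint vol (n : nat) : seq site := if n is m.+1 then m :: vol m else [::].

Lemma mem_vol n i : (i \in vol n) = (i < n)%N.
Proof. by elim: n => //= n IH; rewrite inE IH [in RHS]ltnS (leq_eqVlt i). Qed.

Lemma vol_uniq n : uniq (vol n).
Proof. by elim: n => //= n ->; rewrite mem_vol ltnn. Qed.

Lemma vol_perm n : perm_eq (vol n) (iota 0 n).
Proof.
apply: uniq_perm; rewrite ?vol_uniq ?iota_uniq// => i.
by rewrite mem_vol mem_iota.
Qed.

Lemma concat0 (t : {ffun 'I_0 -> bool}) w : concat t w = w.
Proof. by apply/funext => j; rewrite /concat insubF. Qed.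

Lemma concatS n (t : {ffun 'I_n.+1 -> bool}) w :
  concat t w =
  concat [ffun i : 'I_n => t (widen_ord (leqnSn n) i)]
         (set_spin w n (t ord_max)).
Proof.
apply/funext => j; rewrite /concat /set_spin; case: insubP => [k _ jk|].
  case: insubP => [l _ jl|].
    by rewrite ffunE; congr (t _); apply: val_inj => /=; rewrite jk jl.
  rewrite -leqNgt => nj; have -> : k = ord_max.
    by apply: val_inj => /=; apply/eqP; rewrite eqn_leq jk nj -jk -ltnS ltn_ord.
  by rewrite eqn_leq nj -jk -ltnS ltn_ord.
rewrite -leqNgt => nj; rewrite insubF; last by rewrite ltnNge ltnW.
by rewrite gtn_eqF.
Qed.

Lemma sum_concat n F w :
  \sum_(t : {ffun 'I_n -> bool}) F (concat t w) = ssum (vol n) F w.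
Proof.
elim: n w => [|n IH] w.
  rewrite (big_pred1 [ffun=> true])/= ?concat0// => t.
  by apply/esym/eqP/ffunP => -[].
pose p (t : {ffun 'I_n.+1 -> bool}) :=
  (t ord_max, [ffun i : 'I_n => t (widen_ord (leqnSn n) i)]).
pose q (bt : bool * {ffun 'I_n -> bool}) : {ffun 'I_n.+1 -> bool} :=
  [ffun i : 'I_n.+1 => if insub (i : nat) is Some k then bt.2 k else bt.1].
have qK : cancel q p.
  move=> [b t]; rewrite /p /q; congr pair; first by rewrite ffunE insubF//= ltnn.
  apply/ffunP => i; rewrite !ffunE /=.
  by rewrite insubT// => ?; congr (t _); apply: val_inj.
have pK : cancel p q.
  move=> t; apply/ffunP => i; rewrite ffunE /=; case: insubP => [k _ ki|].
    by rewrite ffunE; congr (t _); apply: val_inj.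
  by rewrite -leqNgt => ni; congr (t _); apply: val_inj; apply/eqP;
    rewrite /= eqn_leq ni -ltnS ltn_ord.
rewrite (reindex q); last by exists p => ? _; [exact: qK|exact: pK].
rewrite (eq_bigr (fun bt => F (concat bt.2 (set_spin w n bt.1)))); last first.
  move=> [b t] _; rewrite concatS; have := qK (b, t); rewrite /p => -[h1 h2].
  by rewrite h1 h2.
rewrite -(pair_bigA _ (fun b t => F (concat t (set_spin w n b))))/=.
rewrite big_bool /=.
by rewrite !IH.
Qed.

End SpinSums.

(** * Gibbs averages in finite windows *)

Section ContinuousFunctions.
Context {R : realType}.
Implicit Types (F G h : config -> R) (s : seq site) (w x y : config).

Definition agree (N : nat) x y := forall j, (j < N)%N -> x j = y j.

Definition same_from (N : nat) x y := forall j, (N <= j)%N -> x j = y j.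

(** Uniform continuity for the product topology, which on this compact space is plain continuity. *)
Definition cont h := forall eps, 0 < eps ->
  exists N, forall x y, agree N x y -> `|h x - h y| <= eps.

Definition local m h := forall x y, agree m x y -> h x = h y.

Definition from k h := forall x y, same_from k x y -> h x = h y.

Lemma agree_sym N x y : agree N x y -> agree N y x.
Proof. by move=> xy j /xy. Qed.

Lemma agree_le M N x y : (M <= N)%N -> agree N x y -> agree M x y.
Proof. by move=> MN xy j jM; apply: xy; rewrite (leq_trans jM). Qed.

Lemma same_from_sym N x y : same_from N x y -> same_from N y x.
Proof. by move=> xy j /xy. Qed.

Lemma same_from_set_spin N x b : same_from N.+1 (set_spin x N b) x.
Proof. by move=> j Nj; rewrite set_spin_neq// gtn_eqF. Qed.

Lemma local_cont m h : local m h -> cont h.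
Proof. by move=> hm e e0; exists m => x y /hm ->; rewrite subrr normr0 ltW. Qed.

Lemma cont_cst c : cont (fun=> c).
Proof. by apply: (@local_cont 0). Qed.

Lemma contD F G : cont F -> cont G -> cont (fun w => F w + G w).
Proof.
move=> cF cG e e0.
have [N HN] := cF (e / 2) ltac:(by rewrite divr_gt0).
have [M HM] := cG (e / 2) ltac:(by rewrite divr_gt0).
exists (maxn M N) => x y xy.
have := HN x y (agree_le (leq_maxr _ _) xy).
have := HM x y (agree_le (leq_maxl _ _) xy).
rewrite !ler_norml => /andP[? ?] /andP[? ?]; apply/andP; split; lra.
Qed.

(** Outside a finite window F varies by at most 1, and on the patterns of the window the sum of all
    absolute values exceeds each of them. *)
Lemma cont_bounded F : cont F -> exists2 B, 0 < B & forall w, `|F w| <= B.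
Proof.
move=> cF; have [N HN] := cF 1 ltr01.
exists (ssum (vol N) (fun u => `|F u|) (fun=> true) + 1).
  rewrite ltr_wpDl//; exact: ssum_ge0.
move=> w.
have key s : exists u, (forall j, j \in s -> u j = w j) /\
    `|F u| <= ssum s (fun u => `|F u|) (fun=> true).
  suff H w0 : exists u, [/\ (forall j, j \in s -> u j = w j),
      (forall j, j \notin s -> u j = w0 j) &
      `|F u| <= ssum s (fun u => `|F u|) w0].
    by have [u [? _ ?]] := H (fun=> true); exists u.
  elim: s w0 => [|a s IH] w0 /=; first by exists w0.
  have [u [u1 u2 u3]] := IH (set_spin w0 a (w a)).
  exists u; split.
  - move=> j; rewrite inE => /orP[/eqP ->|/u1//].
    have [/u1//|/u2 ->] := boolP (a \in s); first by rewrite set_spin_at.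
  - move=> j; rewrite inE negb_or => /andP[ja /u2 ->].
    by rewrite set_spin_neq.
  - have P b : 0 <= ssum s (fun u => `|F u|) (set_spin w0 a b).
      by apply: ssum_ge0.
    by case: (w a) u3 => u3; apply: (le_trans u3); rewrite ?lerDl ?lerDr P.
have [u [u1 u2]] := key (vol N).
have := HN w u; rewrite /agree => /(_ _)/wrap[].
  by move=> j jN; rewrite u1// mem_vol.
move=> wu; rewrite -(subrK (F u) (F w)) addrC.
by apply: (le_trans (ler_normD _ _)); rewrite lerD.
Qed.

Lemma contM F G : cont F -> cont G -> cont (fun w => F w * G w).
Proof.
move=> cF cG e e0.
have [A A0 HA] := cont_bounded cF; have [B B0 HB] := cont_bounded cG.
have [N HN] := cF (e / 2 / B) ltac:(by rewrite !divr_gt0).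
have [M HM] := cG (e / 2 / A) ltac:(by rewrite !divr_gt0).
exists (maxn M N) => x y xy.
have h1 := HN x y (agree_le (leq_maxr _ _) xy).
have h2 := HM x y (agree_le (leq_maxl _ _) xy).
have -> : F x * G x - F y * G y = (F x - F y) * G x + F y * (G x - G y) by ring.
apply: (le_trans (ler_normD _ _)); rewrite !normrM.
have -> : e = (e / 2 / B) * B + A * (e / 2 / A).
  by field; rewrite !gt_eqF.
by apply: lerD; apply: ler_pM.
Qed.

Lemma contZ c F : cont F -> cont (fun w => c * F w).
Proof. by apply: contM; exact: cont_cst. Qed.

Lemma cont_sum (I : Type) (r : seq I) (P : pred I) (F : I -> config -> R) :
  (forall i, P i -> cont (F i)) -> cont (fun w => \sum_(i <- r | P i) F i w).
Proof.
move=> cF; elim: r => [|i r IH].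
  by under eq_fun do rewrite big_nil; exact: cont_cst.
have -> : (fun w => \sum_(j <- i :: r | P j) F j w) =
  (fun w => (if P i then F i w else 0) + \sum_(j <- r | P j) F j w).
  by apply/funext => w; rewrite big_cons; case: ifP => // _; rewrite add0r.
apply: contD => //; case: (P i) (cF i) => [/(_ isT)//|_]; exact: cont_cst.
Qed.

Lemma cont_set_spin F i b : cont F -> cont (fun w => F (set_spin w i b)).
Proof.
move=> cF e e0; have [N HN] := cF e e0; exists N => x y xy.
by apply: HN => j jN; rewrite /set_spin; case: eqP => // _; exact: xy.
Qed.

Lemma cont_ssum s F : cont F -> cont (ssum s F).
Proof.
by move=> cF; elim: s => //= a s IH; apply: contD; exact: cont_set_spin.
Qed.

Lemma expR_lip (a b B : R) : a <= B -> b <= B ->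
  `|expR a - expR b| <= expR B * `|a - b|.
Proof.
wlog ab : a b / b <= a.
  move=> H aB bB; have [/H|/ltW/H] := leP b a; first exact.
  by rewrite distrC (distrC a) => ->.
move=> aB _; rewrite !ger0_norm ?subr_ge0 ?ler_expR//.
have -> : expR a - expR b = expR a * (1 - expR (b - a)).
  by rewrite mulrBr mulr1 -expRD addrCA subrr addr0.
apply: ler_pM; rewrite ?expR_ge0 ?ler_expR ?subr_ge0//.
  by rewrite -[leRHS]expR0 ler_expR subr_le0.
by have := expR_ge1Dx (b - a); lra.
Qed.

Lemma cont_expR F : cont F -> cont (fun w => expR (F w)).
Proof.
move=> cF e e0; have [B B0 HB] := cont_bounded cF.
have [N HN] := cF (e / expR B) ltac:(by rewrite divr_gt0// expR_gt0).
exists N => x y xy.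
have FB w : F w <= B by rewrite (le_trans (ler_norm _))// HB.
apply: (le_trans (expR_lip (FB x) (FB y))).
have -> : e = expR B * (e / expR B).
  by rewrite mulrCA divff ?mulr1// gt_eqF// expR_gt0.
by rewrite ler_pM2l ?expR_gt0// HN.
Qed.

Lemma cont_inv F c : 0 < c -> (forall w, c <= F w) -> cont F ->
  cont (fun w => (F w)^-1).
Proof.
move=> c0 cF cF' e e0.
have [N HN] := cF' (e * c ^+ 2) ltac:(by rewrite mulr_gt0// exprn_gt0).
exists N => x y xy.
have F0 w : 0 < F w by exact: lt_le_trans (cF w).
have -> : (F x)^-1 - (F y)^-1 = (F y - F x) * ((F x)^-1 * (F y)^-1).
  by field; rewrite !gt_eqF.
have P : 0 <= (F x)^-1 * (F y)^-1 by rewrite mulr_ge0// invr_ge0 ltW.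
rewrite normrM (ger0_norm P).
rewrite -invfM ler_pdivrMr ?mulr_gt0// distrC.
apply: (le_trans (HN x y xy)); rewrite ler_pM2l// expr2.
by apply: ler_pM => //; exact: ltW.
Qed.

End ContinuousFunctions.

Section Averages.
Context {R : realType}.
Variable e : nat -> config -> R.
Hypothesis e_from : forall k, from k (e k).
Implicit Types (F G h : config -> R) (s : seq site) (w x y : config).

(* [e k] stands for minus the energy between site k and the sites to its left. *)
Definition H (n : nat) w : R := \sum_(k < n) e k w.

Definition Z n w : R := ssum (vol n) (fun u => expR (H n u)) w.

Definition gam n h w : R := ssum (vol n) (fun u => h u * expR (H n u)) w / Z n w.

(** The law of the spin at n given the sites to its left. Summing out the sites to its right leaves
    [Z n], because [e n] does not depend on them. *)
Definition g n w : R := expR (e n w) * Z n w / Z n.+1 w.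

Lemma Z_gt0 n w : 0 < Z n w.
Proof. by apply: ssum_gt0 => u; exact: expR_gt0. Qed.

Lemma g_gt0 n w : 0 < g n w.
Proof. by rewrite divr_gt0 ?mulr_gt0 ?expR_gt0 ?Z_gt0. Qed.

Lemma ssum_vol_same n F x y : same_from n x y -> ssum (vol n) F x = ssum (vol n) F y.
Proof.
by move=> xy; apply: ssum_off => j; rewrite mem_vol -leqNgt; exact: xy.
Qed.

Lemma ssum_vol_eq n F G w :
  (forall u, same_from n u w -> F u = G u) -> ssum (vol n) F w = ssum (vol n) G w.
Proof.
move=> FG; apply: ssum_eq => u uw; apply: FG => j nj.
by apply: uw; rewrite mem_vol -leqNgt.
Qed.

Lemma Z_from n : from n (Z n).
Proof. by move=> x y xy; exact: ssum_vol_same. Qed.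

Lemma gam_from n h : from n (gam n h).
Proof. by move=> x y xy; rewrite /gam (ssum_vol_same _ xy) (Z_from xy). Qed.

Lemma HS n w : H n.+1 w = H n w + e n w.
Proof. by rewrite /H big_ord_recr. Qed.

Lemma ssum_volS n F w : ssum (vol n.+1) (fun u => F u * expR (H n.+1 u)) w =
  expR (e n (set_spin w n true)) *
    ssum (vol n) (fun u => F u * expR (H n u)) (set_spin w n true) +
  expR (e n (set_spin w n false)) *
    ssum (vol n) (fun u => F u * expR (H n u)) (set_spin w n false).
Proof.
have E b : ssum (vol n) (fun u => F u * expR (H n.+1 u)) (set_spin w n b) =
  expR (e n (set_spin w n b)) *
    ssum (vol n) (fun u => F u * expR (H n u)) (set_spin w n b).
  rewrite -ssumZ; apply: ssum_vol_eq => u uw.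
  by rewrite HS expRD (e_from uw); ring.
by rewrite -!E.
Qed.

Lemma ZS n w : Z n.+1 w =
  expR (e n (set_spin w n true)) * Z n (set_spin w n true) +
  expR (e n (set_spin w n false)) * Z n (set_spin w n false).
Proof.
have E m v : ssum (vol m) (fun u => 1 * expR (H m u)) v = Z m v.
  by apply: eq_ssum => u; rewrite mul1r.
by rewrite -!E ssum_volS.
Qed.

Lemma g_set n w b : g n (set_spin w n b) =
  expR (e n (set_spin w n b)) * Z n (set_spin w n b) / Z n.+1 w.
Proof. by rewrite /g (Z_from (same_from_set_spin w b)). Qed.

Lemma g_sum1 n w : g n (set_spin w n true) + g n (set_spin w n false) = 1.
Proof. by rewrite !g_set -mulrDl -ZS divff// gt_eqF// Z_gt0. Qed.

Lemma gamS n h w : gam n.+1 h w =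
  g n (set_spin w n true) * gam n h (set_spin w n true) +
  g n (set_spin w n false) * gam n h (set_spin w n false).
Proof.
rewrite /gam ssum_volS !g_set.
have := Z_gt0 n.+1 w; have := Z_gt0 n (set_spin w n true).
have := Z_gt0 n (set_spin w n false) => z1 z2 z3.
by field; rewrite !gt_eqF.
Qed.

Lemma gam0 h w : gam 0 h w = h w.
Proof. by rewrite /gam /Z /= /H big_ord0 expR0 mulr1 divr1. Qed.

Lemma gam_from_id n h w : from n h -> gam n h w = h w.
Proof.
move=> hn; rewrite /gam (_ : ssum _ _ _ = h w * Z n w).
  by rewrite mulfK// gt_eqF// Z_gt0.
by rewrite -ssumZ; apply: ssum_vol_eq => u /hn ->.
Qed.

Lemma gam_cst n c w : gam n (fun=> c) w = c.
Proof. by rewrite gam_from_id. Qed.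

Lemma gamD n F G w : gam n (fun u => F u + G u) w = gam n F w + gam n G w.
Proof.
by rewrite /gam -mulrDl -ssumD; congr (_ / _); apply: eq_ssum => u; ring.
Qed.

Lemma gamZ n c F w : gam n (fun u => c * F u) w = c * gam n F w.
Proof.
by rewrite /gam mulrA -ssumZ; congr (_ / _); apply: eq_ssum => u; ring.
Qed.

Lemma gamB n F G w : gam n (fun u => F u - G u) w = gam n F w - gam n G w.
Proof.
have -> : (fun u => F u - G u) = (fun u => F u + (-1) * G u).
  by apply/funext => u; ring.
by rewrite gamD gamZ mulN1r.
Qed.

Lemma gam_le n F G w : (forall u, same_from n u w -> F u <= G u) ->
  gam n F w <= gam n G w.
Proof.
move=> FG; rewrite /gam ler_pM2r ?invr_gt0 ?Z_gt0//.
apply: ssum_le => u uw; rewrite ler_pM2r ?expR_gt0//; apply: FG => j nj.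
by apply: uw; rewrite mem_vol -leqNgt.
Qed.

Lemma gam_tower n N h w : (n <= N)%N -> gam N (gam n h) w = gam N h w.
Proof.
elim: N w => [|N IH] w; first by rewrite leqn0 => /eqP ->; rewrite !gam0.
rewrite leq_eqVlt => /orP[/eqP ->|]; first by rewrite gam_from_id//; exact: gam_from.
by rewrite ltnS => nN; rewrite !gamS !IH.
Qed.

Hypothesis e_cont : forall k, cont (e k).

Lemma H_cont n : cont (H n).
Proof. by apply: cont_sum => i _. Qed.

Lemma Z_cont n : cont (Z n).
Proof. by apply: cont_ssum; apply: cont_expR; exact: H_cont. Qed.

Lemma Z_inv_cont n : cont (fun w => (Z n w)^-1).
Proof.
have [B B0 HB] := cont_bounded (@H_cont n).
apply: (@cont_inv _ _ (expR (- B))); rewrite ?expR_gt0//; last exact: Z_cont.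
move=> w; apply: (@le_trans _ _ (ssum (vol n) (fun=> expR (- B)) w)).
  rewrite ssum_cst ler_peMr ?expR_ge0// exprn_ege1//; lra.
by apply: ssum_le => u _; rewrite ler_expR; have := HB u; rewrite ler_norml => /andP[].
Qed.

Lemma gam_cont n h : cont h -> cont (gam n h).
Proof.
move=> ch; apply: contM; last exact: Z_inv_cont.
apply: cont_ssum; apply: contM => //.
by apply: cont_expR; exact: H_cont.
Qed.

End Averages.

(** * Chains and Gibbs averages *)

Section LocalEvents.

(** Induction on N: the event is split by the spin at N if N is in S, and does not depend on that
    spin otherwise. *)
Lemma local_event (S : set site) N (A : set config) :
  (forall x y, (forall j, (j < N)%N -> S j -> x j = y j) -> A x -> A y) ->
  <<s cylinders S >> A.
Proof.
pose T := g_sigma_algebraType (cylinders S).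
have mcyl j b : S j -> measurable ([set w | w j = b] : set T).
  by move=> Sj; apply: sub_sigma_algebra; exists j => //; exists b.
move=> HA; change (measurable (A : set T)).
elim: N A HA => [|N IH] A HA.
  have [Aw|Aw] := pselect (A (fun=> true)).
    rewrite (_ : A = setT) //; apply/seteqP; split=> // x _.
    exact: HA Aw.
  rewrite (_ : A = set0) //; apply/seteqP; split=> // x Ax.
  by apply: Aw; exact: HA Ax.
pose B b : set T := [set w | A (set_spin w N b)].
have mB b : measurable (B b).
  apply: IH => x y xy; apply: HA => j jN Sj.
  rewrite /set_spin; case: eqP => // /eqP jN'.
  by apply: xy => //; rewrite ltn_neqAle jN'.
have [SN|SN] := pselect (S N).
  rewrite (_ : A = (B true `&` [set w | w N = true]) `|`
                   (B false `&` [set w | w N = false])).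
    by apply: measurableU; apply: measurableI => //; exact: mcyl.
  apply/seteqP; split => x.
    move=> Ax; case xN : (x N); [left|right]; split => //=; rewrite /B/= -xN.
      by rewrite set_spin_id.
    by rewrite set_spin_id.
  by move=> [[+ /= xN]|[+ /= xN]]; rewrite /B/= -xN set_spin_id.
rewrite (_ : A = B true) //; apply/seteqP; split => x; apply: HA => j jN Sj;
  by rewrite set_spin_neq//; apply: contra_notN SN => /eqP <-.
Qed.

End LocalEvents.

Section Expectations.
Context {R : realType}.
Implicit Types (F G h : config -> R) (mu nu : probability Omega R).

Lemma local_measurable N h : local N h -> measurable_fun setT (h : Omega -> R).
Proof.
move=> hN _ Y mY; rewrite setTI.
apply: (@local_event setT N) => x y xy /=.
by rewrite (hN x y)// => j jN; exact: xy.
Qed.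

Definition trunc N (w : config) : config := fun j => if (j < N)%N then w j else true.

Lemma trunc_agree N w : agree N (trunc N w) w.
Proof. by move=> j jN; rewrite /trunc jN. Qed.

Lemma trunc_local N h : local N (fun w => h (trunc N w)).
Proof.
move=> x y xy; congr h; apply/funext => j; rewrite /trunc.
by case: ifP => // /xy.
Qed.

Lemma trunc_from k N h : from k h -> from k (fun w => h (trunc N w)).
Proof.
by move=> hk x y xy; apply: hk => j kj; rewrite /trunc; case: ifP => // _; exact: xy.
Qed.

Lemma cont_measurable h : cont h -> measurable_fun setT (h : Omega -> R).
Proof.
move=> ch.
apply: (measurable_fun_cvg (h := fun N (w : Omega) => h (trunc N w))).
  by move=> N; apply: local_measurable; exact: trunc_local.
move=> w _; apply/cvgrPdist_le => eps eps0.
have [N HN] := ch _ eps0; exists N => // M /= NM.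
by apply: HN; apply/agree_sym; apply: agree_le NM _; exact: trunc_agree.
Qed.

Definition Ex mu h : R := \int[mu]_w h w.

Lemma cont_integrable mu h : cont h -> mu.-integrable setT (EFin \o h).
Proof.
move=> ch; apply: measurable_bounded_integrable => //.
- by rewrite (le_lt_trans (probability_le1 _ _))// ltry.
- exact: cont_measurable.
- have [B B0 HB] := cont_bounded ch.
  exists B; split; first exact: num_real.
  by move=> M BM x _ /=; rewrite (le_trans (HB x))// ltW.
Qed.

Lemma ExE mu h : cont h -> (\int[mu]_w (h w)%:E)%E = (Ex mu h)%:E.
Proof.
move=> ch; rewrite /Ex /Rintegral fineK//.
by apply: integrable_fin_num => //; exact: cont_integrable.
Qed.

Lemma ExD mu F G : cont F -> cont G -> Ex mu (fun w => F w + G w) = Ex mu F + Ex mu G.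
Proof. by move=> cF cG; rewrite /Ex RintegralD//; exact: cont_integrable. Qed.

Lemma ExZ mu c F : cont F -> Ex mu (fun w => c * F w) = c * Ex mu F.
Proof. by move=> cF; rewrite /Ex RintegralZl//; exact: cont_integrable. Qed.

Lemma Ex_le mu F G : cont F -> cont G -> (forall w, F w <= G w) -> Ex mu F <= Ex mu G.
Proof.
by move=> cF cG FG; rewrite /Ex le_Rintegral//; exact: cont_integrable.
Qed.

Lemma Ex_cst mu c : Ex mu (fun=> c) = c.
Proof.
rewrite /Ex Rintegral_cst// -[RHS]mulr1; congr (_ * _).
by rewrite [X in fine X]probability_setT.
Qed.

Lemma Ex_near mu F G eps : cont F -> cont G ->
  (forall w, `|F w - G w| <= eps) -> `|Ex mu F - Ex mu G| <= eps.
Proof.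
move=> cF cG FG; rewrite ler_norml; apply/andP; split.
  rewrite lerBrDr addrC -(Ex_cst mu (-eps)) -ExD//; last exact: cont_cst.
  apply: Ex_le => // [|w]; first by apply: contD => //; exact: cont_cst.
  by have := FG w; rewrite ler_norml => /andP[? _]; lra.
rewrite lerBlDl -(Ex_cst mu eps) -ExD//; last exact: cont_cst.
apply: Ex_le => // [|w]; first by apply: contD => //; exact: cont_cst.
by have := FG w; rewrite ler_norml => /andP[_ ?]; lra.
Qed.

Definition local_set k N (A : set config) :=
  forall x y, (forall j, (j < N)%N -> (k <= j)%N -> x j = y j) -> A x -> A y.

Lemma local_set_sym k N A x y : local_set k N A ->
  (forall j, (j < N)%N -> (k <= j)%N -> x j = y j) -> A x <-> A y.
Proof. by move=> HA xy; split; apply: HA => // j jN kj; rewrite xy. Qed.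

Lemma local_indic k N A : local_set k N A ->
  local N (\1_A : config -> R) /\ from k (\1_A : config -> R).
Proof.
have P x y : A x <-> A y -> \1_A x = \1_A y :> R.
  move=> Axy; rewrite !indicE; congr (nat_of_bool _)%:R.
  by apply/idP/idP; rewrite !inE => /Axy.
move=> HA; split => x y xy; apply: P; apply: (local_set_sym HA) => j jN kj.
  exact: xy.
exact: xy.
Qed.

Lemma local_set_F k N A : local_set k N A -> F_le k A.
Proof.
move=> HA; apply: (@local_event _ N) => x y xy; apply: HA => j jN kj.
exact: xy.
Qed.

Lemma local_setI k A B N M : local_set k N A -> local_set k M B ->
  local_set k (maxn N M) (A `&` B).
Proof.
move=> HA HB x y xy [Ax Bx]; split.
  by apply: HA Ax => j jN; apply: xy; rewrite leq_max jN.
by apply: HB Bx => j jN; apply: xy; rewrite leq_max jN orbT.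
Qed.

Lemma local_set_cyl k j b : (k <= j)%N -> local_set k j.+1 [set w | w j = b].
Proof. by move=> kj x y xy /= <-; rewrite xy. Qed.

Lemma F_le_measurable k (A : set Omega) : F_le k A -> measurable A.
Proof.
move=> kA; apply: (sub_smallest2r (smallest_sigma_algebra _ _) _ kA).
by move=> B [j _ [b ->]]; exists j => //; exists b.
Qed.

(* Local events form a pi-system generating [F_le k]. *)
Lemma F_le_ind k (P : set (set Omega)) :
  lambda_system setT P -> (forall N A, local_set k N A -> P A) ->
  F_le k `<=` P.
Proof.
move=> lP locP.
pose G := [set A : set Omega | exists N, local_set k N A].
apply: (@subset_trans _ <<s G >>).
  apply: sub_smallest2r; first exact: smallest_sigma_algebra.
  move=> B [j /= kj [b ->]].
  by exists j.+1; exact: local_set_cyl.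
apply: lambda_system_subset => //.
  by move=> A B [N HA] [M HB]; exists (maxn N M); exact: local_setI.
by move=> A [N /locP].
Qed.

Lemma Ex_indic mu k N A : local_set k N A -> (Ex mu \1_A)%:E = mu A.
Proof.
move=> HA; have [/local_cont cA _] := local_indic HA.
rewrite -ExE// integral_indic// ?setIT//.
exact: F_le_measurable (local_set_F HA).
Qed.

Lemma same_measure_local mu nu :
  (forall N h, local N h -> Ex mu h = Ex nu h) -> same_measure mu nu.
Proof.
move=> E A mA.
suff : F_le 0 `<=` [set A : set Omega | measurable A /\ mu A = nu A].
  have F0 : F_le 0 A.
    apply: (sub_smallest2r (smallest_sigma_algebra _ _) _ mA).
    by move=> B [j _ [b ->]]; exists j => //; exists b.
  by move=> /(_ A F0)[].
apply: F_le_ind; last first.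
  move=> N B HB; split; first exact: F_le_measurable (local_set_F HB).
  have [lB _] := local_indic HB.
  by rewrite -(Ex_indic mu HB) -(Ex_indic nu HB) (E N).
split => //.
- split => //; apply: etrans (esym (@probability_setT _ _ _ nu)).
  exact: probability_setT.
- move=> B C CB [mB eB] [mC eC]; split; first exact: measurableD.
  rewrite !measureD//; last 2 first.
    by rewrite (le_lt_trans (probability_le1 _ _))// ltry.
    by rewrite (le_lt_trans (probability_le1 _ _))// ltry.
  by rewrite !(setIidr CB); congr (_ - _)%E.
- move=> F ndF mF.
  have mF' n : measurable (F n) by have [] := mF n.
  have mU : measurable (\bigcup_n F n) by exact: bigcupT_measurable.
  split => //.
  have c1 := nondecreasing_cvg_mu (mu := mu) mF' mU ndF.
  have c2 := nondecreasing_cvg_mu (mu := nu) mF' mU ndF.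
  have E2 : mu \o F = nu \o F by apply/funext => n /=; have [] := mF n.
  rewrite E2 in c1.
  by apply: (cvg_unique _ c1 c2).
Qed.

End Expectations.

Section Chains.
Context {R : realType}.
Variable e : nat -> config -> R.
Hypothesis e_from : forall k, from k (e k).
Hypothesis e_cont : forall k, cont (e k).
Implicit Types (F G h : config -> R) (mu nu : probability Omega R).

Lemma kernelsE i A w : kernels (g e) i A w =
  g e i (set_spin w i true) * \1_A (set_spin w i true) +
  g e i (set_spin w i false) * \1_A (set_spin w i false).
Proof. by rewrite /kernels big_bool. Qed.

Lemma kernels_gam k N A w : local_set k N A ->
  kernels (g e) k A w = gam e k.+1 \1_A w.
Proof.
move=> HA; have [_ fA] := @local_indic R _ _ _ HA.
by rewrite kernelsE gamS// !gam_from_id.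
Qed.

Lemma gam_near n F G eps w : (forall u, `|F u - G u| <= eps) ->
  `|gam e n F w - gam e n G w| <= eps.
Proof.
move=> FG; rewrite -gamB ler_norml; apply/andP; split.
  rewrite -(gam_cst e n (- eps) w); apply: gam_le => u _.
  by have := FG u; rewrite ler_norml => /andP[].
rewrite -[leRHS](gam_cst e n eps w); apply: gam_le => u _.
by have := FG u; rewrite ler_norml => /andP[].
Qed.

(** The definition of a chain speaks of events; linearity extends the identity to local functions
    and truncation to continuous ones. *)
Lemma chain_step mu k h : chains (kernels (g e)) mu -> cont h -> from k h ->
  Ex mu (gam e k.+1 h) = Ex mu h.
Proof.
move=> chmu.
have cg F : cont F -> cont (gam e k.+1 F) by move=> cF; exact: gam_cont.
have lin F G : cont F -> cont G -> Ex mu (gam e k.+1 F) = Ex mu F ->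
    Ex mu (gam e k.+1 G) = Ex mu G ->
    Ex mu (gam e k.+1 (fun w => F w + G w)) = Ex mu (fun w => F w + G w).
  move=> cF cG EF EG; rewrite ExD// -EF -EG -ExD//; try exact: cg.
  by congr Ex; apply/funext => w; rewrite gamD.
have ind N A : local_set k N A -> Ex mu (gam e k.+1 \1_A) = Ex mu \1_A.
  move=> HA; apply: EFin_inj; rewrite (Ex_indic _ HA).
  rewrite -(chmu k A (local_set_F HA)) -ExE; last first.
    by apply: cg; have [/local_cont] := @local_indic R _ _ _ HA.
  by apply: eq_integral => w _; rewrite (kernels_gam _ HA).
(* The coordinates on which h' depends are moved one by one into the event A; those below k do not
   matter, by [from k h']. *)
have loc n N h' A : (n <= N)%N -> local n h' -> from k h' -> local_set k N A ->
    Ex mu (gam e k.+1 (fun w => h' w * \1_A w)) = Ex mu (fun w => h' w * \1_A w).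
  elim: n h' A => [|n IH] h' A nN lh fh HA.
    pose c := h' (fun=> true).
    have hc w : h' w = c by exact: lh.
    have cA : cont (\1_A : config -> R) by have [/local_cont] := @local_indic R _ _ _ HA.
    have -> : (fun w => h' w * \1_A w) = (fun w => c * \1_A w).
      by apply/funext => w; rewrite hc.
    rewrite ExZ// -(ind _ _ HA) -ExZ; last exact: cg.
    by congr Ex; apply/funext => w; rewrite gamZ.
  have [nk|kn] := ltnP n k.
    apply: IH => //; first exact: ltnW.
    move=> x y xy.
    rewrite (fh x (fun j => if (k <= j)%N then x j else true)); last first.
      by move=> j kj; rewrite kj.
    rewrite (fh y (fun j => if (k <= j)%N then y j else true)); last first.
      by move=> j kj; rewrite kj.
    apply: lh => j; rewrite ltnS => jn; rewrite ifF ?ifF//;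
      by apply/negbTE; rewrite -ltnNge (leq_ltn_trans jn).
  pose hb b w := h' (set_spin w n b).
  pose Ab b := A `&` [set w | w n = b].
  have lhb b : local n (hb b).
    move=> x y xy; apply: lh => j; rewrite ltnS leq_eqVlt /set_spin.
    by case: eqP => //= _ jn; exact: xy.
  have fhb b : from k (hb b).
    move=> x y xy; apply: fh => j kj; rewrite /set_spin; case: eqP => // _.
    exact: xy.
  have HAb b : local_set k N (Ab b).
    rewrite -(maxn_idPl nN); apply: local_setI => //.
    exact: local_set_cyl.
  have -> : (fun w => h' w * \1_A w) =
      (fun w => hb true w * \1_(Ab true) w + hb false w * \1_(Ab false) w).
    apply/funext => w; rewrite /hb /Ab !indicI /=.
    have I b : \1_[set u : config | u n = b] w = (w n == b)%:R :> R.
      rewrite indicE; congr (nat_of_bool _)%:R.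
      by apply/idP/eqP; rewrite inE.
    rewrite !I; have := set_spin_id w n.
    by case: (w n) => -> /=; rewrite !(mulr1, mulr0) ?addr0 ?add0r.
  have cb b : cont (fun w => hb b w * \1_(Ab b) w : R).
    apply: contM; first exact: local_cont (lhb b).
    by have [/local_cont] := @local_indic R _ _ _ (HAb b).
  by apply: lin => //; apply: IH => //; exact: ltnW.
have loc' n h' : local n h' -> from k h' -> Ex mu (gam e k.+1 h') = Ex mu h'.
  move=> lh fh; have := loc n n h' setT (leqnn n) lh fh _.
  rewrite (_ : (fun w => h' w * \1_setT w) = h'); last first.
    by apply/funext => w; rewrite indicE in_setT mulr1.
  by apply.
move=> ch fh; apply/eqP; rewrite -subr_eq0 -normr_le0; apply/ler_addgt0Pr => eps e0.
rewrite add0r.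
have [N HN] := ch (eps / 2) ltac:(by rewrite divr_gt0).
pose hN w := h (trunc N w).
have lN : local N hN by exact: trunc_local.
have cN : cont hN by exact: local_cont lN.
have nr w : `|h w - hN w| <= eps / 2.
  by apply: HN; apply/agree_sym; exact: trunc_agree.
have E := loc' N hN lN (trunc_from N fh).
have -> : Ex mu (gam e k.+1 h) - Ex mu h =
   (Ex mu (gam e k.+1 h) - Ex mu (gam e k.+1 hN)) - (Ex mu h - Ex mu hN).
  by rewrite E; ring.
apply: (le_trans (ler_normB _ _)); rewrite (splitr eps); apply: lerD.
  by apply: Ex_near; [exact: cg|exact: cg|move=> w; exact: gam_near].
exact: Ex_near.
Qed.

(** The kernel at n acts as [gam e n.+1] on functions of the sites at n and to its left, and
    [gam e n h] is such a function; the tower property then turns single-site consistency into the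
    DLR equations. *)
Lemma chain_gam mu n h : chains (kernels (g e)) mu -> cont h ->
  Ex mu (gam e n h) = Ex mu h.
Proof.
move=> chmu ch; elim: n => [|n IH].
  by congr Ex; apply/funext => w; rewrite gam0.
rewrite -IH -(chain_step (k := n) (h := gam e n h) chmu); last 2 first.
- exact: gam_cont.
- exact: gam_from.
by congr Ex; apply/funext => w; rewrite gam_tower.
Qed.

Lemma measurable_set_spin i b :
  measurable_fun setT (fun w : Omega => set_spin w i b : Omega).
Proof.
apply: (@measurability _ _ Omega Omega setT _ (cylinders setT)) => // _ [_ [j _ [c ->]] <-].
rewrite setTI; apply: (@local_event setT j.+1) => x y xy /= <-.
by rewrite /set_spin; case: eqP => // _; rewrite xy.
Qed.

Lemma measurable_kernels i (A : set Omega) : measurable A ->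
  measurable_fun setT (fun w : Omega => kernels (g e) i A w).
Proof.
move=> mA.
have -> : (fun w : Omega => kernels (g e) i A w) = (fun w : Omega =>
    g e i (set_spin w i true) * \1_A (set_spin w i true) +
    g e i (set_spin w i false) * \1_A (set_spin w i false)).
  by apply/funext => w; rewrite kernelsE.
have mg : measurable_fun setT (g e i : Omega -> R).
  apply: cont_measurable; apply: contM; last exact: Z_inv_cont.
  by apply: contM; [exact: cont_expR|exact: Z_cont].
have m1 : measurable_fun setT (\1_A : Omega -> R) by exact: measurable_indic.
have mb b := measurable_set_spin i b.
apply: measurable_funD; apply: measurable_funM.
- exact: (measurableT_comp mg (mb true)).
- exact: (measurableT_comp m1 (mb true)).
- exact: (measurableT_comp mg (mb false)).
- exact: (measurableT_comp m1 (mb false)).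
Qed.

Lemma kernels_ge0 i A w : 0 <= kernels (g e) i A w.
Proof.
have P b : 0 <= g e i (set_spin w i b) * \1_A (set_spin w i b).
  by rewrite mulr_ge0// ?indicE ?ler0n// ltW// g_gt0.
by rewrite kernelsE addr_ge0.
Qed.

Lemma kernels_T i w : kernels (g e) i setT w = 1.
Proof. by rewrite kernelsE !indicE !in_setT !mulr1 g_sum1. Qed.

Lemma kernelsD i A B w : B `<=` A ->
  kernels (g e) i (A `\` B) w = kernels (g e) i A w - kernels (g e) i B w.
Proof.
move=> BA; rewrite !kernelsE.
have E u : \1_(A `\` B) u = \1_A u - \1_B u :> R.
  rewrite !indicE in_setD.
  have [uB|uB] := boolP (u \in B); last by rewrite andbT subr0.
  by rewrite (mem_set (BA _ (set_mem uB))) subrr.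
by rewrite !E; ring.
Qed.

(** The events on which the identity holds form a lambda-system, so local events suffice. *)
Lemma chains_local mu :
  (forall k N A, local_set k N A -> Ex mu (gam e k.+1 \1_A) = Ex mu \1_A) ->
  chains (kernels (g e)) mu.
Proof.
move=> E i.
suff : F_le i `<=` [set A : set Omega | measurable A /\
    (\int[mu]_w (kernels (g e) i A w)%:E = mu A)%E].
  by move=> iA A /iA[].
have ge0 A w : (0 <= (kernels (g e) i A w)%:E)%E by rewrite lee_fin kernels_ge0.
have mK (A : set Omega) : measurable A ->
    measurable_fun setT (fun w => (kernels (g e) i A w)%:E).
  by move=> mA; apply/measurable_EFinP; exact: measurable_kernels.
apply: F_le_ind; last first.
  move=> N A HA; split; first exact: F_le_measurable (local_set_F HA).
  have [lA _] := @local_indic R _ _ _ HA.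
  rewrite -(Ex_indic mu HA) -(E _ _ _ HA) -ExE; last first.
    by apply: gam_cont => //; exact: local_cont lA.
  by apply: eq_integral => w _; rewrite (kernels_gam _ HA).
split => //.
- split => //; under eq_integral do rewrite kernels_T.
  by rewrite integral_cst// mul1e.
- move=> A B BA [mA EA] [mB EB]; split; first exact: measurableD.
  have fin C : measurable C -> (mu C < +oo)%E.
    by move=> mC; rewrite (le_lt_trans (probability_le1 _ mC))// ltry.
  rewrite measureD// ?fin// (setIidr BA) -[X in (X - _)%E]EA -[X in (_ - X)%E]EB.
  under eq_integral do rewrite kernelsD// EFinB.
  have int C : measurable C -> mu.-integrable setT
      (fun w => (kernels (g e) i C w)%:E).
    move=> mC; apply: measurable_bounded_integrable => //.
    + exact: fin.
    + exact: measurable_kernels.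
    exists 1; split; first exact: num_real.
    move=> M M1 w _ /=; rewrite ger0_norm ?kernels_ge0// (le_trans _ (ltW M1))//.
    rewrite -(kernels_T i w) -subr_ge0 -kernelsD//; exact: kernels_ge0.
  by rewrite integralB//; exact: int.
- move=> F ndF HF.
  have mF n : measurable (F n) by have [] := HF n.
  have EF n : (\int[mu]_w (kernels (g e) i (F n) w)%:E = mu (F n))%E.
    by have [] := HF n.
  have mU : measurable (\bigcup_n F n) by exact: bigcupT_measurable.
  split => //.
  have c1 := nondecreasing_cvg_mu (mu := mu) mF mU ndF.
  have c2 : (\int[mu]_w (kernels (g e) i (F n) w)%:E @[n --> \oo]
     --> \int[mu]_w (lim ((kernels (g e) i (F n) w)%:E @[n --> \oo])))%E.
    apply: cvg_monotone_convergence => //.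
      by move=> n; exact: mK.
    move=> w _ m n mn; rewrite lee_fin -subr_ge0 -kernelsD ?kernels_ge0//.
    by apply/subsetPset; exact: ndF.
  have -> : (\int[mu]_w (kernels (g e) i (\bigcup_n F n) w)%:E =
     \int[mu]_w (lim ((kernels (g e) i (F n) w)%:E @[n --> \oo])))%E.
    apply: eq_integral => w _; apply/esym/cvg_lim => //.
    (* The kernel only evaluates the indicator at two configurations, and at each of them the
       increasing union is reached after finitely many steps. *)
    have ind u : exists N, forall n, (N <= n)%N ->
        \1_(F n) u = \1_(\bigcup_n F n) u :> R.
      have [[N _ FN]|nF] := pselect ((\bigcup_n F n) u).
        exists N => n Nn; rewrite !indicE !mem_set//; first by exists N.
        by have /subsetPset := ndF _ _ Nn; exact.
      exists 0%N => n _; rewrite !indicE !memNset//.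
      by move=> Fn; apply: nF; exists n.
    have [N1 H1] := ind (set_spin w i true).
    have [N2 H2] := ind (set_spin w i false).
    apply: cvg_near_cst; exists (maxn N1 N2) => // n /=.
    by rewrite geq_max => /andP[n1 n2]; rewrite !kernelsE H1// H2.
  have E2 : (fun n => \int[mu]_w (kernels (g e) i (F n) w)%:E)%E = mu \o F.
    by apply/funext => n /=; exact: EF.
  by rewrite E2 in c2; apply: (cvg_unique _ c2 c1).
Qed.

End Chains.

(** * Measures with prescribed cylinder probabilities *)

Section Kolmogorov.
Context {R : realType}.
Variable c : nat -> config -> R.
Hypothesis c_local : forall n, local n (c n).
Hypothesis c0 : forall u, c 0 u = 1.
Hypothesis c_ge0 : forall n u, 0 <= c n u.
Hypothesis cS : forall n u,
  c n u = c n.+1 (set_spin u n true) + c n.+1 (set_spin u n false).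

(* The cylinder of the prefix [u_0 ... u_{n-1}] is coded by the interval
   [[lo n u, lo n u + c n u[], and [digits] reads off the code of a point. *)
Fixpoint lo n u : R :=
  if n is m.+1 then lo m u + (if u m then c m.+1 (set_spin u m false) else 0)
  else 0.

Fixpoint digits n (r : R) : config :=
  if n is m.+1 then
    set_spin (digits m r) m
      (lo m (digits m r) + c m.+1 (set_spin (digits m r) m false) <= r)
  else fun=> false.

Definition decode (r : R) : config := fun j => digits j.+1 r j.

Lemma set_spin_same_agree n u b : agree n (set_spin u n b) u.
Proof. by move=> j jn; rewrite set_spin_neq// ltn_eqF. Qed.

Lemma lo_local n : local n (lo n).
Proof.
elim: n => [|n IH] x y xy //=.
rewrite (IH x y) ?(xy n)//; last exact: agree_le xy.
case: (y n) => //; congr (_ + _); apply: c_local => j; rewrite ltnS /set_spin.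
by case: eqP => // _ jn; exact: xy.
Qed.

Lemma lo_bounds n u : 0 <= lo n u /\ lo n u + c n u <= 1.
Proof.
elim: n => [|n [IH1 IH2]] /=; first by rewrite c0 add0r.
have := cS n u; have := set_spin_id u n.
have := c_ge0 n.+1 (set_spin u n true); have := c_ge0 n.+1 (set_spin u n false).
by case: (u n) => + + -> => /=; lra.
Qed.

Lemma digits_code n r : 0 <= r < 1 ->
  lo n (digits n r) <= r < lo n (digits n r) + c n (digits n r).
Proof.
move=> r01; elim: n => [|n IH] /=; first by rewrite c0 add0r.
rewrite set_spin_at set_spin_twice.
have -> b : lo n (set_spin (digits n r) n b) = lo n (digits n r).
  by apply: lo_local; exact: set_spin_same_agree.
move: IH; rewrite [c n _]cS => /andP[h1 h2].
by case: (leP (_ + c n.+1 (set_spin _ n false)) r) => h /=;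
  apply/andP; split; lra.
Qed.

Lemma digits_uniq n u r : lo n u <= r < lo n u + c n u -> agree n (digits n r) u.
Proof.
elim: n => [|n IH] //= ur.
have uS := cS n u.
have cf := c_ge0 n.+1 (set_spin u n false).
have ct := c_ge0 n.+1 (set_spin u n true).
have E : c n.+1 u = c n.+1 (set_spin u n (u n)) by rewrite set_spin_id.
rewrite E in ur.
have {}IH : agree n (digits n r) u.
  apply: IH; move: ur.
  by case: (u n) => /andP[u1 u2]; apply/andP; split; lra.
move=> j; rewrite ltnS leq_eqVlt => /orP[/eqP ->|jn]; last first.
  by rewrite set_spin_neq ?IH// ltn_eqF.
rewrite set_spin_at (lo_local IH).
have -> : c n.+1 (set_spin (digits n r) n false) = c n.+1 (set_spin u n false).
  apply: c_local => i; rewrite ltnS /set_spin; case: eqP => // /eqP iN.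
  by rewrite leq_eqVlt (negbTE iN) => /= /IH.
move: ur; case: (u n) => /andP[u1 u2].
  by apply/idP; lra.
by apply/negbTE; rewrite -ltNge; lra.
Qed.

Lemma decode_digits n r : agree n (decode r) (digits n r).
Proof.
elim: n => // n IH j; rewrite ltnS leq_eqVlt => /orP[/eqP -> //|jn].
by rewrite /= set_spin_neq ?ltn_eqF// IH.
Qed.

(** Q is arbitrary because there are only finitely many prefixes of length n; this generality also
    covers the thresholds met in the induction. *)
Lemma measurable_digits n (Q : set config) : measurable ([set r | Q (digits n r)] : set (measurableTypeR R)).
Proof.
elim: n Q => [|n IH] Q /=.
  have [Qf|Qf] := pselect (Q (fun=> false)).
    by rewrite (_ : [set _ | _] = setT)//; apply/seteqP; split.
  by rewrite (_ : [set _ | _] = set0)//; apply/seteqP; split.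
pose th r := lo n (digits n r) + c n.+1 (set_spin (digits n r) n false).
have mth : measurable_fun setT (th : measurableTypeR R -> R).
  by move=> _ B mB; rewrite setTI; apply: (IH [set u | B (lo n u + c n.+1 (set_spin u n false))]).
have mle : measurable ([set r | th r <= r] : set (measurableTypeR R)).
  have := measurable_fun_ler mth (@measurable_id _ _ setT).
  move=> /(_ measurableT [set true]); rewrite setTI => H; apply: H; exact: I.
rewrite (_ : [set _ | _] =
  ([set r | Q (set_spin (digits n r) n true)] `&` [set r | th r <= r]) `|`
  ([set r | Q (set_spin (digits n r) n false)] `&` ~` [set r | th r <= r])).
  apply: measurableU; apply: measurableI => //.
  - exact: (IH [set u | Q (set_spin u n true)]).
  - exact: (IH [set u | Q (set_spin u n false)]).
  - exact: measurableC.
apply/seteqP; split => r /=; rewrite -/(th r).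
  by case: (th r <= r) => ?; [left|right].
by case: (th r <= r) => -[] [].
Qed.

Lemma measurable_decode : measurable_fun setT (decode : measurableTypeR R -> Omega).
Proof.
apply: (@measurability _ _ (measurableTypeR R) Omega setT _ (cylinders setT)) => // _ [_ [j _ [b ->]] <-].
by rewrite setTI; exact: (measurable_digits j.+1 [set u | u j = b]).
Qed.

Lemma uniform01E (U : set R) : measurable U ->
  uniform_prob (@ltr01 R) U = lebesgue_measure (U `&` `[0, 1]).
Proof.
move=> mU; rewrite /uniform_prob integral_uniform_pdf.
rewrite (eq_integral (cst 1%E)); last first.
  by move=> x; rewrite inE => -[_ /=]; rewrite in_itv/= /uniform_pdf => ->; rewrite subr0 invr1.
by rewrite integral_cst ?mul1e//; exact: measurableI.
Qed.

(** The measure is the image of the uniform law on the unit interval under [decode]: up to a null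
    set, a cylinder pulls back to the interval coding it, whose length is the prescribed mass. *)
Theorem kolmogorov_extension : exists mu : probability Omega R,
  forall n u, mu [set w | agree n w u] = (c n u)%:E.
Proof.
exists (distribution (uniform_prob (@ltr01 R)) (mfun_Sub (mem_set measurable_decode))).
move=> n u; rewrite /distribution /pushforward /=.
set S := _ @^-1` _.
have mS : measurable S.
  rewrite (_ : S = [set r | agree n (digits n r) u]).
    exact: (measurable_digits n [set v | agree n v u]).
  apply/seteqP; split => r /= Sr j jn.
    by rewrite -(decode_digits r jn); exact: Sr.
  by rewrite (decode_digits r jn); exact: Sr.
rewrite uniform01E//.
have [l0 l1] := lo_bounds n u; have cn := c_ge0 n u.
have len : lebesgue_measure `[lo n u, lo n u + c n u[ = (c n u)%:E.
  rewrite lebesgue_measure_itv/= lte_fin.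
  case: ltP => [_|]; first by rewrite -EFinB addrAC subrr add0r.
  by move=> ?; have -> : c n u = 0 by lra.
apply/eqP; rewrite eq_le; apply/andP; split.
  (* The coding intervals are half-open and reach only points below 1, whereas the uniform law lives
     on the closed interval; the extra point has measure 0. *)
  apply: (@le_trans _ _ (lebesgue_measure (`[lo n u, (lo n u + c n u)[ `|` [set 1]))).
    apply: le_measure; rewrite ?inE//.
    - exact: measurableI.
    - exact: measurableU.
    - move=> r [Sr /=]; rewrite !in_itv /= => /andP[r0 r1].
      have [r1'|] := ltP r 1; last by move=> ?; right; apply/eqP; rewrite eq_le r1.
      left; have := @digits_code n r; rewrite r0 r1' => /(_ isT).
      have E : agree n (digits n r) u.
        by move=> j jn; rewrite -decode_digits//; exact: Sr.
      by rewrite (lo_local E) (c_local E).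
  apply: (le_trans (measureU2 _ _ _)) => //.
  rewrite -[leRHS]adde0 -len leeD2l// le_eqVlt; apply/orP; left; apply/eqP.
  exact: lebesgue_measure_set1.
rewrite -len; apply: le_measure; rewrite ?inE//; first exact: measurableI.
move=> r /=; rewrite in_itv/= => rI; split; last by rewrite /= in_itv/=; lra.
move=> j jn /=; rewrite -(digits_uniq rI)//; exact: decode_digits.
Qed.

End Kolmogorov.

Section LocalInduction.
Context {R : realType}.

Lemma local_ind (P : (config -> R) -> Prop) N :
  (forall F G, local N F -> local N G -> P F -> P G -> P (fun w => F w + G w)) ->
  (forall a F, local N F -> P F -> P (fun w => a * F w)) ->
  (forall u, P \1_[set w | agree N w u]) ->
  forall h, local N h -> P h.
Proof.
move=> PD PZ Pd.
(* The coordinates in [n, N) are already fixed by this indicator while h still depends on those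
   below n; the induction moves coordinates from h to the indicator. *)
pose D n u : config -> R := \1_[set w | forall j, (n <= j < N)%N -> w j = u j].
have DE n u w : D n u w = `[< forall j, (n <= j < N)%N -> w j = u j >]%:R.
  by rewrite /D indicE; congr (nat_of_bool _)%:R; apply/idP/asboolP; rewrite inE.
have lD n u : local N (D n u).
  move=> x y xy; rewrite !DE; congr (nat_of_bool _)%:R; apply: asbool_equiv_eq.
  split => H j njN; have /andP[_ jN] := njN.
    by rewrite -(xy j jN); exact: H.
  by rewrite (xy j jN); exact: H.
have key n u h : (n <= N)%N -> local n h -> P (fun w => h w * D n u w).
  elim: n u h => [|n IH] u h nN lh.
    have -> : (fun w => h w * D 0 u w) = (fun w => h (fun=> true) * D 0 u w).
      by apply/funext => w; congr (_ * _); exact: lh.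
    apply: PZ; first exact: lD.
    rewrite (_ : D 0 u = \1_[set w | agree N w u])//; exact: Pd.
  have -> : (fun w => h w * D n.+1 u w) =
      (fun w => h (set_spin w n true) * D n (set_spin u n true) w +
                h (set_spin w n false) * D n (set_spin u n false) w).
    apply/funext => w.
    have E b : D n (set_spin u n b) w = (w n == b)%:R * D n.+1 u w.
      rewrite !DE -natrM mulnb; congr (nat_of_bool _)%:R.
      apply/asboolP/andP.
        move=> H; split; first by rewrite H ?set_spin_at// leqnn.
        apply/asboolP => j /andP[nj jN]; rewrite H ?set_spin_neq// ?gtn_eqF//.
        by rewrite jN ltnW.
      move=> [/eqP wn /asboolP H] j /andP[nj jN].
      have [->|jn] := eqVneq j n; first by rewrite set_spin_at.
      by rewrite set_spin_neq// H// jN ltn_neqAle eq_sym jn nj.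
    rewrite !E; have := set_spin_id w n.
    by case: (w n) => -> /=; rewrite ?mul0r ?mul1r ?mulr0 ?addr0 ?add0r.
  have lb b : local n (fun w => h (set_spin w n b)).
    move=> x y xy; apply: lh => j; rewrite ltnS leq_eqVlt /set_spin.
    by case: eqP => //= _ jn; exact: xy.
  have lN F G : local n F -> local N G -> local N (fun w => F w * G w).
    move=> lF lG x y xy; rewrite (lF x y) ?(lG x y)//.
    by apply: agree_le xy; exact: ltnW.
  by apply: PD; do ?[exact: lN]; apply: IH => //; exact: ltnW.
move=> h lh; have := key N (fun=> true) h (leqnn N) lh.
congr P; apply/funext => w; rewrite DE; case: asboolP; rewrite ?mulr1//.
by case=> j /andP[Nj jN]; move: (leq_ltn_trans Nj jN); rewrite ltnn.
Qed.

Lemma agree_local_set n u : local_set 0 n [set w | agree n w u].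
Proof. by move=> x y xy xu j jn; rewrite -xy// xu. Qed.

End LocalInduction.

(** * Limits of Gibbs averages, existence and uniqueness of chains *)

Section Existence.
Context {R : realType}.
Variable e : nat -> config -> R.
Hypothesis e_from : forall k, from k (e k).
Hypothesis e_cont : forall k, cont (e k).
Implicit Types (F G h : config -> R).

(** The limits on cylinder indicators are consistent masses, which gives mu. Consistency of mu
    follows because [gam e k.+1] preserves continuity and is absorbed by every larger window. *)
Lemma limit_chain (x : nat -> config) :
  (forall N h, local N h -> cvgn (fun n => gam e n h (x n))) ->
  exists2 mu : probability Omega R, chains (kernels (g e)) mu &
    forall h, cont h -> gam e n h (x n) @[n --> \oo] --> Ex mu h.
Proof.
move=> cv.
pose d n u : config -> R := \1_[set w | agree n w u].
have ld n u : local n (d n u) by have [] := @local_indic R _ _ _ (@agree_local_set n u).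
pose L h := limn (fun n => gam e n h (x n)).
pose c n u := L (d n u).
have LD F G N : local N F -> local N G -> L (fun w => F w + G w) = L F + L G.
  move=> lF lG; rewrite /L -limD; [|exact: cv lF|exact: cv lG].
  by congr (limn _); apply/funext => n /=; rewrite gamD.
have LZ a F N : local N F -> L (fun w => a * F w) = a * L F.
  move=> lF; apply/cvg_lim => //.
  have -> : (fun n => gam e n (fun w => a * F w) (x n)) =
      (fun n => a * gam e n F (x n)) by apply/funext => n; rewrite gamZ.
  by apply: cvgM; [exact: cvg_cst|exact: cv lF].
have dE n u w : d n u w = `[< agree n w u >]%:R.
  by rewrite /d indicE; congr (nat_of_bool _)%:R; apply/idP/asboolP; rewrite inE.
have d_loc n : local n (c n).
  move=> u v uv; congr L; apply/funext => w; rewrite !dE.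
  congr (nat_of_bool _)%:R; apply: asbool_equiv_eq.
  by split => H j jn; rewrite H ?uv.
have [|||mu muE] := @kolmogorov_extension R c d_loc.
- move=> u; rewrite /c /L (_ : (fun n => _) = cst 1) ?lim_cst//.
  apply/funext => n /=; rewrite -[RHS](gam_cst e n 1 (x n)).
  by congr gam; apply/funext => w; rewrite dE asboolT.
- move=> n u; apply: limr_ge; first exact: cv (ld n u).
  by apply: nearW => k; rewrite -(gam_cst e k 0 (x k)); apply: gam_le => w _;
    rewrite dE ler0n.
- move=> n u; rewrite /c -(LD _ _ n.+1)//; congr L; apply/funext => w.
  have E b : d n.+1 (set_spin u n b) w = (w n == b)%:R * d n u w.
    rewrite !dE -natrM mulnb; congr (nat_of_bool _)%:R.
    apply/asboolP/andP.
      move=> H; split; first by rewrite H ?set_spin_at// leqnn.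
      by apply/asboolP => j jn; rewrite H ?set_spin_neq ?ltn_eqF// ltnW.
    move=> [/eqP wn /asboolP H] j; rewrite ltnS leq_eqVlt => /orP[/eqP ->|jn].
      by rewrite set_spin_at.
    by rewrite set_spin_neq ?H// ltn_eqF.
  by rewrite !E; case: (w n) => /=; rewrite ?mul0r ?mul1r ?addr0 ?add0r.
have locE N h : local N h -> Ex mu h = L h.
  apply: (local_ind (P := fun h => Ex mu h = L h)).
  - move=> F G lF lG EF EG; rewrite (LD _ _ N)// -EF -EG ExD//.
      exact: local_cont lF.
    exact: local_cont lG.
  - by move=> a F lF EF; rewrite (LZ _ _ N)// -EF ExZ//; exact: local_cont lF.
  - move=> u; apply: EFin_inj.
    by rewrite (Ex_indic _ (@agree_local_set N u)) muE.
have contE h : cont h -> gam e n h (x n) @[n --> \oo] --> Ex mu h.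
  move=> ch; apply/cvgrPdist_le => eps e0.
  have [N HN] := ch (eps / 3) ltac:(by rewrite divr_gt0).
  pose hN w := h (trunc N w).
  have lN : local N hN by exact: trunc_local.
  have nr w : `|h w - hN w| <= eps / 3.
    by apply: HN; apply/agree_sym; exact: trunc_agree.
  have := cv _ _ lN => /cvgrPdist_le /(_ (eps / 3)) /(_ ltac:(by rewrite divr_gt0)).
  rewrite -/(L hN) -(locE _ _ lN) => -[M _ HM]; exists M => // n /= Mn.
  have h1 : `|Ex mu h - Ex mu hN| <= eps / 3.
    by apply: Ex_near => //; exact: local_cont lN.
  have h2 := HM n Mn.
  have h3 := gam_near e n (x n) nr.
  move: h1 h2 h3; rewrite /= !ler_norml => /andP[? ?] /andP[? ?] /andP[? ?].
  by apply/andP; split; lra.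
exists mu => //; apply: chains_local => // k N A HA.
have [/local_cont cA _] := @local_indic R _ _ _ HA.
apply: cvg_unique (contE _ cA); first exact: norm_hausdorff.
have cgA : cont (gam e k.+1 (\1_A : config -> R)) by exact: gam_cont.
apply: cvg_trans (contE _ cgA); apply: near_eq_cvg; exists k.+1 => // n /= kn.
by rewrite gam_tower.
Qed.

(** A chain integrates h as it integrates [gam e n h], which is nearly constant for large n, so one
    value determines the integral. The same near constancy makes the averages with a fixed exterior
    a Cauchy sequence. *)
Lemma unique_chain_of_osc :
  (forall N h, local N h -> forall eps, 0 < eps -> exists n0, forall n x y,
     (n0 <= n)%N -> `|gam e n h x - gam e n h y| <= eps) ->
  unique_chain (kernels (g e)).
Proof.
move=> osc.
pose x0 : config := fun=> true.
have [|mu chmu muE] := @limit_chain (fun=> x0).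
  move=> N h lh; apply: cauchy_cvg; apply: cauchy_exP => eps e0.
  have [n0 Hn0] := osc N h lh _ (divr_gt0 e0 (ltr0n _ 2)).
  exists (gam e n0 h x0); exists n0 => // k /= nk.
  rewrite /ball /= -(gam_tower e_from h x0 nk).
  rewrite -[X in X - _](gam_cst e k _ x0).
  apply: (@le_lt_trans _ _ (eps / 2)); last lra.
  by apply: gam_near => u; exact: Hn0.
exists mu => // nu chnu; apply: same_measure_local => N h lh.
have ch := local_cont lh.
have E m : chains (kernels (g e)) m -> gam e n h x0 @[n --> \oo] --> Ex m h.
  move=> chm; apply/cvgrPdist_le => eps e0.
  have [n0 Hn0] := osc N h lh _ e0; exists n0 => // n /= nn.
  rewrite -(chain_gam e_from e_cont n chm ch) -(Ex_cst m (gam e n h x0)).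
  by apply: Ex_near => [||w]; [exact: gam_cont|exact: cont_cst|exact: Hn0].
by apply: cvg_unique (E _ chmu) (E _ chnu); exact: norm_hausdorff.
Qed.

End Existence.

(** * The Ising energy *)

Section AbsSum.
Context {R : realType}.

Lemma abs_sum_cvg (P : pred nat) (u : nat -> R) :
  summable [set j | P j] (fun j => (u j)%:E) ->
  \sum_(0 <= j < n | P j) u j @[n --> \oo] --> abs_sum [set j | P j] u.
Proof.
move=> Pu.
have cv (v : nat -> R) : (forall j, 0 <= v j) -> (forall j, v j <= `|u j|) ->
    \sum_(0 <= j < n | P j) v j @[n --> \oo] --> fine (\esum_(j in [set j | P j]) (v j)%:E).
  move=> v0 vu; have vP j : P j -> (0 <= (v j)%:E)%E by rewrite lee_fin.
  have E := @nneseries_esum R (fun j => (v j)%:E) P vP; rewrite -E.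
  have fin : (\sum_(0 <= j <oo | P j) (v j)%:E)%E \is a fin_num.
    rewrite ge0_fin_numE ?nneseries_ge0//; last by move=> j _; exact: vP.
    by rewrite E; apply: le_lt_trans Pu; apply: le_esum => j _; rewrite lee_fin.
  have : (\sum_(0 <= j < n | P j) (v j)%:E)%E @[n --> \oo] -->
      (fine (\sum_(0 <= j <oo | P j) (v j)%:E))%:E.
    rewrite fineK//.
    have : cvgn (fun n => \sum_(0 <= j < n | P j) (v j)%:E)%E.
      by apply: is_cvg_nneseries => n _; exact: vP.
    exact.
  move=> /fine_cvg.
  by under [X in X @ _ --> _]eq_fun => n do [rewrite /= sumEFin /=].
have c1 := cv (fun j => Num.max (u j) 0) _ _.
have c2 := cv (fun j => Num.max (- u j) 0) _ _.
have -> : (fun n => \sum_(0 <= j < n | P j) u j) = (fun n =>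
   \sum_(0 <= j < n | P j) Num.max (u j) 0 -
   \sum_(0 <= j < n | P j) Num.max (- u j) 0).
  apply/funext => n; rewrite -sumrB; apply: eq_bigr => j _.
  by rewrite /Num.max; case: ltP => ?; case: ltP => ?; lra.
apply: cvgB; [apply: c1 => j|apply: c2 => j]; rewrite ?le_max ?lexx ?orbT//
  ge_max normr_ge0 andbT ?ler_norm//.
by rewrite -normrN ler_norm.
Qed.

Lemma summable_tail (P : pred nat) (u : nat -> R) eps :
  summable [set j | P j] (fun j => (u j)%:E) -> 0 < eps ->
  exists N, forall n, \sum_(N <= j < n | P j) `|u j| <= eps.
Proof.
move=> Pu e0.
have u0 j : P j -> (0 <= (`|u j|)%:E)%E by rewrite lee_fin.
have E := @nneseries_esum R (fun j => (`|u j|)%:E) P u0.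
have fin : (\sum_(0 <= j <oo | P j) (`|u j|)%:E < +oo)%E by rewrite E.
have := nneseries_tail_cvg fin u0.
move=> /fine_cvgP[[N1 _ H1] /cvgrPdist_le/(_ _ e0)[N2 _ H2]].
exists (maxn N1 N2) => n; set N := maxn N1 N2.
have h1 := H1 N (leq_maxl _ _); have := H2 N (leq_maxr _ _).
rewrite /= sub0r normrN => h2; rewrite -lee_fin -sumEFin.
apply: (@le_trans _ _ (\sum_(N <= j <oo | P j) (`|u j|)%:E)%E).
  by apply: nneseries_lim_ge => j _; exact: u0.
by rewrite -(fineK h1) lee_fin; apply: le_trans h2; exact: ler_norm.
Qed.

End AbsSum.

Section IsingEnergy.
Context {R : realType}.
Variable J : site -> site -> R.
Hypothesis hJ : couplings J.
Implicit Types (w x y : config).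

Local Notation sp := (@spin R).

Lemma spin_norm b : `|sp b| = 1.
Proof. by case: b; rewrite /spin ?normrN normr1. Qed.

Lemma spin_sqr b : sp b * sp b = 1.
Proof. by case: b; rewrite /spin; ring. Qed.

(** Each pair is attributed to its rightmost site, the smaller number. *)
Definition right_coupling k j : R := if (k < j)%N then J k j else 0.

Local Notation K := right_coupling.

Definition local_field k w : R :=
  abs_sum [set j : site | (k < j)%N] (fun j => J k j * sp (w j)).

Lemma couplings_summable k (P : pred nat) (c : site -> R) :
  (forall j, P j -> (k < j)%N) -> (forall j, `|c j| <= 1) ->
  summable [set j : site | P j] (fun j => (J k j * c j)%:E).
Proof.
move=> Pk c1; have := hJ.2 k; apply: le_lt_trans.
rewrite [leRHS](esumID [set j | P j])//.
rewrite (_ : [set j | j != k] `&` [set j | P j] = [set j | P j]); last first.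
  by apply/setIidr => j /= /Pk kj; rewrite gtn_eqF.
rewrite -[leLHS]adde0; apply: leeD; last by apply: esum_ge0 => j _; rewrite lee_fin.
by apply: le_esum => j Pj; rewrite lee_fin normrM ler_piMr.
Qed.

Lemma local_field_cvg k w :
  \sum_(0 <= j < n) K k j * sp (w j) @[n --> \oo] --> local_field k w.
Proof.
have := @abs_sum_cvg R (fun j => (k < j)%N) (fun j => J k j * sp (w j)).
move=> /(_ (couplings_summable _ _))/wrap[]//; first by move=> j; rewrite spin_norm.
rewrite (_ : (fun n => \sum_(0 <= j < n | (k < j)%N) J k j * sp (w j)) =
  (fun n => \sum_(0 <= j < n) K k j * sp (w j)))//.
apply/funext => n; rewrite big_mkcond; apply: eq_bigr => j _.
by rewrite /K; case: ifP; rewrite ?mul0r.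
Qed.


Lemma local_field_lim k w l :
  \sum_(0 <= j < n) K k j * sp (w j) @[n --> \oo] --> l -> local_field k w = l.
Proof.
by move=> cl; rewrite -(cvg_lim _ cl)//; apply/esym/cvg_lim => //; exact: local_field_cvg.
Qed.

Lemma local_field_eq k x y :
  (forall j, (k < j)%N -> x j = y j) -> local_field k x = local_field k y.
Proof.
move=> xy; apply: local_field_lim; have := @local_field_cvg k y.
rewrite (_ : (fun n => \sum_(0 <= j < n) K k j * sp (y j)) =
  (fun n => \sum_(0 <= j < n) K k j * sp (x j)))//.
apply/funext => n; apply: eq_bigr => j _; rewrite /K.
by case: ifP => [/xy ->|]; rewrite ?mul0r.
Qed.

Lemma local_field_near k N B x y :
  (forall n, \sum_(N <= j < n) `|K k j| <= B) -> agree N x y ->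
  `|local_field k x - local_field k y| <= 2 * B.
Proof.
move=> HB xy.
have cv : `|\sum_(0 <= j < n) K k j * sp (x j) - \sum_(0 <= j < n) K k j * sp (y j)|
    @[n --> \oo] --> `|local_field k x - local_field k y|.
  by apply: cvg_norm; apply: cvgB; exact: local_field_cvg.
apply: (cvgr_to_le cv); apply: nearW => n /=.
rewrite -sumrB; apply: (@le_trans _ _ (\sum_(N <= j < n) 2 * `|K k j|)); last first.
  by rewrite -mulr_sumr ler_pM2l.
apply: (le_trans (ler_norm_sum _ _ _)).
have b2 j : `|K k j * sp (x j) - K k j * sp (y j)| <= 2 * `|K k j|.
  rewrite -mulrBr normrM mulrC ler_wpM2r//; apply: (le_trans (ler_normB _ _)).
  by rewrite !spin_norm.
have bz j : (j < N)%N -> `|K k j * sp (x j) - K k j * sp (y j)| = 0.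
  by move=> jN; rewrite xy// subrr normr0.
have [Nn|nN] := leqP N n; last first.
  rewrite [leRHS]big_geq ?(ltnW nN)// big_nat big1 ?lexx// => j /andP[_ jn].
  exact/bz/(ltn_trans jn).
rewrite (@big_cat_nat _ _ _ N 0 n)//= big_nat big1 ?add0r; last first.
  by move=> j /andP[_ jN]; exact: bz.
by apply: ler_sum => j _; exact: b2.
Qed.

Lemma local_field_set k w i b :
  local_field k (set_spin w i b) = local_field k w + K k i * (sp b - sp (w i)).
Proof.
apply: local_field_lim.
have cv : \sum_(0 <= j < n) K k j * sp (w j) + K k i * (sp b - sp (w i))
    @[n --> \oo] --> local_field k w + K k i * (sp b - sp (w i)).
  by apply: cvgD; [exact: local_field_cvg|exact: cvg_cst].
apply: cvg_trans cv; apply: near_eq_cvg; exists i.+1 => // n /= i_n.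
have -> : \sum_(0 <= j < n) K k j * sp (set_spin w i b j) =
    \sum_(0 <= j < n) K k j * sp (w j) + K k i * (sp b - sp (w i)).
  rewrite !big_mkord (bigD1 (Ordinal i_n))//= set_spin_at.
  rewrite [in RHS](bigD1 (Ordinal i_n))//=.
  rewrite (eq_bigr (fun j : 'I_n => K k j * sp (w j))); first by ring.
  by move=> j ji; rewrite set_spin_neq.
by [].
Qed.

Lemma right_coupling_tail k eps : 0 < eps ->
  exists N, forall n, \sum_(N <= j < n) `|K k j| <= eps.
Proof.
move=> e0.
have := @summable_tail R (fun j => (k < j)%N) (fun j => J k j * 1) eps.
move=> /(_ (couplings_summable _ _) e0)/wrap[]//; first by move=> j; rewrite normr1.
move=> [N HN]; exists N => n; apply: le_trans (HN n).
rewrite [leRHS]big_mkcond le_eqVlt; apply/orP; left; apply/eqP.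
by apply: eq_bigr => j _; rewrite /K mulr1; case: ifP; rewrite ?normr0.
Qed.

Section Energy.
Variable beta : R.

Definition site_energy k w : R := beta * sp (w k) * local_field k w.

Lemma site_energy_from k : from k (site_energy k).
Proof.
move=> x y xy; rewrite /site_energy xy// (@local_field_eq k x y)// => j kj.
by rewrite xy// ltnW.
Qed.

Lemma site_energy_near k N B x y :
  (forall n, \sum_(N <= j < n) `|K k j| <= B) -> (k < N)%N -> agree N x y ->
  `|site_energy k x - site_energy k y| <= `|beta| * (2 * B).
Proof.
move=> HB kN xy; rewrite /site_energy xy// -mulrBr normrM normrM spin_norm mulr1.
by rewrite ler_wpM2l// (local_field_near HB).
Qed.

Lemma site_energy_cont k : cont (site_energy k).
Proof.
move=> eps e0.
have b0 : 0 < `|beta| + 1 by rewrite ltr_wpDl.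
have [N HN] := @right_coupling_tail k (eps / 2 / (`|beta| + 1)) ltac:(by rewrite !divr_gt0).
exists (maxn N k.+1) => x y xy.
have HN' n : \sum_(maxn N k.+1 <= j < n) `|K k j| <= eps / 2 / (`|beta| + 1).
  apply: le_trans (HN n).
  have [h|h] := leqP (maxn N k.+1) n; last first.
    by rewrite big_geq ?(ltnW h)// sumr_ge0.
  by rewrite [leRHS](@big_cat_nat _ _ _ (maxn N k.+1) N n) ?leq_maxl//= lerDr sumr_ge0.
apply: (le_trans (site_energy_near HN' _ xy)); first by rewrite leq_maxr.
have -> : `|beta| * (2 * (eps / 2 / (`|beta| + 1))) = eps * (`|beta| / (`|beta| + 1)).
  by field; rewrite gt_eqF.
apply: ler_piMr; first exact: ltW.
by rewrite ler_pdivrMr// mul1r lerDl.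
Qed.

Lemma potentialE w k j : (k < j)%N ->
  ising_potential J beta [fset k; j]%fset w = - beta * J k j * sp (w k) * sp (w j).
Proof.
move=> kj; rewrite /ising_potential.
have : perm_eq (enum_fset [fset k; j]%fset) [:: k; j].
  apply: uniq_perm => //=; first by rewrite inE ltn_eqF.
  by move=> i; rewrite !inE.
case: (enum_fset _) (fset_uniq [fset k; j]%fset) => [_ /perm_size//|a [_ /perm_size//|b
  [|c s _ /perm_size//]]].
rewrite /= inE andbT => ab /perm_mem P.
have := P a; have := P b; rewrite !inE !eqxx ?orbT /=.
move=> /esym/orP[] /eqP bE /esym/orP[] /eqP aE; move: ab; rewrite aE bE ?eqxx// => _.
by rewrite (hJ.1 j k) ?gtn_eqF//; ring.
Qed.

Lemma potential0 w (A : {fset site}) :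
  (forall k j, (k < j)%N -> A != [fset k; j]%fset) -> ising_potential J beta A w = 0.
Proof.
move=> HA; rewrite /ising_potential; case E : (enum_fset A) => [|a [|b []]] //.
exfalso.
have uA := fset_uniq A; rewrite E /= inE andbT in uA.
have mA i : (i \in A) = (i == a) || (i == b).
  by rewrite -[i \in A]/(i \in enum_fset A) E !inE.
have AE : A = [fset a; b]%fset by apply/fsetP => i; rewrite mA !inE.
have AE' : A = [fset b; a]%fset by apply/fsetP => i; rewrite mA !inE orbC.
move: uA; rewrite neq_ltn => /orP[] /HA; first by rewrite AE eqxx.
by rewrite AE' eqxx.
Qed.

Lemma fset2_lt_inj k j l m : (k < j)%N -> (l < m)%N ->
  [fset k; j]%fset = [fset l; m]%fset -> k = l /\ j = m.
Proof.
move=> kj lm /fsetP E.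
have := E k; have := E j; have := E l; have := E m; rewrite !inE !eqxx ?orbT /=.
by lia.
Qed.

(** A pair meets {0, ..., i} exactly when its smaller element does, so the relevant sets are
    parametrised by k <= i and j > k. The function v stands for the positive or the negative part,
    which [abs_sum] sums separately. *)
Lemma esum_potential i w (v : R -> R) : v 0 = 0 -> (forall r, 0 <= v r) ->
  (\esum_(A in [set A : {fset site} | exists2 j, j \in A & (j <= i)%N])
     (v (ising_potential J beta A w))%:E =
   \sum_(k < i.+1) \esum_(j in [set j | (k < j)%N])
     (v (- beta * J k j * sp (w k) * sp (w j)))%:E)%E.
Proof.
move=> v0 vge.
have vE r : (0 <= (v r)%:E)%E by rewrite lee_fin.
rewrite (fsbig_ord _ _ (fun k => \esum_(j in [set j | (k < j)%N])
   (v (- beta * J k j * sp (w k) * sp (w j)))%:E)%E).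
rewrite -esum_fset//; last by move=> k _; exact: esum_ge0.
rewrite (@esum_esum _ _ _ `I_i.+1 (fun k => [set j | (k < j)%N])
   (fun k j => (v (- beta * J k j * sp (w k) * sp (w j)))%:E))//.
pose enc (p : site * site) : {fset site} := [fset p.1; p.2]%fset.
set S := _ `*`` _.
rewrite (eq_esum (b := fun p => (v (ising_potential J beta (enc p) w))%:E)); last first.
  by move=> [k j] [/= _ kj]; rewrite potentialE.
rewrite -(@esum_image R _ _ S enc (fun A => (v (ising_potential J beta A w))%:E)); last first.
  move=> [k j] [l m]; rewrite !inE => -[/= _ kj] [/= _ lm] E.
  by have [-> ->] := fset2_lt_inj kj lm E.
set D := [set A : {fset site} | _].
rewrite [LHS](esumID (enc @` S))// [X in (_ + X)%E]esum1 ?adde0; last first.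
  move=> A [[a aA ai] nA]; rewrite potential0 ?v0// => k j kj; apply/eqP => AE.
  apply: nA; exists (k, j) => //; split => //=.
  by move: aA; rewrite AE !inE => /orP[] /eqP aE; rewrite -aE ltnS// in kj *; lia.
congr (esum _ _); apply/setIidr => _ [[k j] [/= ki kj] <-].
by exists k => //; rewrite !inE eqxx.
Qed.

Lemma energyE i w : energy (ising_potential J beta) i w = - H site_energy i.+1 w.
Proof.
have bd k : summable [set j : site | (k < j)%N]
    (fun j => (- beta * J k j * sp (w k) * sp (w j))%:E).
  have := @couplings_summable k (fun j => (k < j)%N) (fun=> 1).
  move=> /(_ _ _)/wrap[]// => [j|]; first by rewrite normr1.
  rewrite /summable => fin.
  have P j : (fun j => (k < j)%N) j -> (0 <= (`|J k j|)%:E)%E by rewrite lee_fin.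
  have E := @nneseries_esum R (fun j => (`|J k j|)%:E) (fun j => (k < j)%N) P.
  have finJ : (\sum_(0 <= j <oo | (k < j)%N) (`|J k j|)%:E < +oo)%E.
    by rewrite E; apply: le_lt_trans fin; apply: le_esum => j _; rewrite mulr1.
  rewrite (eq_esum (b := fun j => ((`|beta|)%:E * (`|J k j|)%:E)%E)); last first.
    by move=> j _; rewrite /= -EFinM !normrM !spin_norm !mulr1 normrN.
  rewrite -(@nneseries_esum R _ (fun j => (k < j)%N)); last first.
    by move=> j _; rewrite mule_ge0// lee_fin.
  rewrite nneseriesZl//.
  by rewrite -ge0_fin_numE ?mule_ge0 ?lee_fin ?nneseries_ge0// fin_numM//
    ge0_fin_numE// nneseries_ge0.
have fin (v : R -> R) k : (forall r, 0 <= v r <= `|r|) ->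
    (\esum_(j in [set j : site | (k < j)%N])
       (v (- beta * J k j * sp (w k) * sp (w j)))%:E)%E \is a fin_num.
  move=> Hv; rewrite ge0_fin_numE; last first.
    by apply: esum_ge0 => j _; rewrite lee_fin; have /andP[] := Hv (- beta * J k j * sp (w k) * sp (w j)).
  apply: le_lt_trans (bd k); apply: le_esum => j _; rewrite lee_fin.
  by have /andP[] := Hv (- beta * J k j * sp (w k) * sp (w j)).
rewrite /energy /abs_sum.
rewrite (@esum_potential i w (fun r => Num.max r 0)) ?maxxx//; last first.
  by move=> r; rewrite le_max lexx orbT.
rewrite (@esum_potential i w (fun r => Num.max (- r) 0)) ?oppr0 ?maxxx//; last first.
  by move=> r; rewrite le_max lexx orbT.
rewrite -!sum_fine; last 2 first.
- move=> k _; apply: (fin (fun r => Num.max (- r) 0)) => r.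
  by rewrite le_max lexx orbT ge_max normr_ge0 andbT -normrN ler_norm.
- move=> k _; apply: (fin (fun r => Num.max r 0)) => r.
  by rewrite le_max lexx orbT ge_max normr_ge0 andbT ler_norm.
rewrite -sumrB /H -sumrN; apply: eq_bigr => k _.
transitivity (abs_sum [set j : site | (k < j)%N]
    (fun j => - beta * J k j * sp (w k) * sp (w j))); first by [].
have := @abs_sum_cvg R (fun j => (k < j)%N) _ (bd k) => /cvg_lim <-//.
apply/cvg_lim => //.
have -> : (fun n => \sum_(0 <= j < n | (k < j)%N) (- beta * J k j * sp (w k) * sp (w j))) =
   (fun n => (- beta * sp (w k)) * \sum_(0 <= j < n) K k j * sp (w j)).
  apply/funext => n; rewrite mulr_sumr big_mkcond; apply: eq_bigr => j _.
  by rewrite /K; case: ifP => _; ring.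
rewrite /site_energy -!mulNr; apply: cvgM; first exact: cvg_cst.
exact: local_field_cvg.
Qed.

Lemma boltzmann_sumE i n w : boltzmann_sum (ising_potential J beta) i n w =
  ssum (vol n) (fun u => expR (H site_energy i.+1 u)) w.
Proof.
rewrite /boltzmann_sum -sum_concat; apply: eq_bigr => t _.
by rewrite energyE opprK.
Qed.

Lemma single_siteE i w : single_site (ising_potential J beta) i w = g site_energy i w.
Proof.
rewrite /single_site !boltzmann_sumE /g; congr (_ / _).
rewrite /Z -ssumZ; apply: ssum_vol_eq => u uw.
by rewrite HS expRD mulrC (site_energy_from uw).
Qed.

Lemma ising_LSSE : ising_LSS J beta = kernels (g site_energy).
Proof.
rewrite /ising_LSS; congr kernels; apply/funext => i; apply/funext => w.
exact: single_siteE.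
Qed.

End Energy.

End IsingEnergy.

(** * Entropy and the renewal inequality *)

Section RealInequalities.
Context {R : realType}.
Implicit Types s t : R.

(** A convex, continuously differentiable majorant of max(-t, 0) with second derivative at most 1.
    Thus e^(- loss t) is a smoothed lower bound for min(1, e^t), the common part of the weights 1
    and e^t. *)
Definition loss t : R :=
  if 1/2 <= t then 0 else if t <= -(1/2) then - t else (1/2 - t) ^+ 2 / 2.

Definition loss_slope t : R :=
  if 1/2 <= t then 0 else if t <= -(1/2) then -1 else t - 1/2.

Lemma loss_ge0 t : 0 <= loss t.
Proof.
by rewrite /loss; case: (leP (1/2) t) => ?//; case: (leP t (-(1/2))) => ?; nra.
Qed.

Lemma loss_low t : t <= -(1/2) -> loss t = - t.
Proof. by rewrite /loss => t1; rewrite t1; case: (leP (1/2) t) => ?; lra. Qed.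

Lemma loss_geN t : - t <= loss t.
Proof.
by rewrite /loss; case: (leP (1/2) t) => ?; [lra|];
  case: (leP t (-(1/2))) => ?; nra.
Qed.

Lemma loss_slope_bounds t : -1 <= loss_slope t <= 0.
Proof.
by rewrite /loss_slope; case: (leP (1/2) t) => ?; [lra|];
  case: (leP t (-(1/2))) => ?; lra.
Qed.

Lemma loss_quad t s : loss (t + s) <= loss t + loss_slope t * s + s ^+ 2 / 2.
Proof.
rewrite /loss /loss_slope.
case: (leP (1/2) t) => ?; case: (leP (1/2) (t + s)) => ?;
  try (case: (leP t (-(1/2))) => ?); try (case: (leP (t + s) (-(1/2))) => ?); nra.
Qed.

Lemma loss_lip t s : s <= 0 -> loss (t + s) <= loss t - s.
Proof.
move=> s0; rewrite /loss.
case: (leP (1/2) t) => ?; case: (leP (1/2) (t + s)) => ?;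
  try (case: (leP t (-(1/2))) => ?); try (case: (leP (t + s) (-(1/2))) => ?); nra.
Qed.

(** The square of 1 + s/2 <= e^(s/2), whose left side is nonnegative in this range. *)
Lemma expR_quad s : -2 <= s -> 1 + s + s ^+ 2 / 4 <= expR s.
Proof.
move=> s2; have -> : expR s = expR (s / 2) ^+ 2 by rewrite -expRM_natl -mulr_natl; congr expR; field.
have := expR_ge1Dx (s / 2); nra.
Qed.

(** When e^s is a likelihood ratio, e^s - 1 - s averages to a relative entropy. It controls the
    quadratic remainder for s >= -2; below -2 the Lipschitz bound is good enough. *)
Lemma loss_entropy t s :
  loss (t + s) <= loss t + loss_slope t * s + 2 * (expR s - 1 - s).
Proof.
have [s2|s2] := leP (-2) s.
  by have := loss_quad t s; have := expR_quad s2; lra.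
have s0 : s <= 0 by lra.
have := loss_lip t s0; have := loss_slope_bounds t; have := expR_gt0 s.
by move=> ? /andP[? ?] ?; nra.
Qed.

Lemma jensen_expR (p q u v : R) : 0 <= p -> 0 <= q -> p + q = 1 ->
  expR (p * u + q * v) <= p * expR u + q * expR v.
Proof.
move=> p0 q0 pq; set m := p * u + q * v.
have key w : expR m * (1 + (w - m)) <= expR w.
  have -> : expR w = expR m * expR (w - m) by rewrite -expRD; congr expR; ring.
  by rewrite ler_pM2l ?expR_gt0// expR_ge1Dx.
have h1 := ler_wpM2l p0 (key u); have h2 := ler_wpM2l q0 (key v).
have E : p * (1 + (u - m)) + q * (1 + (v - m)) = 1.
  have qE : q = 1 - p by lra.
  by rewrite /m qE; ring.
have -> : expR m = p * (expR m * (1 + (u - m))) + q * (expR m * (1 + (v - m))).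
  by rewrite mulrCA (mulrCA q) -mulrDr E mulr1.
exact: lerD.
Qed.

(* The entropy term pays for the curvature of [loss]; the linear term vanishes
   on average. *)
Lemma loss_average (p q p' q' t : R) : 0 < p -> 0 < q -> 0 < p' -> 0 < q' ->
  p + q = 1 -> p' + q' = 1 ->
  p * loss (t + ln (p' / p)) + q * loss (t + ln (q' / q)) <=
  loss t + 3 * (p * ln (p / p') + q * ln (q / q')).
Proof.
move=> p0 q0 p'0 q'0 pq p'q'.
have lnV a b : 0 < a -> 0 < b -> ln (a / b) = - ln (b / a) :> R.
  by move=> a0 b0; rewrite -[a / b]invrK invf_div lnV// posrE divr_gt0.
rewrite (lnV p p')// (lnV q q')//.
set s := ln (p' / p); set r := ln (q' / q).
have es : expR s = p' / p by rewrite lnK// posrE divr_gt0.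
have er : expR r = q' / q by rewrite lnK// posrE divr_gt0.
have h1 := ler_wpM2l (ltW p0) (loss_entropy t s).
have h2 := ler_wpM2l (ltW q0) (loss_entropy t r).
have k1 : p * (expR s - 1) = p' - p by rewrite es mulrBr mulrCA divff ?gt_eqF// !mulr1.
have k2 : q * (expR r - 1) = q' - q by rewrite er mulrBr mulrCA divff ?gt_eqF// !mulr1.
have e1 : p * s <= p * (expR s - 1).
  by rewrite ler_pM2l//; have := expR_ge1Dx s; lra.
have e2 : q * r <= q * (expR r - 1).
  by rewrite ler_pM2l//; have := expR_ge1Dx r; lra.
have /andP[sl1 sl2] := loss_slope_bounds t.
set L := loss t in h1 h2 *; set S := loss_slope t in h1 h2 sl1 sl2.
have k : p * s + q * r <= 0 by lra.
(* The mean of the log-ratio is minus the relative entropy and the slope lies in [-1, 0], so the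
   linear term costs at most one relative entropy. With the two units of [loss_entropy] this makes
   the constant 3. *)
have kk : S * (p * s + q * r) <= - (p * s + q * r) by nra.
have : p * (L + S * s + 2 * (expR s - 1 - s)) + q * (L + S * r + 2 * (expR r - 1 - r)) =
  (p + q) * L + S * (p * s + q * r) + 2 * (p * (expR s - 1) + q * (expR r - 1)) - 2 * (p * s + q * r).
  by ring.
rewrite pq k1 k2; lra.
Qed.

End RealInequalities.

Section Renewal.
Context {R : realType}.
Variable e : nat -> config -> R.
Hypothesis e_from : forall k, from k (e k).
Hypothesis e_cont : forall k, cont (e k).
Variable D : nat -> R.
(** A site a < j feels only disagreements at distance at least N - a; the difference of D adds up
    these tails over the window. *)
Hypothesis H_near : forall j N u v, (j <= N)%N -> agree N u v ->
  `|H e j u - H e j v| <= D N - D (N - j)%N.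
Implicit Types (x y u v : config) (h : config -> R).

Let gs := g_sum1 e_from.

Lemma ssum_le2 j (F G : config -> R) x y :
  (forall u v, same_from j u x -> same_from j v y -> agree j u v -> F u <= G v) ->
  ssum (vol j) F x <= ssum (vol j) G y.
Proof.
elim: j x y => [|j IH] x y FG /=; first exact: FG.
have E b : ssum (vol j) F (set_spin x j b) <= ssum (vol j) G (set_spin y j b).
  apply: IH => u v ux vy uv; apply: FG.
  - move=> i ji; rewrite ux ?set_spin_neq ?gtn_eqF//; exact: ltnW.
  - move=> i ji; rewrite vy ?set_spin_neq ?gtn_eqF//; exact: ltnW.
  - move=> i; rewrite ltnS leq_eqVlt => /orP[/eqP ->|ij]; last exact: uv.
    by rewrite ux// vy// !set_spin_at.
exact: lerD.
Qed.

(* Relative entropy between the laws of the sites < j given x and given y. *)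
Fixpoint kl j x y : R :=
  if j is i.+1 then
    g e i (set_spin x i true) * (ln (g e i (set_spin x i true) / g e i (set_spin y i true))
      + kl i (set_spin x i true) (set_spin y i true)) +
    g e i (set_spin x i false) * (ln (g e i (set_spin x i false) / g e i (set_spin y i false))
      + kl i (set_spin x i false) (set_spin y i false))
  else 0.

Lemma ln_g_ratio j x y b :
  ln (g e j (set_spin x j b) / g e j (set_spin y j b)) =
  e j (set_spin x j b) - e j (set_spin y j b) +
  (ln (Z e j (set_spin x j b)) - ln (Z e j (set_spin y j b))) +
  (ln (Z e j.+1 y) - ln (Z e j.+1 x)).
Proof.
have P z k : Z e k z \is Num.pos by rewrite posrE Z_gt0.
have E z : expR (e j z) \is Num.pos by rewrite posrE expR_gt0.
have PV z k : (Z e k z)^-1 \is Num.pos by rewrite posrE invr_gt0 Z_gt0.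
rewrite ln_div ?posrE ?g_gt0// !g_set.
rewrite !lnM ?posrE ?mulr_gt0 ?invr_gt0 ?Z_gt0 ?expR_gt0//.
by rewrite !lnV// !expRK; ring.
Qed.

(** The relative entropy of two Gibbs laws is a mean energy difference plus a difference of log
    partition functions. Only the former is estimated here. *)
Lemma kl_le j x y d :
  (forall u v, same_from j u x -> same_from j v y -> agree j u v ->
     H e j u - H e j v <= d) ->
  kl j x y <= d + (ln (Z e j y) - ln (Z e j x)).
Proof.
elim: j x y d => [|j IH] x y d Hd /=.
  have := Hd x y; rewrite /Z/= /H !big_ord0 expR0 !subrr addr0; exact.
have kb b : kl j (set_spin x j b) (set_spin y j b) <=
    d - e j (set_spin x j b) + e j (set_spin y j b) +
    (ln (Z e j (set_spin y j b)) - ln (Z e j (set_spin x j b))).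
  apply: IH => u v ux vy uv.
  have := Hd u v; rewrite !HS (e_from ux) (e_from vy) => /(_ _ _ _)/wrap[].
  - by move=> i ji; rewrite ux ?set_spin_neq ?gtn_eqF//; exact: ltnW.
  - by move=> i ji; rewrite vy ?set_spin_neq ?gtn_eqF//; exact: ltnW.
  - move=> i; rewrite ltnS leq_eqVlt => /orP[/eqP ->|ij]; last exact: uv.
    by rewrite ux// vy// !set_spin_at.
  lra.
rewrite !ln_g_ratio.
have := ler_wpM2l (ltW (g_gt0 e j (set_spin x j true))) (kb true).
have := ler_wpM2l (ltW (g_gt0 e j (set_spin x j false))) (kb false).
have -> : g e j (set_spin x j false) = 1 - g e j (set_spin x j true).
  by rewrite -(gs j x); ring.
move: (kl j _ _) (kl j _ _) (g e j _) (ln _) (ln _) (ln _) (ln _) (ln _) (ln _) (e j _) (e j _) (e j _) (e j _).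
by move=> k1 k2 p a1 a2 a3 a4 a5 a6 e1 e2 e3 e4; lra.
Qed.

(** The energy difference and the ratio of the partition functions contribute one term each, hence
    the 2. *)
Lemma kl_bound j N x y : (j <= N)%N ->
  (forall i, (j <= i < N)%N -> x i = y i) ->
  kl j x y <= 2 * (D N - D (N - j)%N).
Proof.
move=> jN xy.
have Huv u v : same_from j u x -> same_from j v y -> agree j u v ->
    `|H e j u - H e j v| <= D N - D (N - j)%N.
  move=> ux vy uv; apply: H_near => // i iN.
  have [ij|ji] := ltnP i j; first exact: uv.
  by rewrite ux// vy// xy// ji.
have := @kl_le j x y (D N - D (N - j)%N) _.
move=> /(_ (fun u v ux vy uv => le_trans (ler_norm _) (Huv u v ux vy uv))) k1.
have : Z e j y <= expR (D N - D (N - j)%N) * Z e j x.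
  rewrite /Z -ssumZ; apply: ssum_le2 => v u vy ux vu.
  rewrite -expRD ler_expR.
  have /(Huv u v ux vy) : agree j u v by exact: agree_sym.
  by rewrite ler_norml; lra.
rewrite -ler_ln ?posrE ?mulr_gt0 ?Z_gt0 ?expR_gt0//.
rewrite lnM ?posrE ?Z_gt0 ?expR_gt0// expRK; lra.
Qed.

(** * Contraction of the oscillation of a local function *)

Section Contraction.
Variables (m : nat) (h : config -> R).
Hypothesis h_local : local m h.

Let f j x : R := gam e j h x.
Let up j : R := sup [set f j x | x in setT].
Let dn j : R := inf [set f j x | x in setT].

Let f_bounded : exists B, forall j x, `|f j x| <= B.
Proof.
have [B B0 HB] := cont_bounded (local_cont h_local).
exists B => j x; rewrite ler_norml; apply/andP; split.
  rewrite -(gam_cst e j (- B) x); apply: gam_le => u _.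
  by have := HB u; rewrite ler_norml => /andP[].
rewrite -[leRHS](gam_cst e j B x); apply: gam_le => u _.
by have := HB u; rewrite ler_norml => /andP[].
Qed.

Let f_sup j : has_sup [set f j x | x in setT].
Proof.
split; first by exists (f j (fun=> true)), (fun=> true).
by have [B HB] := f_bounded; exists B => _ [x _ <-];
  rewrite (le_trans (ler_norm _))// HB.
Qed.

Let f_inf j : has_inf [set f j x | x in setT].
Proof.
split; first by exists (f j (fun=> true)), (fun=> true).
by have [B HB] := f_bounded; exists (- B) => _ [x _ <-];
  have := HB j x; rewrite ler_norml => /andP[].
Qed.

Let le_up j x : f j x <= up j.
Proof. by apply: ub_le_sup; [case: (f_sup j)|exists x]. Qed.

Let ge_dn j x : dn j <= f j x.
Proof. by apply: ge_inf; [case: (f_inf j)|exists x]. Qed.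

Let fS j x : f j.+1 x =
  g e j (set_spin x j true) * f j (set_spin x j true) +
  g e j (set_spin x j false) * f j (set_spin x j false).
Proof. exact: gamS. Qed.

Let up_dec j : up j.+1 <= up j.
Proof.
apply: sup_le_ub; first by case: (f_sup j.+1).
move=> _ [x _ <-]; rewrite fS -[leRHS]mul1r -(gs j x) mulrDl.
by apply: lerD; rewrite ler_pM2l ?g_gt0// le_up.
Qed.

Let dn_inc j : dn j <= dn j.+1.
Proof.
apply: lb_le_inf; first by case: (f_inf j.+1).
move=> _ [x _ <-]; rewrite fS -[leLHS]mul1r -(gs j x) mulrDl.
by apply: lerD; rewrite ler_pM2l ?g_gt0// ge_dn.
Qed.

Let p j : R := up j - dn j.
Let p_dec j : p j.+1 <= p j.
Proof. by rewrite /p lerB. Qed.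

Let p_ge0 j : 0 <= p j.
Proof.
rewrite /p subr_ge0; exact: le_trans (ge_dn j (fun=> true)) (le_up j (fun=> true)).
Qed.

(** For fixed weights this is nearly 0 when x almost maximises and y almost minimises [f j]. A lower
    bound in terms of a common mass therefore limits how well both extremes can be approached at
    once. *)
Let gain j x y (a b : R) : R := a * (up j - f j x) + b * (f j y - dn j).

Let gain_le j x y a b a' b' : a' <= a -> b' <= b -> gain j x y a' b' <= gain j x y a b.
Proof.
by move=> aa bb; apply: lerD; rewrite ler_wpM2r ?subr_ge0 ?le_up ?ge_dn.
Qed.

(** The subtracted term is the price of measuring against the wider extremes of volume j instead of
    those of volume j + 1. *)
Let gainS j x y a b : gain j.+1 x y a b =
  gain j (set_spin x j true) (set_spin y j true)
    (a * g e j (set_spin x j true)) (b * g e j (set_spin y j true)) +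
  gain j (set_spin x j false) (set_spin y j false)
    (a * g e j (set_spin x j false)) (b * g e j (set_spin y j false)) -
  (a * (up j - up j.+1) + b * (dn j.+1 - dn j)).
Proof.
rewrite /gain !fS.
have -> : g e j (set_spin x j false) = 1 - g e j (set_spin x j true).
  by rewrite -(gs j x); ring.
have -> : g e j (set_spin y j false) = 1 - g e j (set_spin y j true).
  by rewrite -(gs j y); ring.
by ring.
Qed.

Section FixedVolume.
Variable N : nat.
Hypothesis mN : (m <= N)%N.

(** What is left of the initial oscillation after paying for the first j volumes. The 6 is the 3 of
    [loss_average] times the 2 of [kl_bound]; the factor e is e^(1/2) for the trimmed ratio of the
    weights times e^(1/2) for the loss at trimmed weights. *)
Let bet j : R := p 0 - expR 1 *
  \sum_(l < j) (p l - p l.+1) * expR (6 * (D N - D (N - l.+1)%N)).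

Let betS j : bet j.+1 = bet j -
  expR 1 * ((p j - p j.+1) * expR (6 * (D N - D (N - j.+1)%N))).
Proof. by rewrite /bet big_ord_recr /= mulrDr opprD addrA. Qed.

Let bet_dec j : bet j.+1 <= bet j.
Proof.
by rewrite betS lerBlDr lerDl !mulr_ge0 ?expR_ge0// subr_ge0.
Qed.

(* [a e^t] is the weight carried by [y] when [x] carries [a]; the weights are
   first trimmed to a bounded ratio, which does not change [a e^(- loss t)]. *)
Lemma gain_lb j x y a t : (j <= N)%N -> 0 <= bet j -> 0 < a ->
  (forall i, (j <= i < N)%N -> x i = y i) ->
  a * expR (- loss t - 3 * kl j x y) * bet j <= gain j x y a (a * expR t).
Proof.
elim: j x y a t => [|j IH] x y a t jN bj a0 xy.
  rewrite /= mulr0 subr0 /bet big_ord0 mulr0 subr0 /gain /f !gam0.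
  have -> : h y = h x.
    by apply/esym/h_local => i im; apply: xy; rewrite (leq_trans im).
  have ux : 0 <= up 0 - h x by rewrite subr_ge0 -(gam0 e h x); exact: le_up.
  have dx : 0 <= h x - dn 0 by rewrite subr_ge0 -(gam0 e h x); exact: ge_dn.
  have -> : p 0 = (up 0 - h x) + (h x - dn 0) by rewrite /p; ring.
  rewrite mulrDr; apply: lerD; apply: ler_wpM2r => //.
    by rewrite ler_piMr ?(ltW a0)// -expR0 ler_expR oppr_le0 loss_ge0.
  by rewrite ler_pM2l// ler_expR lerNl loss_geN.
have trimmed a' t' : 0 < a' -> -(1/2) <= t' <= 1/2 ->
   a' * expR (- loss t' - 3 * kl j.+1 x y) * bet j.+1 <= gain j.+1 x y a' (a' * expR t').
  move=> a'0 /andP[t1 t2].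
  have bj' : 0 <= bet j by exact: le_trans (bet_dec j).
  rewrite gainS.
  have gp z b : 0 < g e j (set_spin z j b) by exact: g_gt0.
  have ih b : a' * g e j (set_spin x j b) *
     expR (- loss (t' + ln (g e j (set_spin y j b) / g e j (set_spin x j b)))
           - 3 * kl j (set_spin x j b) (set_spin y j b)) * bet j <=
     gain j (set_spin x j b) (set_spin y j b) (a' * g e j (set_spin x j b))
       (a' * expR t' * g e j (set_spin y j b)).
    have -> : a' * expR t' * g e j (set_spin y j b) = a' * g e j (set_spin x j b) *
       expR (t' + ln (g e j (set_spin y j b) / g e j (set_spin x j b))).
      rewrite expRD lnK; last by rewrite posrE (divr_gt0 (gp y b) (gp x b)).
      by field; rewrite gt_eqF.
    apply: IH => //; [exact: ltnW|by rewrite mulr_gt0|].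
    move=> i; rewrite leq_eqVlt => /andP[/orP[/eqP <- _|ji iN]].
      by rewrite !set_spin_at.
    by rewrite !set_spin_neq ?gtn_eqF// xy// ji.
  set cost := a' * (up j - _) + _.
  set klx := kl j.+1 x y.
  have costE : cost <= a' * expR (- loss t' - 3 * klx) *
      (expR 1 * ((p j - p j.+1) * expR (6 * (D N - D (N - j.+1)%N)))).
    have c1 : cost <= a' * expR (1/2) * (p j - p j.+1).
      have -> : p j - p j.+1 = (up j - up j.+1) + (dn j.+1 - dn j) by rewrite /p; ring.
      rewrite mulrDr; apply: lerD; apply: ler_wpM2r; rewrite ?subr_ge0//.
        by rewrite ler_peMr ?(ltW a'0)// -expR0 ler_expR.
      by rewrite ler_pM2l// ler_expR.
    apply: (le_trans c1).
    have -> : a' * expR (- loss t' - 3 * klx) *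
      (expR 1 * ((p j - p j.+1) * expR (6 * (D N - D (N - j.+1)%N)))) =
      a' * expR (- loss t' - 3 * klx + 1 + 6 * (D N - D (N - j.+1)%N)) * (p j - p j.+1).
      by rewrite !expRD; ring.
    apply: ler_wpM2r; first by rewrite subr_ge0.
    rewrite ler_pM2l// ler_expR.
    have kb := kl_bound jN xy.
    have lt : loss t' <= 1/2.
      rewrite /loss; case: (leP (1/2) t') => ?; first lra.
      by case: (leP t' (-(1/2))) => ?; first lra; nra.
    by rewrite -/klx in kb; lra.
  rewrite betS mulrBr; apply: lerB => //.
  apply: le_trans (lerD (ih true) (ih false)).
  have := loss_average t' (gp x true) (gp x false) (gp y true) (gp y false) (gs j x) (gs j y).
  have := @jensen_expR R _ _
    (- loss (t' + ln (g e j (set_spin y j true) / g e j (set_spin x j true)))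
           - 3 * kl j (set_spin x j true) (set_spin y j true))
    (- loss (t' + ln (g e j (set_spin y j false) / g e j (set_spin x j false)))
           - 3 * kl j (set_spin x j false) (set_spin y j false))
    (ltW (gp x true)) (ltW (gp x false)) (gs j x).
  rewrite /klx /=.
  set l1 := loss (t' + ln (_ / g e j (set_spin x j true))).
  set l2 := loss (t' + ln (_ / g e j (set_spin x j false))).
  set q1 := ln (g e j (set_spin x j true) / _).
  set q2 := ln (g e j (set_spin x j false) / _).
  move: (kl j _ _) (kl j _ _) => k2 k1.
  move: l1 l2 q1 q2 (g e j (set_spin x j true)) (g e j (set_spin x j false)) => l1 l2 q1 q2 G1 G2.
  move=> J1 J2.
  have J3 : expR (- loss t' - 3 * (G1 * (q1 + k1) + G2 * (q2 + k2))) <=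
      G1 * expR (- l1 - 3 * k1) + G2 * expR (- l2 - 3 * k2).
    by apply: le_trans J1; rewrite ler_expR; lra.
  have := ler_wpM2r bj' (ler_wpM2l (ltW a'0) J3).
  move: (expR _) (expR (- l1 - _)) (expR (- l2 - _)) => E0 E1 E2; lra.
have [t2|t2] := leP t (1/2).
  have [t1|t1] := leP (-(1/2)) t; first by apply: trimmed; rewrite ?t1.
  have := trimmed (a * expR (t + 1/2)) (-(1/2)); rewrite mulr_gt0 ?expR_gt0//.
  move=> /(_ isT); rewrite lexx => /(_ ltac:(lra)) T.
  have E1 : a * expR (t + 1/2) * expR (-(1/2)) = a * expR t.
    by rewrite -mulrA -expRD addrK.
  have E2 : a * expR (- loss t - 3 * kl j.+1 x y) =
      a * expR (t + 1/2) * expR (- loss (-(1/2)) - 3 * kl j.+1 x y).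
    rewrite -mulrA -expRD; congr (_ * expR _).
    by rewrite (loss_low (ltW t1)) (loss_low (lexx _)); ring.
  rewrite E2; apply: (le_trans T); rewrite E1; apply: gain_le => //.
  by rewrite ler_piMr ?(ltW a0)// -[leRHS]expR0 ler_expR; lra.
have := trimmed a (1/2) a0; rewrite lexx => /(_ ltac:(lra)) T.
have -> : loss t = loss (1/2) by rewrite /loss lexx (ltW t2).
by apply: (le_trans T); apply: gain_le => //; rewrite ler_pM2l// ler_expR ltW.
Qed.

(** At j = N no agreement of x and y is required, so a near maximiser and a near minimiser can be
    compared. Were [bet N] positive, [gain_lb] would keep their gain away from 0. *)
Lemma renewal_ineq : p 0 * expR (- (6 * D N)) <=
  expR 1 * \sum_(l < N) (p l - p l.+1) * expR (- (6 * D (N - l.+1)%N)).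
Proof.
rewrite leNgt; apply/negP => lt0.
have bN : 0 < bet N.
  rewrite /bet subr_gt0 -(ltr_pM2r (expR_gt0 (- (6 * D N)))).
  apply: le_lt_trans lt0; rewrite -mulrA ler_pM2l ?expR_gt0// mulr_suml.
  apply: ler_sum => l _; rewrite -mulrA -expRD.
  by rewrite (_ : 6 * _ + - (6 * _) = - (6 * D (N - l.+1)%N)) //; ring.
pose eta := expR (- loss 0 - 3 * (2 * (D N - D (N - N)%N))) * bet N.
have eta0 : 0 < eta by rewrite mulr_gt0 ?expR_gt0.
have [_ [x _ <-] hx] := sup_adherent (divr_gt0 eta0 (ltr0n _ 2)) (f_sup N).
have [_ [y _ <-] hy] := inf_adherent (divr_gt0 eta0 (ltr0n _ 2)) (f_inf N).
have xy i : (N <= i < N)%N -> x i = y i.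
  by move=> /andP[Ni iN]; have := leq_ltn_trans Ni iN; rewrite ltnn.
have := @gain_lb N x y 1 0 (leqnn N) (ltW bN) ltr01 xy.
rewrite !mul1r expR0 /gain !mul1r => gl.
have : eta <= expR (- loss 0 - 3 * kl N x y) * bet N.
  rewrite ler_pM2r// ler_expR; have := kl_bound (leqnn N) xy; lra.
rewrite -/(up N) -/(dn N) in hx hy; lra.
Qed.

End FixedVolume.

Let phi k : R := expR (- (6 * D k)).

(** After exchanging the sums, each decrement of p is multiplied by at most the full sum of phi, and
    the decrements telescope. *)
Lemma renewal_sum M : (m <= M)%N ->
  p 0 * \sum_(m <= k < M.+1) phi k <=
  expR 1 * ((p 0 - p M) * \sum_(0 <= k < M.+1) phi k).
Proof.
move=> mM; have phi0 k : 0 <= phi k by exact: expR_ge0.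
pose d l := p l - p l.+1.
have d0 l : 0 <= d l by rewrite subr_ge0.
rewrite mulr_sumr.
apply: (@le_trans _ _ (expR 1 * \sum_(0 <= N < M.+1) \sum_(0 <= l < N) d l * phi (N - l.+1)%N)).
  apply: (@le_trans _ _ (\sum_(m <= N < M.+1) expR 1 *
      \sum_(0 <= l < N) d l * phi (N - l.+1)%N)).
    rewrite [leLHS]big_nat [leRHS]big_nat; apply: ler_sum => N /andP[mN _].
    by rewrite big_mkord; exact: renewal_ineq.
  rewrite -mulr_sumr ler_pM2l ?expR_gt0//.
  rewrite [leRHS](@big_cat_nat _ _ _ m)//=; last exact: leqW.
  by rewrite lerDr; apply: sumr_ge0 => N _; apply: sumr_ge0 => l _; rewrite mulr_ge0.
rewrite ler_pM2l ?expR_gt0//.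
have tel : \sum_(0 <= l < M) d l = p 0 - p M.
  elim: (M) => [|n IH]; first by rewrite big_geq// subrr.
  by rewrite big_nat_recr//= IH /d; ring.
rewrite -tel mulr_suml.
have -> : \sum_(0 <= N < M.+1) \sum_(0 <= l < N) d l * phi (N - l.+1)%N =
   \sum_(0 <= N < M.+1) \sum_(0 <= l < M | (l < N)%N) d l * phi (N - l.+1)%N.
  rewrite [LHS]big_nat [RHS]big_nat; apply: eq_bigr => N /andP[_ NM].
  by rewrite (big_nat_widen _ _ M).
rewrite (exchange_big_dep xpredT)//=; apply: ler_sum => l _.
rewrite -mulr_sumr ler_wpM2l//.
rewrite big_mkcond/=.
apply: (@le_trans _ _ (\sum_(l.+1 <= N < M.+1) phi (N - l.+1)%N)).
  have [lM|Ml] := leqP l.+1 M.+1; last first.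
    rewrite [leRHS]big_geq ?(ltnW Ml)// big_nat big1// => N /andP[_ NM].
    by rewrite ltnNge (leq_trans (n := M))// -ltnS ?(ltn_trans _ Ml)//.
  rewrite (@big_cat_nat _ _ _ l.+1 0 M.+1)//= big_nat big1 ?add0r; last first.
    by move=> N /andP[_ Nl]; rewrite ltnNge -ltnS Nl.
  by rewrite [leLHS]big_nat [leRHS]big_nat; apply: ler_sum => N /andP[-> _].
have -> : \sum_(l.+1 <= N < M.+1) phi (N - l.+1)%N = \sum_(0 <= k < M.+1 - l.+1) phi k.
  have := big_addn 0 M.+1 l.+1 xpredT (fun N => phi (N - l.+1)%N).
  rewrite add0n => ->; apply: eq_bigr => k _; by rewrite addnK.
rewrite [leRHS](@big_cat_nat _ _ _ (M.+1 - l.+1)%N 0 M.+1)//= ?leq_subr//.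
by rewrite lerDl sumr_ge0.
Qed.

(** When the terms below m make up at most half of the sum of phi, this sum cancels from
    [renewal_sum] and p 0 / 2 <= e (p 0 - p M) remains. *)
Lemma contraction M B : (m <= M)%N ->
  2 * \sum_(0 <= k < m) phi k <= \sum_(0 <= k < M.+1) phi k ->
  (forall x y, h x - h y <= B) ->
  forall x y, gam e M h x - gam e M h y <= (1 - (2 * expR 1)^-1) * B.
Proof.
move=> mM mM2 hB x y.
apply: (@le_trans _ _ (p M)).
  by rewrite /p; have := le_up M x; have := ge_dn M y; rewrite /f; lra.
have pB : p 0 <= B.
  rewrite /p lerBlDr; apply: sup_le_ub; first by case: (f_sup 0).
  move=> _ [u _ <-]; rewrite -lerBlDl; apply: lb_le_inf; first by case: (f_inf 0).
  by move=> _ [v _ <-]; rewrite /f !gam0; have := hB u v; lra.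
have := renewal_sum mM; set Phi := \sum_(0 <= k < M.+1) phi k in mM2 *.
have E : \sum_(m <= k < M.+1) phi k = Phi - \sum_(0 <= k < m) phi k.
  by rewrite /Phi (@big_cat_nat _ _ _ m 0 M.+1)//=; [ring|exact: leqW].
have Phi0 : 0 < Phi.
  rewrite /Phi big_nat_recr//= ltr_wpDl// ?expR_gt0// sumr_ge0// => k _.
  exact: expR_ge0.
rewrite E => rs.
have e1 := expR_gt0 (1 : R).
have rs' : p 0 * (Phi / 2) <= expR 1 * (p 0 - p M) * Phi.
  rewrite -mulrA; apply: le_trans rs; apply: ler_wpM2l; first exact: p_ge0.
  by lra.
have : p 0 / 2 <= expR 1 * (p 0 - p M).
  by rewrite -(ler_pM2r Phi0); apply: le_trans rs'; rewrite -!mulrA (mulrC _ Phi).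
rewrite -ler_pdivrMl// => rs''.
have k0 : 0 <= 1 - (2 * expR 1)^-1 :> R.
  rewrite subr_ge0 invf_le1 ?mulr_gt0//.
  by have := @expR_ge1Dx R 1; lra.
apply: (@le_trans _ _ ((1 - (2 * expR 1)^-1) * p 0)); last by rewrite ler_wpM2l.
rewrite mulrBl mul1r invfM.
have -> : 2^-1 / expR 1 * p 0 = (expR 1)^-1 * (p 0 / 2) by ring.
by lra.
Qed.

End Contraction.

Hypothesis phi_div : forall A, exists n, A <= \sum_(0 <= k < n) expR (- (6 * D k)).

(** To iterate, [gam e n1 h] has to be replaced by a local truncation. The two errors th B / 4 use
    up half of the gain th, so each round contracts by 1 - th / 2. *)
Lemma osc_gam m h : local m h -> forall eps, 0 < eps ->
  exists n0, forall n x y, (n0 <= n)%N -> `|gam e n h x - gam e n h y| <= eps.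
Proof.
move=> lh eps eps0.
have phiM M1 M2 : (M1 <= M2)%N -> \sum_(0 <= k < M1) expR (- (6 * D k)) <=
    \sum_(0 <= k < M2) expR (- (6 * D k)).
  move=> M12; rewrite [leRHS](@big_cat_nat _ _ _ M1 0 M2)//= lerDl.
  by apply: sumr_ge0 => k _; exact: expR_ge0.
have [B0 B00 HB0] := cont_bounded (local_cont lh).
pose th : R := (2 * expR 1)^-1.
have th0 : 0 < th by rewrite invr_gt0 mulr_gt0 ?expR_gt0.
have th1 : th < 1.
  rewrite invf_lt1 ?mulr_gt0 ?expR_gt0//.
  by have := @expR_ge1Dx R 1; lra.
have iter k : exists n0, forall n x y, (n0 <= n)%N ->
    gam e n h x - gam e n h y <= (1 - th / 2) ^+ k * (2 * B0).
  elim: k => [|k [n1 IH]].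
    exists 0%N => n x y _; rewrite expr0 mul1r.
    have nr u : `|gam e n h u| <= B0.
      rewrite -[X in `|X|]subr0 -(gam_cst e n 0 u); apply: gam_near => v.
      by rewrite subr0.
    have := nr x; have := nr y; rewrite !ler_norml => /andP[? ?] /andP[? ?]; lra.
  set B := _ ^+ k * _ in IH.
  have B_gt0 : 0 < B by rewrite mulr_gt0 ?exprn_gt0 ?mulr_gt0//; lra.
  have ch : cont (gam e n1 h) by apply: gam_cont => //; exact: local_cont lh.
  have [m' Hm'] := ch (th * B / 4) ltac:(by rewrite divr_gt0// mulr_gt0).
  pose h' w := gam e n1 h (trunc m' w).
  have lh' : local m' h' by exact: trunc_local.
  have [M HM] := phi_div (2 * \sum_(0 <= k < m') expR (- (6 * D k))).
  exists (maxn n1 (maxn m' M)) => n x y; rewrite !geq_max => /and3P[n1n m'n Mn].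
  have nr z : `|gam e n h z - gam e n h' z| <= th * B / 4.
    rewrite -(gam_tower e_from h z n1n); apply: gam_near => u.
    by apply: Hm'; apply/agree_sym; exact: trunc_agree.
  have c := @contraction m' h' lh' n B m'n (le_trans HM (phiM _ _ (leqW Mn))) _ x y.
  have {}c := c (fun x y => IH n1 _ _ (leqnn n1)).
  rewrite exprS -mulrA -/B.
  have := nr x; have := nr y; rewrite !ler_norml => /andP[? ?] /andP[? ?].
  rewrite -/th in c; lra.
have q1 : `|1 - th / 2| < 1 by rewrite ger0_norm; lra.
have /cvgrPdist_le/(_ (eps / (2 * B0))) := @cvg_expr R _ q1.
move=> /(_ ltac:(by rewrite divr_gt0// mulr_gt0))[k _ /(_ k (leqnn k))].
rewrite /= sub0r normrN => qk.
have [n0 Hn0] := iter k; exists n0 => n x y nn.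
have step u v : gam e n h u - gam e n h v <= eps.
  apply: (le_trans (Hn0 n u v nn)); rewrite -ler_pdivlMr ?mulr_gt0//.
  exact: le_trans (ler_norm _) qk.
by have := step x y; have := step y x; rewrite ler_norml => ? ?; apply/andP; split; lra.
Qed.

End Renewal.

(** * The exponential series controls the energy *)

Section ExpSeries.
Context {R : realType}.
Variable J : site -> site -> R.
Hypothesis hJ : couplings J.

Lemma dist_lt a b : (a < b)%N -> dist a b = (b - a)%N.
Proof. by move=> ab; rewrite /dist distnC distnEl// ltnW. Qed.

Lemma Jsup_ub i j : (`|J i j|%:E <= Jsup J (dist i j))%E.
Proof. by apply: ereal_sup_ubound; exists i, j. Qed.

Lemma Jsup_ge0 r : (0 <= Jsup J r)%E.
Proof.
have [->|r0] := posnP r.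
  by apply: le_trans (Jsup_ub 0 0); rewrite lee_fin.
have := Jsup_ub 0 r; rewrite dist_lt// subn0; apply: le_trans.
by rewrite lee_fin.
Qed.

Let S j : \bar R := (\sum_(1 <= r <oo) (minn j r)%:R%:E * Jsup J r)%E.

Let S_term j r : (0 <= (minn j r)%:R%:E * Jsup J r)%E.
Proof. by rewrite mule_ge0 ?lee_fin ?Jsup_ge0. Qed.

Let S_ge0 j : (0 <= S j)%E.
Proof. exact: nneseries_ge0. Qed.

Section Finite.
Hypothesis S1 : (S 1 < +oo)%E.

Let S_fin j : S j \is a fin_num.
Proof.
rewrite ge0_fin_numE//; apply: (@le_lt_trans _ _ (j%:R%:E * S 1)%E).
  rewrite /S -nneseriesZl; last by move=> r _; exact: S_term.
  apply: lee_nneseries => // r r1; rewrite muleA; apply: lee_wpmul2r.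
    exact: Jsup_ge0.
  rewrite -EFinM lee_fin -natrM ler_nat.
  case: r r1 => [|r] _; first by rewrite minn0.
  by rewrite [minn 1 _](minn_idPl _)// muln1 geq_minl.
by rewrite lte_mul_pinfty ?lee_fin.
Qed.

Let jr r : R := fine (Jsup J r).

Let jr_fin r : (0 < r)%N -> Jsup J r = (jr r)%:E.
Proof.
move=> r0; rewrite fineK// ge0_fin_numE ?Jsup_ge0//; apply: le_lt_trans S1.
rewrite /S; apply: (@le_trans _ _ (\sum_(1 <= i < r.+1) (minn 1 i)%:R%:E * Jsup J i)%E).
  rewrite big_nat_recr//= (minn_idPl _)// mul1e leeDr//.
  by apply: sume_ge0 => i _; exact: S_term.
by apply: nneseries_lim_ge.
Qed.

Let jr_ge0 r : 0 <= jr r.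
Proof. by rewrite fine_ge0// Jsup_ge0. Qed.

Let s j : R := fine (S j).

Let s_cvg j : \sum_(1 <= r < n) (minn j r)%:R * jr r @[n --> \oo] --> s j.
Proof.
have : (\sum_(1 <= r < n) (minn j r)%:R%:E * Jsup J r)%E @[n --> \oo] --> (s j)%:E.
  rewrite fineK//; have : cvgn (fun n => \sum_(1 <= r < n) (minn j r)%:R%:E * Jsup J r)%E.
    by apply: is_cvg_nneseries => r _ _; exact: S_term.
  exact.
move=> /fine_cvg.
rewrite (_ : fine \o _ = (fun n => \sum_(1 <= r < n) (minn j r)%:R * jr r))//.
apply/funext => n /=.
rewrite (eq_big_nat _ _ (F2 := fun r => ((minn j r)%:R * jr r)%:E)).
  by rewrite sumEFin.
by move=> r /andP[r0 _]; rewrite jr_fin.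
Qed.

(** The increment of min(i, r) in i is 1 for r > i and 0 otherwise. *)
Let s_tail i n : \sum_(i.+1 <= r < n) jr r <= s i.+1 - s i.
Proof.
have cv : \sum_(1 <= r < n) (minn i.+1 r)%:R * jr r -
  \sum_(1 <= r < n) (minn i r)%:R * jr r @[n --> \oo] --> s i.+1 - s i.
  by apply: cvgB; exact: s_cvg.
apply: (cvgr_to_ge cv); exists (maxn n i.+1) => // k /=; rewrite geq_max => /andP[nk ik].
rewrite -sumrB (@big_cat_nat _ _ _ i.+1 1 k)//=.
apply: (@le_trans _ _ (\sum_(i.+1 <= r < k) jr r)).
  have [ni|ni] := leqP n i.+1; first by rewrite big_geq// sumr_ge0.
  by rewrite [leRHS](@big_cat_nat _ _ _ n i.+1 k)//= ?lerDl ?sumr_ge0// ltnW.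
rewrite -[leLHS]add0r; apply: lerD.
  apply: sumr_ge0 => r _; rewrite -mulrBl mulr_ge0// subr_ge0 ler_nat.
  by rewrite leq_min geq_minr andbT (leq_trans (geq_minl _ _)).
rewrite [leLHS]big_nat [leRHS]big_nat; apply: ler_sum => r /andP[ir _].
rewrite -mulrBl (minn_idPl ir) (minn_idPl (ltnW ir)) -natrB//.
by rewrite subSnn mul1r.
Qed.

Let s_tele N j : (j <= N)%N ->
  \sum_(a < j) (s (N - a)%N - s (N - a.+1)%N) = s N - s (N - j)%N.
Proof.
elim: j => [|j IH] jN; first by rewrite big_ord0 subn0 subrr.
by rewrite big_ord_recr/= IH ?(ltnW jN)//; ring.
Qed.

Lemma energy_near beta j N u v : 0 <= beta -> (j <= N)%N -> agree N u v ->
  `|H (site_energy J beta) j u - H (site_energy J beta) j v| <=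
  2 * beta * s N - 2 * beta * s (N - j)%N.
Proof.
move=> b0 jN uv; rewrite /H -sumrB -mulrBr -s_tele// mulr_sumr.
apply: (le_trans (ler_norm_sum _ _ _)); apply: ler_sum => a _.
have aN : (a < N)%N by exact: leq_trans (ltn_ord a) jN.
have E x : 2 * beta * x = `|beta| * (2 * x) by rewrite ger0_norm//; ring.
rewrite E; apply: (@site_energy_near R J hJ beta a N) => // n.
have := s_tail (N - a.+1) (n - a); rewrite subnSK// => tl; apply: le_trans tl.
have -> : \sum_(N - a <= r < n - a) jr r = \sum_(N <= b < n) jr (b - a)%N.
  have := big_addn (N - a) n a xpredT (fun b => jr (b - a)%N).
  rewrite subnK ?(ltnW aN)// => ->.
  by apply: eq_bigr => r _; rewrite addnK.
rewrite [leLHS]big_nat [leRHS]big_nat; apply: ler_sum => b /andP[Nb _].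
have ab : (a < b)%N by exact: leq_trans aN Nb.
rewrite /right_coupling ab -lee_fin -jr_fin ?subn_gt0// -dist_lt//.
exact: Jsup_ub.
Qed.

Lemma exp_seriesE C : exp_series J C =
  (\sum_(1 <= j <oo) (expR (- (C * s j)))%:E)%E.
Proof.
apply: eq_eseriesr => j _; rewrite -/(S j).
by rewrite -[S j]fineK//.
Qed.

End Finite.

Theorem unique_of_exp_series : (forall C : R, 0 < C -> exp_series J C = +oo%E) ->
  forall beta : R, 0 < beta -> unique_chain (ising_LSS J beta).
Proof.
move=> hC beta b0; rewrite ising_LSSE//.
have S1 : (S 1 < +oo)%E.
  (* If the J(r) are not summable, every term of the exponential series is 0, against its divergence
     at C = 1. *)
  rewrite ltNge leye_eq; apply/eqP => S1.
  have := hC 1 ltr01; rewrite /exp_series.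
  rewrite eseries0// => j j1 _; rewrite mul1e -/(S j).
  suff -> : S j = +oo%E by [].
  apply/eqP; rewrite -leye_eq -S1; apply: lee_nneseries => // r _.
  apply: lee_wpmul2r; first exact: Jsup_ge0.
  rewrite lee_fin ler_nat leq_min geq_minr andbT.
  by rewrite (leq_trans (geq_minl _ _)).
apply: unique_chain_of_osc.
- by move=> k; exact: site_energy_from.
- by move=> k; exact: site_energy_cont.
move=> N h lh eps eps0.
apply: (@osc_gam R (site_energy J beta) _ _ (fun j => 2 * beta * fine (S j))).
- by move=> k; exact: site_energy_from.
- by move=> k; exact: site_energy_cont.
- move=> j M u v jM uv; apply: (energy_near S1) => //; exact: ltW.
- move=> A; apply: contrapT => /forallNP nA.
  (* The renewal argument uses exp (- 6 D) with D = 2 beta S. *)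
  have : (exp_series J (12 * beta) <= A%:E)%E.
    rewrite exp_seriesE//; apply: lime_le.
      by apply: is_cvg_nneseries => j _ _; rewrite lee_fin expR_ge0.
    apply: nearW => n; rewrite sumEFin lee_fin.
    have := nA n => /negP; rewrite -ltNge => /ltW; apply: le_trans.
    have [n0|n0] := posnP n.
      by rewrite n0 !big_geq.
    rewrite [leRHS](@big_cat_nat _ _ _ 1 0 n)//= -[leLHS]add0r; apply: lerD.
      by apply: sumr_ge0 => j _; exact: expR_ge0.
    apply: ler_sum => j _; rewrite ler_expR; lra.
  by rewrite hC// mulr_gt0.
- exact: lh.
- exact: eps0.
Qed.

End ExpSeries.

(** * High temperature *)

Section SingleSite.
Context {R : realType}.
Variable J : site -> site -> R.
Hypothesis hJ : couplings J.
Variable beta : R.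
Hypothesis beta0 : 0 <= beta.
Implicit Types (x y u v w : config) (h : config -> R).

Local Notation e := (site_energy J beta).
Local Notation sp := (@spin R).

Let e_from k : from k (e k).
Proof. exact: site_energy_from. Qed.

Let e_cont k : cont (e k).
Proof. exact: site_energy_cont. Qed.

Let two i j w (a b : bool) := set_spin (set_spin w i a) j b.

(** Only energy terms containing both spins survive a mixed second difference, and each of the two
    spin differences equals 2. *)
Lemma mixed_difference n i j w : i != j ->
  `|H e n (two i j w true true) - H e n (two i j w false true) -
    (H e n (two i j w true false) - H e n (two i j w false false))| <=
  4 * beta * `|J i j|.
Proof.
move=> ij; rewrite /H -!sumrB.
pose K := right_coupling J.
have E (k : 'I_n) : e k (two i j w true true) - e k (two i j w false true) -
    (e k (two i j w true false) - e k (two i j w false false)) =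
    4 * beta * ((k == i :> nat)%:R * K i j + (k == j :> nat)%:R * K j i).
  have kk l : K l l = 0 by rewrite /K /right_coupling ltnn.
  have E1 a b : e k (two i j w a b) =
      beta * sp (two i j w a b k) * (local_field J k w +
        K k i * (sp a - sp (w i)) + K k j * (sp b - sp (w j))).
    have ji : j != i by rewrite eq_sym.
    by rewrite /site_energy /two !local_field_set// (set_spin_neq _ _ ji).
  rewrite !E1 /two.
  have [ki|ki] := eqVneq (k : nat) i.
    rewrite ki kk (negbTE ij).
    by rewrite !(set_spin_neq _ _ ij) !set_spin_at /= /spin; ring.
  have [kj|kj] := eqVneq (k : nat) j.
    by rewrite kj kk !set_spin_at /= /spin; ring.
  by rewrite !set_spin_neq//= /spin; ring.
rewrite (eq_bigr _ (fun k _ => E k)) -mulr_sumr normrM ger0_norm ?mulr_ge0//.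
apply: ler_wpM2l; first by rewrite mulr_ge0.
rewrite big_split/= -!mulr_suml.
have S (l : nat) : 0 <= (\sum_(k < n) (k == l :> nat)%:R : R) <= 1.
  rewrite sumr_ge0//=; have [ln|nl] := ltnP l n.
    rewrite (bigD1 (Ordinal ln))//= eqxx big1 ?addr0// => k.
    by rewrite -val_eqE /= => /negbTE ->.
  by rewrite big1// => k _; rewrite ltn_eqF// (leq_trans (ltn_ord k)).
apply: (@le_trans _ _ (`|K i j| + `|K j i|)).
  apply: (le_trans (ler_normD _ _)); rewrite !normrM; apply: lerD;
    by rewrite ler_piMl// ger0_norm; have /andP[] := S i; have /andP[] := S j.
rewrite /K /right_coupling.
case: (ltngtP i j) ij => // h _; first by rewrite normr0 addr0.
by rewrite normr0 add0r hJ.1// ltn_eqF.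
Qed.

Let hb n i x : R := expR (H e n (set_spin x i true)) /
  (expR (H e n (set_spin x i true)) + expR (H e n (set_spin x i false))).

Definition heat_bath n i h x : R :=
  hb n i x * h (set_spin x i true) + (1 - hb n i x) * h (set_spin x i false).

Let hb01 n i x : 0 <= hb n i x <= 1.
Proof.
have p := expR_gt0 (H e n (set_spin x i true)).
have q := expR_gt0 (H e n (set_spin x i false)).
rewrite /hb divr_ge0 ?addr_ge0 ?(ltW p) ?(ltW q)//=.
by rewrite ler_pdivrMr ?addr_gt0// mul1r lerDl ltW.
Qed.

Lemma heat_bath_gam n i h x : (i < n)%N ->
  gam e n (heat_bath n i h) x = gam e n h x.
Proof.
move=> ilt; rewrite /gam; congr (_ / _).
rewrite (@ssum_avg _ _ _ _ i) ?mem_vol// [RHS](@ssum_avg _ _ _ _ i) ?mem_vol//.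
apply: eq_ssum => u; congr (_ / _).
rewrite /heat_bath /hb !set_spin_twice.
have p := expR_gt0 (H e n (set_spin u i true)).
have q := expR_gt0 (H e n (set_spin u i false)).
by field; rewrite gt_eqF// addr_gt0.
Qed.

(** Both fractions are values of the logistic function, at a - b and at c - d, whose slope is at
    most 1. *)
Lemma logistic_lip (a b c d : R) :
  `|expR a / (expR a + expR b) - expR c / (expR c + expR d)| <= `|a - b - (c - d)|.
Proof.
wlog ab : a b c d / 0 <= a - b - (c - d).
  move=> W; case: (leP 0 (a - b - (c - d))) => [|/ltW h]; first exact: W.
  by rewrite distrC [leRHS]distrC; apply: W; lra.
have pa := expR_gt0 a; have pb := expR_gt0 b.
have pc := expR_gt0 c; have pd := expR_gt0 d.
have -> : expR a / (expR a + expR b) - expR c / (expR c + expR d) =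
    (expR a * expR d - expR b * expR c) / ((expR a + expR b) * (expR c + expR d)).
  by field; rewrite !gt_eqF// addr_gt0.
have E : expR b * expR c = expR a * expR d * expR (- (a - b - (c - d))).
  by rewrite -!expRD; congr expR; ring.
have ge0 : 0 <= expR a * expR d - expR b * expR c.
  rewrite E subr_ge0 ler_piMr ?mulr_ge0 ?expR_ge0//.
  by rewrite -[leRHS]expR0 ler_expR oppr_le0.
have den0 : 0 <= (expR a + expR b) * (expR c + expR d).
  by rewrite mulr_ge0 ?addr_ge0// ltW.
rewrite (ger0_norm ab) (ger0_norm (divr_ge0 ge0 den0)).
rewrite ler_pdivrMr ?mulr_gt0 ?addr_gt0//.
apply: (@le_trans _ _ (expR a * expR d * (a - b - (c - d)))).
  rewrite E -{1}[expR a * expR d]mulr1 -mulrBr ler_wpM2l ?mulr_ge0 ?expR_ge0//.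
  by have := expR_ge1Dx (- (a - b - (c - d))); lra.
rewrite mulrC ler_wpM2l//.
have -> : (expR a + expR b) * (expR c + expR d) =
  expR a * expR d + (expR a * expR c + expR b * expR c + expR b * expR d) by ring.
by rewrite lerDl !addr_ge0// mulr_ge0// ltW.
Qed.

Definition osc j h (o : R) := forall x,
  `|h (set_spin x j true) - h (set_spin x j false)| <= o.

Lemma osc_ge0 j h o : osc j h o -> 0 <= o.
Proof. by move=> /(_ (fun=> true)); apply: le_trans. Qed.

Lemma osc_flip j h o x b c : osc j h o ->
  `|h (set_spin x j b) - h (set_spin x j c)| <= o.
Proof.
move=> ho; have h0 := osc_ge0 ho; have hx := ho x.
by case: b; case: c; rewrite ?subrr ?normr0// distrC.
Qed.

Lemma heat_bath_osc_self n i h : osc i (heat_bath n i h) 0.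
Proof.
by move=> x; rewrite /heat_bath /hb !set_spin_twice subrr normr0.
Qed.

(** The spin at j acts directly through h, and indirectly through the law of the resampled spin,
    which moves by at most the mixed difference. *)
Lemma heat_bath_osc n i j h oi oj : i != j -> osc i h oi -> osc j h oj ->
  osc j (heat_bath n i h) (oj + 4 * beta * `|J i j| * oi).
Proof.
move=> ij hi hj x.
set y := set_spin x j true; set z := set_spin x j false.
have C b c : set_spin (set_spin x j b) i c = two i j x c b.
  by rewrite /two set_spinC// eq_sym.
rewrite /heat_bath.
have -> : hb n i y * h (set_spin y i true) + (1 - hb n i y) * h (set_spin y i false) -
  (hb n i z * h (set_spin z i true) + (1 - hb n i z) * h (set_spin z i false)) =
  hb n i y * (h (set_spin y i true) - h (set_spin z i true)) +
  (1 - hb n i y) * (h (set_spin y i false) - h (set_spin z i false)) +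
  (hb n i y - hb n i z) * (h (set_spin z i true) - h (set_spin z i false)) by ring.
have hyz : `|hb n i y - hb n i z| <= 4 * beta * `|J i j|.
  rewrite /hb /y /z !C; apply: (le_trans (logistic_lip _ _ _ _)).
  exact: mixed_difference.
have d c : `|h (set_spin y i c) - h (set_spin z i c)| <= oj.
  by rewrite /y /z !C; exact: hj.
have /andP[p0 p1] := hb01 n i y.
apply: (le_trans (ler_normD _ _)); apply: lerD; last first.
  by rewrite normrM ler_pM//; exact: hi.
have q0 : 0 <= 1 - hb n i y by rewrite subr_ge0.
apply: (le_trans (ler_normD _ _)).
rewrite (normrM (hb n i y)) (normrM (1 - hb n i y)) (ger0_norm p0) (ger0_norm q0).
have -> : oj = hb n i y * oj + (1 - hb n i y) * oj by ring.
by apply: lerD; [exact: (ler_wpM2l p0)|exact: (ler_wpM2l q0)].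
Qed.

(* A coupling-free form of Dobrushin's comparison: [v j] plays the role of the
   probability of disagreement at j. *)
Definition comparison n N (v : nat -> R) := forall h (o : nat -> R),
  (forall j, (j < N)%N -> osc j h (o j)) ->
  forall x y, same_from N x y ->
  `|gam e n h x - gam e n h y| <= \sum_(j < N) v j * o j.

Lemma same_from_osc N h (o : nat -> R) x y : (forall j, (j < N)%N -> osc j h (o j)) ->
  same_from N x y -> `|h x - h y| <= \sum_(j < N) o j.
Proof.
elim: N x => [|N IH] x ho xy.
  rewrite big_ord0; have -> : x = y by apply/funext => j; exact: xy.
  by rewrite subrr normr0.
rewrite big_ord_recr/=; set x' := set_spin x N (y N).
have h1 : `|h x - h x'| <= o N.
  by rewrite -{1}(set_spin_id x N); exact: (osc_flip _ _ _ (ho N (ltnSn N))).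
have h2 : `|h x' - h y| <= \sum_(j < N) o j.
  apply: IH => [j jN|j]; first by apply: ho; exact: ltnW.
  rewrite leq_eqVlt => /orP[/eqP <-|Nj]; first by rewrite /x' set_spin_at.
  by rewrite /x' set_spin_neq ?gtn_eqF// xy.
rewrite addrC -(subrKA (h x') (h x)); apply: (le_trans (ler_normD _ _)).
exact: lerD.
Qed.

Lemma comparison1 n N : (n <= N)%N -> comparison n N (fun=> 1).
Proof.
move=> nN h o ho.
under eq_bigr do rewrite mul1r.
have half x y : same_from N x y -> gam e n h x - gam e n h y <= \sum_(j < N) o j.
  move=> xy; set S := \sum_(j < N) o j.
  have hx w : same_from n w y -> gam e n h x <= h w + S.
    move=> wy; rewrite -[leRHS](gam_cst e n _ x); apply: gam_le => u ux.
    rewrite -lerBlDl; apply: (le_trans (ler_norm _)); apply: (same_from_osc ho) => j Nj.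
    by rewrite ux ?wy ?xy// (leq_trans nN).
  have : gam e n (fun=> gam e n h x - S) y <= gam e n h y.
    by apply: gam_le => w /hx; lra.
  by rewrite gam_cst; lra.
move=> x y xy; have := half _ _ xy; have := half _ _ (same_from_sym xy).
by rewrite ler_norml => ? ?; apply/andP; split; lra.
Qed.

Lemma comparison_le n N (v v' : nat -> R) : (forall j, (j < N)%N -> v j <= v' j) ->
  comparison n N v -> comparison n N v'.
Proof.
move=> vv cv h o ho x y xy; apply: (le_trans (cv h o ho x y xy)).
apply: ler_sum => j _; apply: ler_wpM2r; last exact: vv.
exact: osc_ge0 (ho j (ltn_ord j)).
Qed.

(** The heat bath at i leaves the Gibbs average unchanged, so the given estimate may be applied to
    the resampled function. It no longer depends on spin i, and collecting the coefficients of o i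
    yields the new v i. *)
Lemma comparison_update n N (v : nat -> R) i : (i < n)%N -> (n <= N)%N -> comparison n N v ->
  comparison n N (fun j => if j == i then
    4 * beta * \sum_(l < N | l != i :> nat) `|J i l| * v l else v j).
Proof.
move=> iltn nN cv h o ho x y xy.
rewrite -(heat_bath_gam h x iltn) -(heat_bath_gam h y iltn).
pose o' j := if j == i then 0 else o j + 4 * beta * `|J i j| * o i.
have iN := leq_trans iltn nN.
apply: (le_trans (cv _ o' _ x y xy)).
  move=> j jN; rewrite /o'; have [->|ji] := eqVneq j i.
    exact: heat_bath_osc_self.
  by apply: heat_bath_osc; [rewrite eq_sym|exact: ho|exact: ho].
rewrite (bigD1 (Ordinal iN))//= [leRHS](bigD1 (Ordinal iN))//= /o' eqxx mulr0 add0r.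
under eq_bigr => j ji.
  rewrite -val_eqE /= in ji; rewrite (negbTE ji) mulrDr; over.
rewrite big_split/= addrC le_eqVlt; apply/orP; left; apply/eqP; congr (_ + _).
  rewrite mulr_sumr mulr_suml; apply: eq_big => [j|j _]; first by rewrite -val_eqE.
  by ring.
by apply: eq_bigr => j; rewrite -val_eqE/= => /negbTE ->.
Qed.

Hypothesis small : forall i n, 4 * beta * \sum_(0 <= j < n | j != i) `|J i j| <= 1 / 4.

Lemma row_tail i eps : 0 < eps ->
  exists a, forall n, \sum_(a <= j < n | j != i) `|J i j| <= eps.
Proof. by move=> e0; apply: summable_tail => //; exact: hJ.2. Qed.

(** The sites below m are updated one at a time. If v <= r below a, the couplings to sites below a
    contribute at most r / 4 by [small] and those beyond a another r / 4, so v is halved. It matters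
    that n0 does not depend on N. *)
Lemma comparison_decay k m : exists n0, forall n N, (n0 <= n)%N -> (n <= N)%N ->
  comparison n N (fun j => if (j < m)%N then 2^-1 ^+ k else 1).
Proof.
elim: k m => [|k IH] m.
  exists 0%N => n N _ nN; apply: comparison_le (comparison1 nN) => j _.
  by case: ifP.
set r : R := 2^-1 ^+ k.
have r0 : 0 < r by rewrite exprn_gt0.
have r1 : r <= 1 by rewrite exprn_ile1 ?invr_ge0 ?invf_le1// ler1n.
have [a ma ta] : exists2 a, (m <= a)%N & forall i n, (i < m)%N ->
    4 * beta * \sum_(a <= j < n | j != i) `|J i j| <= r / 4.
  have tails i : exists a, forall n, 4 * beta * \sum_(a <= j < n | j != i) `|J i j| <= r / 4.
    have b1 : 0 < 4 * beta + 1 by rewrite ltr_wpDl// mulr_ge0.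
    have [a Ha] := @row_tail i (r / 4 / (4 * beta + 1)) ltac:(by rewrite !divr_gt0).
    exists a => n; apply: (@le_trans _ _ (4 * beta * (r / 4 / (4 * beta + 1)))).
      by rewrite ler_wpM2l ?mulr_ge0.
    have -> : 4 * beta * (r / 4 / (4 * beta + 1)) = r / 4 * (4 * beta / (4 * beta + 1)).
      by field; rewrite gt_eqF.
    apply: ler_piMr; first by rewrite ltW// divr_gt0.
    by rewrite ler_pdivrMr// mul1r lerDl.
  have mono i b a n : (b <= a)%N -> \sum_(a <= j < n | j != i) `|J i j| <=
      \sum_(b <= j < n | j != i) `|J i j|.
    move=> ba; have [na|an] := leqP n a; first by rewrite big_geq// sumr_ge0.
    by rewrite [leRHS](@big_cat_nat _ _ _ a b n)//= ?lerDr ?sumr_ge0// ltnW.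
  clear -tails mono beta0.
  elim: (m) => [|m' [a ma Ha]]; first by exists 0%N.
  have [b Hb] := tails m'.
  exists (maxn m'.+1 (maxn a b)); first by rewrite leq_maxl.
  move=> i n; rewrite ltnS leq_eqVlt => /orP[/eqP ->|im'].
    apply: le_trans (Hb n); rewrite ler_wpM2l ?mulr_ge0//; apply: mono.
    by rewrite !leq_max leqnn !orbT.
  apply: le_trans (Ha i n im'); rewrite ler_wpM2l ?mulr_ge0//; apply: mono.
  by rewrite !leq_max leqnn !orbT.
have [n0 Hn0] := IH a.
exists (maxn n0 m) => n N; rewrite geq_max => /andP[n0n mn] nN.
have step q : (q <= m)%N -> comparison n N
    (fun j => if (j < q)%N then r / 2 else if (j < a)%N then r else 1).
  elim: q => [|q IHq] qm; first by apply: comparison_le (Hn0 n N n0n nN).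
  have {}IHq := IHq (ltnW qm).
  apply: comparison_le (comparison_update (i := q) (leq_trans qm mn) nN IHq) => j jN.
  have [->|jq] := eqVneq j q; last first.
    have -> : (j < q.+1)%N = (j < q)%N by rewrite ltnS (leq_eqVlt j q) (negbTE jq).
    exact: lexx.
  rewrite ltnSn.
  have aN : (a <= N)%N \/ (N < a)%N by case: (leqP a N); [left|right].
  rewrite -(big_mkord (fun l => l != q) (fun l => `|J q l| *
    (if (l < q)%N then r / 2 else if (l < a)%N then r else 1))).
  have h1 n' : (n' <= a)%N -> 4 * beta * (\sum_(0 <= l < n' | l != q) `|J q l| *
     (if (l < q)%N then r / 2 else if (l < a)%N then r else 1)) <= r / 4.
    move=> n'a; apply: (@le_trans _ _ (4 * beta * \sum_(0 <= l < n' | l != q) `|J q l| * r)).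
      rewrite ler_wpM2l ?mulr_ge0// big_nat_cond [leRHS]big_nat_cond.
      apply: ler_sum => l /andP[/andP[_ ln] _]; rewrite ler_wpM2l//.
      by case: ifP => _; [lra|rewrite (leq_trans ln)].
    rewrite -mulr_suml mulrA; apply: (@le_trans _ _ (1 / 4 * r)); last lra.
    by rewrite ler_wpM2r// ltW.
  case: aN => [aN|/ltnW Na]; last by apply: (le_trans (h1 N Na)); lra.
  rewrite (@big_cat_nat _ _ _ a 0 N)//= mulrDr.
  apply: (@le_trans _ _ (r / 4 + r / 4)); last lra.
  apply: lerD; first exact: h1.
  apply: le_trans (ta q N qm); rewrite ler_wpM2l ?mulr_ge0//.
  rewrite big_nat_cond [leRHS]big_nat_cond.
  apply: ler_sum => l /andP[/andP[al _] _]; rewrite ler_piMr//.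
  by rewrite ltnNge (leq_trans _ al) ?(leq_trans (ltnW qm))//= ltnNge al.
apply: comparison_le (step m (leqnn m)) => j jN.
rewrite exprSr -/r; case: ifP => // _; by case: ifP.
Qed.

Theorem unique_of_small : unique_chain (ising_LSS J beta).
Proof.
rewrite ising_LSSE//; apply: unique_chain_of_osc => // m h lh eps eps0.
have [B B0 HB] := cont_bounded (local_cont lh).
have hosc j : osc j h (if (j < m)%N then 2 * B else 0).
  move=> x; case: ifP => jm.
    apply: (le_trans (ler_normB _ _)).
    by have := HB (set_spin x j true); have := HB (set_spin x j false); lra.
  rewrite (lh _ (set_spin x j false)) ?subrr ?normr0// => i im.
  by rewrite !set_spin_neq// ltn_eqF// (leq_trans im)// leqNgt jm.
have q1 : `|2^-1 : R| < 1 by rewrite ger0_norm ?invr_ge0// invf_lt1// ltr1n.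
have c0 : 0 < eps / 2 / (m%:R * (2 * B) + 1).
  by rewrite !divr_gt0// ltr_wpDl// mulr_ge0// mulr_ge0// ltW.
have /cvgrPdist_le/(_ _ c0)[k _ /(_ k (leqnn k))] := @cvg_expr R _ q1.
rewrite /= sub0r normrN => qk.
have [n0 Hn0] := comparison_decay k m.
exists n0 => n x y nn.
have ch : cont (gam e n h) by apply: gam_cont => //; exact: local_cont lh.
have [N HN] := ch (eps / 2) ltac:(by rewrite divr_gt0).
pose N' := maxn N n.
(* The comparison requires exteriors that differ at finitely many sites only; continuity of
   [gam e n h] allows changing y far away. *)
pose y' : config := fun j => if (j < N')%N then y j else x j.
have h1 : `|gam e n h y - gam e n h y'| <= eps / 2.
  by apply: HN => j jN; rewrite /y' ifT// leq_max jN.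
have h2 : `|gam e n h x - gam e n h y'| <= eps / 2.
  have := Hn0 n N' nn (leq_maxr _ _) h _ (fun j _ => hosc j) x y' _.
  move=> /(_ ltac:(by move=> j Nj; rewrite /y' ltnNge Nj))/le_trans; apply.
  have mN : (m <= N' + m)%N by exact: leq_addl.
  apply: (@le_trans _ _ (\sum_(0 <= j < m) 2^-1 ^+ k * (2 * B))).
    rewrite -(big_mkord xpredT (fun j => (if (j < m)%N then 2^-1 ^+ k else 1) *
      (if (j < m)%N then 2 * B else 0))).
    have t0 j : 0 <= (if (j < m)%N then 2^-1 ^+ k else 1) * (if (j < m)%N then 2 * B else 0) :> R.
      by case: ifP => _; rewrite mulr_ge0// ?exprn_ge0 ?invr_ge0 ?ler0n ?mulr_ge0// ltW.
    apply: (@le_trans _ _ (\sum_(0 <= j < N' + m) (if (j < m)%N then 2^-1 ^+ k else 1) *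
      (if (j < m)%N then 2 * B else 0))).
      by rewrite [leRHS](@big_cat_nat _ _ _ N' 0 _)//= ?leq_addr// lerDl sumr_ge0.
    rewrite (@big_cat_nat _ _ _ m 0 _)//= -[leRHS]addr0; apply: lerD.
      by rewrite big_nat [leRHS]big_nat; apply: ler_sum => j /andP[_ ->].
    rewrite big_nat big1// => j /andP[mj _].
    by rewrite ltnNge mj /= mulr0.
  rewrite sumr_const_nat subn0 -[leLHS]mulr_natl.
  apply: (@le_trans _ _ ((m%:R * (2 * B)) * (eps / 2 / (m%:R * (2 * B) + 1)))).
    have B2 : 0 <= m%:R * (2 * B) by rewrite !mulr_ge0// ltW.
    rewrite [leLHS]mulrCA [leLHS]mulrC; apply: (ler_wpM2l B2).
    exact: le_trans (ler_norm _) qk.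
  have d0 : 0 < m%:R * (2 * B) + 1 by rewrite ltr_wpDl// !mulr_ge0// ltW.
  have -> : m%:R * (2 * B) * (eps / 2 / (m%:R * (2 * B) + 1)) =
    eps / 2 * (m%:R * (2 * B) / (m%:R * (2 * B) + 1)) by field; rewrite gt_eqF.
  apply: ler_piMr; first by rewrite ltW// divr_gt0.
  by rewrite ler_pdivrMr// mul1r lerDl.
by move: h1 h2; rewrite !ler_norml => /andP[? ?] /andP[? ?]; apply/andP; split; lra.
Qed.

End SingleSite.

(** * Correlation inequalities *)

Section Griffiths.
Context {R : realType}.
Implicit Types (s A B : seq site) (u w x y : config) (F G : config -> R).

Local Notation sp := (@spin R).

Definition spins B w : R := \prod_(i <- B) sp (w i).

Definition plus : config := fun=> true.

(** The sitewise product of spins: equality of the booleans is multiplication of the signs. *)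
Definition mulc (u w : config) : config := fun j => u j == w j.

Lemma spin_eq b c : sp (b == c) = sp b * sp c.
Proof. by case: b; case: c; rewrite /spin /=; ring. Qed.

Lemma spins_mulc B u w : spins B (mulc u w) = spins B u * spins B w.
Proof. by rewrite /spins -big_split; apply: eq_bigr => i _; exact: spin_eq. Qed.

Lemma spins_cat A B w : spins (A ++ B) w = spins A w * spins B w.
Proof. exact: big_cat. Qed.

Lemma spins_pm B w : spins B w = 1 \/ spins B w = -1.
Proof.
rewrite /spins; elim: B => [|i B IH]; first by rewrite big_nil; left.
by rewrite big_cons; case: IH => ->; case: (w i); rewrite /spin; [left|right|right|left]; ring.
Qed.

Lemma spins_le1 B w : -1 <= spins B w <= 1.
Proof. by case: (spins_pm B w) => ->; lra. Qed.

Lemma spins_plus B : spins B plus = 1.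
Proof. by rewrite /spins big1. Qed.

(** Summing over one spin kills the product if that spin occurs an odd number of times in B, and
    doubles the rest of it otherwise. *)
Lemma ssum_spins s B : exists2 k : R, 0 <= k &
  exists B', forall w, ssum s (spins B) w = k * spins B' w.
Proof.
elim: s => [|a s [k k0 [B' HB]]]; first by exists 1 => //; exists B => w; rewrite mul1r.
exists (k * (1 + (-1) ^+ count_mem a B')).
  by rewrite mulr_ge0// -signr_odd; case: odd; rewrite ?expr1 ?expr0; lra.
exists [seq i <- B' | i != a] => w /=; rewrite !HB.
have E b : spins B' (set_spin w a b) =
    sp b ^+ count_mem a B' * spins [seq i <- B' | i != a] w.
  rewrite /spins big_filter; elim: (B') => [|i t IH].
    by rewrite !big_nil mulr1.
  rewrite !big_cons IH /=; have [->|ia] := eqVneq i a.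
    by rewrite /= set_spin_at exprS; ring.
  by rewrite /= set_spin_neq//; ring.
by rewrite !E {1}/spin expr1n /spin; ring.
Qed.

(** For z = 1 or -1, e^(cz) = cosh c + z sinh c; this expands the weight into spin products with
    nonnegative coefficients. *)
Lemma griffiths1 (I : Type) s (r : seq I) (c : I -> R) (A : I -> seq site) B :
  (forall i, 0 <= c i) ->
  0 <= ssum s (fun u => spins B u * expR (\sum_(i <- r) c i * spins (A i) u)) plus.
Proof.
move=> c0; elim: r B => [|i r IH] B.
  have [k k0 [B' HB]] := ssum_spins s B.
  rewrite (@eq_ssum _ s _ (spins B)).
    by rewrite HB spins_plus mulr1.
  by move=> u; rewrite big_nil expR0 mulr1.
have E z : z = 1 \/ z = -1 -> expR (c i * z) =
    (expR (c i) + expR (- c i)) / 2 + z * ((expR (c i) - expR (- c i)) / 2).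
  by case=> ->; rewrite ?mulr1 ?mulrN1; field.
rewrite (@eq_ssum _ s _ (fun u =>
   (expR (c i) + expR (- c i)) / 2 *
     (spins B u * expR (\sum_(i <- r) c i * spins (A i) u)) +
   (expR (c i) - expR (- c i)) / 2 *
     (spins (A i ++ B) u * expR (\sum_(i <- r) c i * spins (A i) u)))).
  have a0 : 0 <= (expR (c i) + expR (- c i)) / 2 by rewrite divr_ge0// addr_ge0// expR_ge0.
  have b0 : 0 <= (expR (c i) - expR (- c i)) / 2.
    by rewrite divr_ge0// subr_ge0 ler_expR; have := c0 i; lra.
  by rewrite ssumD !ssumZ; apply: addr_ge0; apply: mulr_ge0 => //; exact: IH.
move=> u; rewrite big_cons expRD (E _ (spins_pm (A i) u)) spins_cat.
by ring.
Qed.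

Lemma ssum_mulc s F u w : ssum s (fun v => F (mulc u v)) w = ssum s F (mulc u w).
Proof.
elim: s w => //= a s IH w; rewrite !IH.
have E b : mulc u (set_spin w a b) = set_spin (mulc u w) a (u a == b).
  by apply/funext => j; rewrite /mulc /set_spin; case: (eqVneq j a) => [->|].
by rewrite !E; case: (u a) => //=; rewrite addrC.
Qed.

(* Ginibre's duplication: in the variables (u, v) with second copy [u v], the
   difference of the two sides is an average over v of ferromagnetic sums. *)
Lemma griffiths2 (I : Type) s (r : seq I) (c c' : I -> R) (A : I -> seq site) B :
  (forall i, `|c' i| <= c i) ->
  ssum s (fun u => spins B u * expR (\sum_(i <- r) c' i * spins (A i) u)) plus *
  ssum s (fun u => expR (\sum_(i <- r) c i * spins (A i) u)) plus <=
  ssum s (fun u => spins B u * expR (\sum_(i <- r) c i * spins (A i) u)) plus *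
  ssum s (fun u => expR (\sum_(i <- r) c' i * spins (A i) u)) plus.
Proof.
move=> cc; set E := fun u => \sum_(i <- r) c i * spins (A i) u.
set E' := fun u => \sum_(i <- r) c' i * spins (A i) u.
rewrite -subr_ge0.
have -> : ssum s (fun u => spins B u * expR (E u)) plus * ssum s (fun u => expR (E' u)) plus -
  ssum s (fun u => spins B u * expR (E' u)) plus * ssum s (fun u => expR (E u)) plus =
  ssum s (fun u => ssum s (fun v =>
    (spins B u - spins B v) * (expR (E u) * expR (E' v))) plus) plus.
  rewrite [RHS](@eq_ssum _ s _ (fun u => spins B u * expR (E u) * ssum s (fun v => expR (E' v)) plus -
     expR (E u) * ssum s (fun v => spins B v * expR (E' v)) plus)).
    by rewrite ssumB !ssumZr; ring.
  move=> u; rewrite -!ssumZ -ssumB; apply: eq_ssum => v; ring.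
rewrite (@ssum_eq _ s _ (fun u => ssum s (fun v =>
    (1 - spins B v) * (spins B u *
      expR (\sum_(i <- r) (c i + c' i * spins (A i) v) * spins (A i) u))) plus)); last first.
  move=> u us.
  (* u agrees with [plus] off s, so the second copy can be written [mulc u v] with v summed from
     [plus]. *)
  rewrite -(@ssum_off _ s _ u plus)//.
  have -> : u = mulc u plus by apply/funext => j; rewrite /mulc /plus eqb_id.
  rewrite -ssum_mulc; apply: eq_ssum => v.
  have <- : u = mulc u plus by apply/funext => j; rewrite /mulc /plus eqb_id.
  have <- : E u + E' (mulc u v) = \sum_(i <- r) (c i + c' i * spins (A i) v) * spins (A i) u.
    rewrite /E /E' -big_split; apply: eq_bigr => i _ /=.
    by rewrite spins_mulc; ring.
  by rewrite spins_mulc expRD; ring.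
rewrite ssum_exch; apply: ssum_ge0 => v _; rewrite ssumZ mulr_ge0//.
  by have /andP[_] := spins_le1 B v; rewrite subr_ge0.
apply: griffiths1 => i.
have /andP[a1 a2] := spins_le1 (A i) v.
by have := cc i; rewrite ler_norml => /andP[? ?]; nra.
Qed.

Lemma ssum_local n F x y : local n F -> ssum (vol n) F x = ssum (vol n) F y.
Proof.
by move=> lF; apply/eqP; rewrite eq_le; apply/andP; split; apply: ssum_le2 => u v _ _ uv;
  rewrite (lF u v).
Qed.

(* [c k n] is an external field at site k. *)
Definition quad n (c : nat -> nat -> R) u : R :=
  \sum_(k < n) sp (u k) * (\sum_(j < n) c k j * sp (u j) + c k n).

Lemma quad_local n c : local n (quad n c).
Proof.
move=> u v uv; apply: eq_bigr => k _; rewrite uv//.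
by congr (_ * (_ + _)); apply: eq_bigr => j _; rewrite uv.
Qed.

Lemma griffiths_quad n (c c' : nat -> nat -> R) B :
  (forall k j, (k < n)%N -> (j <= n)%N -> `|c' k j| <= c k j) ->
  ssum (vol n) (fun u => spins B u * expR (quad n c' u)) plus *
  ssum (vol n) (fun u => expR (quad n c u)) plus <=
  ssum (vol n) (fun u => spins B u * expR (quad n c u)) plus *
  ssum (vol n) (fun u => expR (quad n c' u)) plus.
Proof.
move=> cc.
pose A (p : 'I_n * 'I_n.+1) : seq site :=
  if (p.2 == n :> nat) then [:: p.1 : site] else [:: p.1 : site; p.2 : site].
have E d u : quad n d u = \sum_(p : 'I_n * 'I_n.+1) d p.1 p.2 * spins (A p) u.
  rewrite -(pair_bigA _ (fun (k : 'I_n) (j : 'I_n.+1) => d k j * spins (A (k, j)) u))/=.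
  apply: eq_bigr => k _; rewrite big_ord_recr/= /A/= eqxx /spins big_seq1.
  rewrite mulrDr (mulrC _ (d k n)); congr (_ + _).
  rewrite mulr_sumr; apply: eq_bigr => j _.
  by rewrite ltn_eqF// big_cons big_seq1; ring.
have Ef d : quad n d = (fun u => \sum_(p : 'I_n * 'I_n.+1) d p.1 p.2 * spins (A p) u).
  by apply/funext => u; exact: E.
rewrite !Ef; apply: griffiths2 => -[k j] /=.
by apply: cc => //; rewrite -ltnS.
Qed.

End Griffiths.

(** * Ferromagnetic Gibbs averages with plus exterior *)

Section Ferromagnet.
Context {R : realType}.
Variable J : site -> site -> R.
Hypothesis hJ : couplings J.
Hypothesis hF : ferromagnetic J.
Variable beta : R.
Hypothesis beta0 : 0 <= beta.
Implicit Types (B : seq site) (u w x y : config) (h : config -> R).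

Local Notation e := (site_energy J beta).
Local Notation sp := (@spin R).
Local Notation K := (right_coupling J).

Lemma right_coupling_ge0 k j : 0 <= K k j.
Proof. by rewrite /right_coupling; case: ifP => // kj; rewrite hF// ltn_eqF. Qed.

Definition outer_field n k w : R :=
  local_field J k w - \sum_(0 <= j < n) K k j * sp (w j).

Lemma outer_field_cvg n k w :
  \sum_(n <= j < N) K k j * sp (w j) @[N --> \oo] --> outer_field n k w.
Proof.
have cv : \sum_(0 <= j < N) K k j * sp (w j) - \sum_(0 <= j < n) K k j * sp (w j)
    @[N --> \oo] --> outer_field n k w.
  by apply: cvgB; [exact: local_field_cvg|exact: cvg_cst].
apply: cvg_trans cv; apply: near_eq_cvg; exists n => // N /= nN.
by rewrite [in LHS](@big_cat_nat _ _ _ n 0 N)//= addrAC subrr add0r.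
Qed.

Lemma outer_field_from n k : from n (outer_field n k).
Proof.
move=> x y xy.
have E : (fun N => \sum_(n <= j < N) K k j * sp (x j)) =
    (fun N => \sum_(n <= j < N) K k j * sp (y j)).
  apply/funext => N; rewrite !big_nat; apply: eq_bigr => j /andP[nj _].
  by rewrite xy.
have := @outer_field_cvg n k x; rewrite E => /cvg_lim <-//.
by apply: cvg_lim => //; exact: outer_field_cvg.
Qed.

Lemma outer_field_plus n k x : `|outer_field n k x| <= outer_field n k plus.
Proof.
have cv : `|\sum_(n <= j < N) K k j * sp (x j)| @[N --> \oo] --> `|outer_field n k x|.
  by apply: cvg_norm; exact: outer_field_cvg.
apply: (ler_cvg_to cv (@outer_field_cvg n k plus)); apply: nearW => N.
apply: (le_trans (ler_norm_sum _ _ _)); apply: ler_sum => j _.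
by rewrite normrM spin_norm ger0_norm ?right_coupling_ge0// /plus /spin.
Qed.

Lemma outer_field_ge n M k : (n <= M)%N ->
  \sum_(n <= j < M) K k j <= outer_field n k plus.
Proof.
move=> nM; apply: (cvgr_to_ge (@outer_field_cvg n k plus)).
exists M => // N /= MN; rewrite (@big_cat_nat _ _ _ M n N)//=.
rewrite -[leLHS]addr0; apply: lerD.
  by apply: ler_sum => j _; rewrite /plus /spin mulr1.
by apply: sumr_ge0 => j _; rewrite /plus /spin mulr1 right_coupling_ge0.
Qed.

(* The pair couplings inside [[0, n[] are symmetrised; the diagonal part [d]
   only adds a constant. *)
Definition sym_coupling n (d f : nat -> R) k j : R :=
  if j == n then f k
  else beta / 2 * (K k j + K j k) + (k == j)%:R * d k.

Lemma quad_energy n (d : nat -> R) x u : same_from n u x ->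
  quad n (sym_coupling n d (fun k => beta * outer_field n k x)) u =
  H e n u + \sum_(k < n) d k.
Proof.
move=> ux.
have E1 : H e n u = \sum_(k < n) sp (u k) * (\sum_(j < n) beta * K k j * sp (u j)
    + beta * outer_field n k x).
  apply: eq_bigr => k _; rewrite /site_energy -(outer_field_from k ux) /outer_field.
  have -> : \sum_(j < n) beta * K k j * sp (u j) =
      beta * \sum_(0 <= j < n) K k j * sp (u j).
    by rewrite big_mkord mulr_sumr; apply: eq_bigr => j _; ring.
  by ring.
have E2 : \sum_(k < n) \sum_(j < n) sp (u k) * (beta * K k j * sp (u j)) =
   \sum_(k < n) \sum_(j < n) sp (u k) * (beta / 2 * (K k j + K j k) * sp (u j)).
  pose L := \sum_(k < n) \sum_(j < n) sp (u k) * (beta * K k j * sp (u j)).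
  pose L' := \sum_(k < n) \sum_(j < n) sp (u k) * (beta * K j k * sp (u j)).
  have S : L = L'.
    rewrite /L exchange_big/=; apply: eq_bigr => k _; apply: eq_bigr => j _; ring.
  have -> : \sum_(k < n) \sum_(j < n) sp (u k) * (beta / 2 * (K k j + K j k) * sp (u j)) =
      2^-1 * (L + L').
    rewrite /L /L' -big_split mulr_sumr; apply: eq_bigr => k _.
    rewrite -big_split mulr_sumr; apply: eq_bigr => j _ /=.
    by ring.
  by rewrite -S -/L; lra.
have Ek (k : 'I_n) : sp (u k) * (\sum_(j < n) sym_coupling n d
      (fun k => beta * outer_field n k x) k j * sp (u j) +
      sym_coupling n d (fun k => beta * outer_field n k x) k n) =
    \sum_(j < n) sp (u k) * (beta / 2 * (K k j + K j k) * sp (u j)) +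
    (sp (u k) * (beta * outer_field n k x) + d k).
  have -> : sym_coupling n d (fun k => beta * outer_field n k x) k n =
      beta * outer_field n k x by rewrite /sym_coupling eqxx.
  rewrite mulrDr [RHS]addrCA [LHS]addrC; congr (_ + _).
  rewrite (eq_bigr (fun j : 'I_n => beta / 2 * (K k j + K j k) * sp (u j) +
      (k == j)%:R * d k * sp (u j))); last first.
    by move=> j _; rewrite /sym_coupling ltn_eqF// mulrDl.
  rewrite big_split/= mulrDr mulr_sumr; congr (_ + _).
  rewrite (bigD1 k)//= eqxx big1 ?addr0.
    by rewrite mul1r mulrCA spin_sqr mulr1.
  by move=> j jk; rewrite eq_sym (negbTE jk) /= !mul0r.
have Fk (k : 'I_n) : sp (u k) * (\sum_(j < n) beta * K k j * sp (u j)
    + beta * outer_field n k x) = \sum_(j < n) sp (u k) * (beta * K k j * sp (u j)) +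
    sp (u k) * (beta * outer_field n k x) by rewrite mulrDr mulr_sumr.
rewrite E1 /quad (eq_bigr _ (fun k _ => Ek k)) (eq_bigr _ (fun k _ => Fk k)).
by rewrite !big_split/= E2 addrA.
Qed.

(** The diagonal d can be chosen freely because squares of spins are constant. This freedom is
    needed for the hierarchical couplings, whose diagonal does not vanish. *)
Lemma griffiths_plus n (d : nat -> R) (c : nat -> nat -> R) B :
  (forall k j, (k < n)%N -> (j <= n)%N ->
    `|c k j| <= sym_coupling n d (fun k => beta * outer_field n k plus) k j) ->
  ssum (vol n) (fun u => spins B u * expR (quad n c u)) plus <=
  gam e n (spins B) plus * ssum (vol n) (fun u => expR (quad n c u)) plus.
Proof.
move=> cc; have := griffiths_quad B cc.
set c' := sym_coupling _ _ _; set D := expR (\sum_(k < n) d k).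
have -> : ssum (vol n) (fun u => expR (quad n c' u)) plus = Z e n plus * D.
  rewrite /Z -ssumZr; apply: ssum_vol_eq => u up.
  by rewrite quad_energy// expRD.
have -> : ssum (vol n) (fun u => spins B u * expR (quad n c' u)) plus =
   gam e n (spins B) plus * (Z e n plus * D).
  rewrite /gam mulrA divfK ?gt_eqF ?Z_gt0// -ssumZr; apply: ssum_vol_eq => u up.
  by rewrite quad_energy// expRD mulrA.
have ZD : 0 < Z e n plus * D by rewrite mulr_gt0 ?Z_gt0 ?expR_gt0.
by rewrite -mulrA [X in _ <= X]mulrCA mulrC ler_pM2l.
Qed.

Lemma spins_local n B : all (fun i => (i < n)%N) B -> local n (@spins R B).
Proof.
by move=> /allP Bn x y xy; apply: eq_big_seq => i /Bn ilt; rewrite xy.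
Qed.

(** The exterior enters only through the fields on the window, and those of any exterior are bounded
    in modulus by those of [plus]. *)
Lemma gam_spins_le_plus n B x : all (fun i => (i < n)%N) B ->
  gam e n (spins B) x <= gam e n (spins B) plus.
Proof.
move=> Bn.
pose c := sym_coupling n (fun=> 0) (fun k => beta * outer_field n k x).
have sum0 : \sum_(k < n) (0 : R) = 0 by rewrite big1.
have cE u : same_from n u x -> quad n c u = H e n u.
  by move=> ux; rewrite quad_energy// sum0 addr0.
have cc k j : (k < n)%N -> (j <= n)%N ->
    `|c k j| <= sym_coupling n (fun=> 0) (fun k => beta * outer_field n k plus) k j.
  move=> kn jn; rewrite /c /sym_coupling; case: ifP => _.
    by rewrite normrM (ger0_norm beta0) ler_wpM2l// outer_field_plus.
  rewrite mulr0 addr0 ger0_norm// mulr_ge0 ?divr_ge0// addr_ge0//;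
    exact: right_coupling_ge0.
have := griffiths_plus B cc.
have -> : ssum (vol n) (fun u => expR (quad n c u)) plus = Z e n x.
  rewrite (@ssum_local _ _ _ plus x).
    by apply: ssum_vol_eq => u ux; rewrite cE.
  by move=> u v uv; rewrite (quad_local _ uv).
have -> : ssum (vol n) (fun u => spins B u * expR (quad n c u)) plus =
   gam e n (spins B) x * Z e n x.
  rewrite (@ssum_local _ _ _ plus x).
    rewrite /gam divfK ?gt_eqF ?Z_gt0//.
    by apply: ssum_vol_eq => u ux; rewrite cE.
  by move=> u v uv; rewrite (quad_local _ uv) (spins_local Bn uv).
by rewrite ler_pM2r// Z_gt0.
Qed.

(** The larger window frees the spin at n, and neither of its values does better than plus. *)
Lemma gam_spins_dec n B : all (fun i => (i < n)%N) B ->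
  gam e n.+1 (spins B) plus <= gam e n (spins B) plus.
Proof.
move=> Bn; rewrite gamS; last by move=> k; exact: site_energy_from.
have g1 := g_sum1 (fun k => @site_energy_from R J hJ beta k) n plus.
rewrite -[leRHS]mul1r -g1 mulrDl.
by apply: lerD; rewrite ler_pM2l ?g_gt0// gam_spins_le_plus.
Qed.

(** Spin products converge by monotonicity. A cylinder indicator is a product of factors (1 + u_j
    w_j) / 2 over signs and expands into spin products. *)
Lemma gam_plus_cvg N h : local N h -> cvgn (fun n => gam e n h plus).
Proof.
pose P h := cvgn (fun n => gam e n h plus).
have PD F G : P F -> P G -> P (fun w => F w + G w).
  move=> PF PG; rewrite /P.
  have -> : (fun n => gam e n (fun w => F w + G w) plus) =
      (fun n => gam e n F plus + gam e n G plus).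
    by apply/funext => n; rewrite gamD.
  exact: is_cvgD.
have PZ a F : P F -> P (fun w => a * F w).
  move=> PF; rewrite /P.
  have -> : (fun n => gam e n (fun w => a * F w) plus) = (fun n => a * gam e n F plus).
    by apply/funext => n; rewrite gamZ.
  by apply: is_cvgM => //; exact: is_cvg_cst.
have Pspins B : P (spins B).
  pose m := \max_(i <- B) i.+1.
  have Bm n : (m <= n)%N -> all (fun i => (i < n)%N) B.
    move=> mn; apply/allP => i iB; apply: leq_trans mn.
    exact: (@leq_bigmax_seq site B xpredT (fun i => i.+1) i iB isT).
  have cv : cvgn (fun n => gam e (n + m) (spins B) plus).
    apply: nonincreasing_is_cvgn.
      apply/nonincreasing_seqP => n; rewrite addSn.
      by apply: gam_spins_dec; apply: Bm; rewrite leq_addl.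
    exists (-1) => _ [n _ <-]; rewrite -(gam_cst e (n + m) (-1) plus).
    by apply: gam_le => u _; have /andP[] := @spins_le1 R B u.
  by move/cvg_ex: cv => [l cl]; apply/cvg_ex; exists l; rewrite -(cvg_shiftn m).
move=> lh; apply: (local_ind (P := P) _ _ _ lh) => [F G _ _||u].
- exact: PD.
- by move=> a F _; exact: PZ.
have key q B : P (fun w => spins B w * \prod_(j < q) (1 + sp (u j) * sp (w j))).
  elim: q B => [|q IH] B.
    have -> : (fun w => spins B w * \prod_(j < 0) (1 + sp (u j) * sp (w j))) = spins B.
      by apply/funext => w; rewrite big_ord0 mulr1.
    exact: Pspins.
  have -> : (fun w => spins B w * \prod_(j < q.+1) (1 + sp (u j) * sp (w j))) =
    (fun w => spins B w * \prod_(j < q) (1 + sp (u j) * sp (w j)) +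
      sp (u q) * (spins (q :: B) w * \prod_(j < q) (1 + sp (u j) * sp (w j)))).
    by apply/funext => w; rewrite big_ord_recr/= [spins (q :: B) w]big_cons; rewrite /spins; ring.
  by apply: PD => //; exact: PZ.
have -> : \1_[set w | agree N w u] =
   (fun w => 2^-1 ^+ N * (spins [::] w * \prod_(j < N) (1 + sp (u j) * sp (w j)))) :> (config -> R).
  apply/funext => w; rewrite [spins [::] w]big_nil mul1r indicE.
  have [wu|nwu] := pselect (agree N w u).
    rewrite mem_set// (eq_bigr (fun=> 2)).
      by rewrite prodr_const card_ord -exprMn mulVf ?expr1n// pnatr_eq0.
    by move=> j _; rewrite wu// spin_sqr; ring.
  rewrite memNset//=.
  have [j jN wuj] : exists2 j, (j < N)%N & w j <> u j.
    apply: contrapT => H; apply: nwu => j jN; apply: contrapT => wuj.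
    by apply: H; exists j.
  rewrite (bigD1 (Ordinal jN))//=; move: wuj.
  by case: (w j) => //; case: (u j) => //; rewrite /spin => _; ring.
exact: PZ.
Qed.

Definition flip w : config := fun j => ~~ w j.

Lemma spin_neg b : sp (~~ b) = - sp b.
Proof. by case: b; rewrite /spin //= opprK. Qed.

Lemma ssum_flip s (F : config -> R) w : ssum s F (flip w) = ssum s (fun u => F (flip u)) w.
Proof.
elim: s w => //= a s IH w; rewrite -!IH addrC.
have E b : set_spin (flip w) a (~~ b) = flip (set_spin w a b).
  by apply/funext => j; rewrite /flip /set_spin; case: eqP.
by rewrite -(E true) -(E false).
Qed.

Lemma energy_flip n w : H e n (flip w) = H e n w.
Proof.
apply: eq_bigr => k _; rewrite /site_energy.
have -> : local_field J k (flip w) = - local_field J k w.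
  apply: local_field_lim => //.
  have -> : (fun n => \sum_(0 <= j < n) K k j * sp (flip w j)) =
     (fun n => - \sum_(0 <= j < n) K k j * sp (w j)).
    apply/funext => N; rewrite -sumrN; apply: eq_bigr => j _.
    by rewrite /flip spin_neg mulrN.
  by apply: cvgN; exact: local_field_cvg.
by rewrite /flip spin_neg; ring.
Qed.

Lemma gam_flip n h w : gam e n h (flip w) = gam e n (fun u => h (flip u)) w.
Proof.
rewrite /gam /Z !ssum_flip; congr (_ / _); apply: eq_ssum => u;
  by rewrite energy_flip.
Qed.

Theorem multiple_of_magnetization (m0 : R) : 0 < m0 ->
  (forall n, (0 < n)%N -> m0 <= gam e n (spins [:: 0%N]) plus) ->
  multiple_chains (ising_LSS J beta).
Proof.
move=> m00 mag; rewrite ising_LSSE//.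
have ef k : from k (e k) by exact: site_energy_from.
have ec k : cont (e k) by exact: site_energy_cont.
have [mu chmu muE] := limit_chain ef ec (x := fun=> plus) gam_plus_cvg.
have [|nu chnu nuE] := limit_chain ef ec (x := fun=> flip plus).
  move=> N h lh.
  have -> : (fun n => gam e n h (flip plus)) = (fun n => gam e n (fun u => h (flip u)) plus).
    by apply/funext => n; rewrite gam_flip.
  apply: (@gam_plus_cvg N) => x y xy; apply: lh => j jN.
  by rewrite /flip xy.
exists mu, nu; split => // same.
pose A : set config := [set w | w 0%N = true].
have HA : local_set 0 1 A by exact: local_set_cyl.
have cA : cont (\1_A : config -> R) by have [/local_cont] := @local_indic R _ _ _ HA.
have cs : cont (@spins R [:: 0%N]) by apply: (@local_cont _ 1); exact: spins_local.
have spE : spins [:: 0%N] = (fun w => 2 * \1_A w + -1) :> (config -> R).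
  apply/funext => w; rewrite /spins big_seq1 indicE /A.
  case w0 : (w 0%N); rewrite /spin.
    by rewrite mem_set//=; ring.
  by rewrite memNset/= ?w0//; ring.
have ExE' (m : probability Omega R) : Ex m (spins [:: 0%N]) = 2 * Ex m \1_A - 1.
  by rewrite spE ExD ?ExZ ?Ex_cst//; [exact: contZ|exact: cont_cst].
have E : Ex mu (spins [:: 0%N]) = Ex nu (spins [:: 0%N]).
  rewrite !ExE'; congr (2 * _ - 1); apply: EFin_inj; rewrite !(Ex_indic _ HA).
  by apply: same; exact: F_le_measurable (local_set_F HA).
have h1 : m0 <= Ex mu (spins [:: 0%N]).
  by apply: (cvgr_to_ge (muE _ cs)); exists 1%N => // n /= n0; exact: mag.
have h2 : Ex nu (spins [:: 0%N]) <= - m0.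
  apply: (cvgr_to_le (nuE _ cs)); exists 1%N => // n /= n0.
  rewrite gam_flip.
  have -> : (fun u => spins [:: 0%N] (flip u)) = (fun u => (-1) * spins [:: 0%N] u) :> (config -> R).
    by apply/funext => u; rewrite /spins !big_seq1 /flip spin_neg mulN1r.
  by rewrite gamZ mulN1r lerN2 mag.
by move: h1 h2; rewrite E; lra.
Qed.

End Ferromagnet.

(** * The hierarchical model *)

Section BlockAverages.
Context {R : realType}.
Variable t : nat -> R.
Hypothesis t_ge0 : forall p, 0 <= t p.
Implicit Types (u v w : config) (f : R -> R).

Local Notation sp := (@spin R).

(* The unnormalised law of the average spin of a block of size 2^p. *)
Fixpoint avg_int p f : R :=
  if p is q.+1 then
    avg_int q (fun x => avg_int q (fun y =>
      expR (t p * ((x + y) / 2) ^+ 2) * f ((x + y) / 2)))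
  else f 1 + f (-1).

Lemma eq_avg_int p f f' : f =1 f' -> avg_int p f = avg_int p f'.
Proof. by move=> /funext ->. Qed.

Lemma avg_intD p f f' : avg_int p (fun x => f x + f' x) = avg_int p f + avg_int p f'.
Proof.
elim: p f f' => [|p IH] f f' /=; first by ring.
rewrite -IH; apply: eq_avg_int => x; rewrite -IH; apply: eq_avg_int => y; ring.
Qed.

Lemma avg_intZ p c f : avg_int p (fun x => c * f x) = c * avg_int p f.
Proof.
elim: p f => [|p IH] f /=; first by ring.
rewrite -IH; apply: eq_avg_int => x; rewrite -IH; apply: eq_avg_int => y; ring.
Qed.

Lemma avg_intZr p c f : avg_int p (fun x => f x * c) = avg_int p f * c.
Proof. by rewrite mulrC -avg_intZ; apply: eq_avg_int => x; rewrite mulrC. Qed.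

Lemma avg_int_le p f f' : (forall x, -1 <= x <= 1 -> f x <= f' x) ->
  avg_int p f <= avg_int p f'.
Proof.
elim: p f f' => [|p IH] f f' ff /=; first by apply: lerD; apply: ff; lra.
apply: (IH) => x x1; apply: (IH) => y y1; rewrite ler_pM2l ?expR_gt0//.
by apply: ff; lra.
Qed.

Lemma avg_int1_gt0 p : 0 < avg_int p (fun=> 1).
Proof.
elim: p => [|p IH] /=; first by lra.
have N0 : 0 < avg_int p (fun=> 1) * avg_int p (fun=> 1) by rewrite mulr_gt0.
apply: (lt_le_trans N0); rewrite -avg_intZ; apply: avg_int_le => x _.
rewrite mulr1; apply: avg_int_le => y _; rewrite mulr1 -[leLHS]expR0 ler_expR.
by rewrite mulr_ge0// sqr_ge0.
Qed.

Lemma avg_int_exch p q (G : R -> R -> R) :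
  avg_int p (fun x => avg_int q (G x)) = avg_int q (fun y => avg_int p (fun x => G x y)).
Proof.
elim: p G => [|p IH] G /=; first by rewrite -avg_intD.
rewrite -IH; apply: eq_avg_int => x; rewrite -IH; apply: eq_avg_int => y.
by rewrite avg_intZ.
Qed.

Definition second_moment p : R := avg_int p (fun x => x ^+ 2) / avg_int p (fun=> 1).

Lemma second_moment0 : second_moment 0 = 1.
Proof. by rewrite /second_moment /=; field. Qed.

Lemma second_moment_ge0 p : 0 <= second_moment p.
Proof.
rewrite divr_ge0 ?(ltW (avg_int1_gt0 p))//.
rewrite -(mul0r (avg_int p (fun=> 1))) -avg_intZ; apply: avg_int_le => x _.
by rewrite mul0r sqr_ge0.
Qed.

Lemma second_moment_le1 p : second_moment p <= 1.
Proof.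
rewrite ler_pdivrMr ?avg_int1_gt0// mul1r; apply: avg_int_le => x /andP[x1 x2]; nra.
Qed.

(* Two independent block averages exceed their root mean square with the same
   sign with probability at least eps^2/8, and the weight e^(t s^2) makes this
   event dominate. *)
Lemma second_moment_step p eps : 0 < eps ->
  2 * ln (16 / eps ^+ 3) <= t p.+1 * eps ->
  second_moment p - eps <= second_moment p.+1.
Proof.
move=> e0 teps; set tt := t p.+1 in teps.
have [|] := leP (second_moment p - eps) 0.
  by move=> h; exact: le_trans (second_moment_ge0 _).
set F := second_moment p; set u := F - eps => u0.
set N := avg_int p (fun=> 1); have N0 : 0 < N by exact: avg_int1_gt0.
rewrite /second_moment ler_pdivlMr ?avg_int1_gt0// -avg_intZ -subr_ge0.
have -> : avg_int p.+1 (fun x => x ^+ 2) - avg_int p.+1 (fun=> u * 1) =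
    avg_int p.+1 (fun x => x ^+ 2 - u).
  rewrite -[X in _ - X]mul1r -mulNr -avg_intZ -avg_intD.
  by apply: eq_avg_int => x; ring.
rewrite /= -/tt.
(* The threshold lies halfway between u and the second moment u + eps at scale p. The lower half of
   the gap forces |x| >= r with mass at least eps / 2, and the upper half gives an excess eps / 2
   over u. *)
set v := u + eps / 2; have v0 : 0 < v by rewrite /v; lra.
pose r := Num.sqrt v; have r0 : 0 < r by rewrite sqrtr_gt0.
have rv : r ^+ 2 = v by rewrite sqr_sqrtr// ltW.
pose a := avg_int p (fun x => (r <= x)%R%:R); pose b := avg_int p (fun x => (x <= - r)%R%:R).
have a0 : 0 <= a.
  rewrite -(mul0r N) -avg_intZ; apply: avg_int_le => x _; rewrite mul0r; exact: ler0n.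
have b0 : 0 <= b.
  rewrite -(mul0r N) -avg_intZ; apply: avg_int_le => x _; rewrite mul0r; exact: ler0n.
have ab : eps / 2 * N <= a + b.
  have : F * N <= v * N + (a + b).
    rewrite /F /second_moment divfK ?gt_eqF// -avg_intZ -!avg_intD.
    apply: avg_int_le => x /andP[x1 x2]; rewrite mulr1.
    case: (leP r x) => rx; case: (leP x (- r)) => xr /=; nra.
  rewrite /v /u => h; nra.
set D := eps / 2 * expR (tt * v).
have pw x y : -1 <= x <= 1 -> -1 <= y <= 1 ->
    - expR (tt * u) + D * ((r <= x)%R%:R * (r <= y)%R%:R + (x <= - r)%R%:R * (y <= - r)%R%:R) <=
    expR (tt * ((x + y) / 2) ^+ 2) * (((x + y) / 2) ^+ 2 - u).
  move=> /andP[x1 x2] /andP[y1 y2]; set s2 := ((x + y) / 2) ^+ 2.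
  have s20 : 0 <= s2 by exact: sqr_ge0.
  have tt0 : 0 <= tt by exact: t_ge0.
  have D0 : 0 < D by rewrite mulr_gt0 ?expR_gt0// divr_gt0.
  have E0 := expR_gt0 (tt * u); have E1 := expR_gt0 (tt * s2).
  have u1 : u <= 1 by have := second_moment_le1 p; rewrite /u /F; lra.
  (* A negative integrand requires s2 < u, where the weight is at most e^(tt u) and the other factor
     is at least -u >= -1. *)
  have lowb : - expR (tt * u) <= expR (tt * s2) * (s2 - u).
    have [us|su] := leP u s2.
      by apply: (@le_trans _ _ 0); [lra|rewrite mulr_ge0 ?(ltW E1)// subr_ge0].
    have : expR (tt * s2) <= expR (tt * u).
      by rewrite ler_expR ler_wpM2l// ltW.
    nra.
  have highb : v <= s2 -> D <= expR (tt * s2) * (s2 - u).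
    move=> vs; rewrite /D mulrC; apply: ler_pM.
    - exact: expR_ge0.
    - by rewrite divr_ge0// ltW.
    - by rewrite ler_expR ler_wpM2l.
    - by move: vs; rewrite /v; lra.
  have [rx|rx] := leP r x; have [ry|ry] := leP r y;
    have [xr|xr] := leP x (- r); have [yr|yr] := leP y (- r) => /=;
    rewrite ?mulr0 ?mul0r ?mulr1 ?addr0 ?add0r ?mulr0 ?addr0 ?mulr1 //; try lra.
  - have : v <= s2 by rewrite -rv /s2; nra.
    by move=> /highb; lra.
  - have : v <= s2 by rewrite -rv /s2; nra.
    by move=> /highb; lra.
have sum : - expR (tt * u) * (N * N) + D * (a * a + b * b) <=
    avg_int p (fun x => avg_int p (fun y =>
       expR (tt * ((x + y) / 2) ^+ 2) * (((x + y) / 2) ^+ 2 - u))).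
  apply: (@le_trans _ _ (avg_int p (fun x => avg_int p (fun y =>
     - expR (tt * u) + D * ((r <= x)%R%:R * (r <= y)%R%:R + (x <= - r)%R%:R * (y <= - r)%R%:R))))).
    rewrite le_eqVlt; apply/orP; left; apply/eqP.
    transitivity (avg_int p (fun x => - expR (tt * u) * N +
       D * ((r <= x)%R%:R * a + (x <= - r)%R%:R * b))).
      have -> : - expR (tt * u) * (N * N) = avg_int p (fun=> - expR (tt * u) * N * 1).
        by rewrite avg_intZ mulrA.
      have -> : D * (a * a + b * b) = avg_int p (fun x => D * ((r <= x)%R%:R * a + (x <= - r)%R%:R * b)).
        by rewrite avg_intZ avg_intD !avg_intZr.
      by rewrite -avg_intD; apply: eq_avg_int => x; rewrite mulr1.
    apply: eq_avg_int => x; rewrite avg_intD avg_intZ avg_intD !avg_intZ; congr (_ + _).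
    by rewrite -avg_intZ; apply: eq_avg_int => y; rewrite mulr1.
  by apply: avg_int_le => x x1; apply: avg_int_le => y y1; exact: pw.
apply: le_trans sum.
(* Equal signs cost a factor 2: a^2 + b^2 is at least half of (a + b)^2. *)
have aabb : eps ^+ 2 / 8 * (N * N) <= a * a + b * b.
  have h : eps / 2 * N * (eps / 2 * N) <= (a + b) * (a + b).
    by apply: ler_pM => //; rewrite mulr_ge0 ?divr_ge0// ltW.
  have := sqr_ge0 (a - b); nra.
(* Origin of 16 / eps^3: the excess eps / 2, the probability eps^2 / 8 and the relative weight e^(tt
   eps / 2) must have product at least 1. *)
have big : 16 / eps ^+ 3 <= expR (tt * (eps / 2)).
  have e3 : 0 < 16 / eps ^+ 3 by rewrite divr_gt0// exprn_gt0.
  by rewrite -[leLHS]lnK ?posrE// ler_expR; lra.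
have DE : D = expR (tt * u) * (eps / 2 * expR (tt * (eps / 2))).
  by rewrite /D /v mulrDr expRD; ring.
have one : 1 <= eps / 2 * expR (tt * (eps / 2)) * (eps ^+ 2 / 8).
  have E1 : 1 = eps / 2 * (16 / eps ^+ 3) * (eps ^+ 2 / 8).
    by field; rewrite gt_eqF.
  rewrite [leLHS]E1 ler_wpM2r ?divr_ge0 ?sqr_ge0// ler_wpM2l// divr_ge0// ltW//.
rewrite DE mulNr addrC subr_ge0 -(mulrA (expR (tt * u))) ler_pM2l ?expR_gt0//.
have NN : 0 < N * N by rewrite mulr_gt0.
have q0 : 0 < eps / 2 * expR (tt * (eps / 2)) by rewrite mulr_gt0 ?divr_gt0 ?expR_gt0.
apply: (@le_trans _ _ (eps / 2 * expR (tt * (eps / 2)) * (eps ^+ 2 / 8 * (N * N)))).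
  by rewrite mulrA ler_peMl// ltW.
by rewrite ler_pM2l.
Qed.

Definition block p k : seq site := iota (k * 2 ^ p) (2 ^ p).

Lemma block0 k : block 0 k = [:: k].
Proof. by rewrite /block muln1. Qed.

Lemma mem_block p k i : (i \in block p k) = (i %/ 2 ^ p == k)%N.
Proof.
rewrite /block mem_iota; have P0 : (0 < 2 ^ p)%N by rewrite expn_gt0.
apply/idP/eqP => [/andP[h1 h2]|<-].
  apply/eqP; rewrite eqn_leq; apply/andP; split; last by rewrite leq_divRL.
  by rewrite -ltnS ltn_divLR// mulSn addnC.
by rewrite leq_divM/= -mulSnr ltn_ceil.
Qed.

Lemma blockS p k : block p.+1 k = block p k.*2 ++ block p k.*2.+1.
Proof.
rewrite /block -muln2 mulSn -mulnA -expnS addnC -iotaD.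
by rewrite expnS mul2n addnn.
Qed.

Lemma mem_blockS p k i : (i \in block p.+1 k) = (i \in block p k.*2) || (i \in block p k.*2.+1).
Proof. by rewrite blockS mem_cat. Qed.

Lemma block_disjoint p k l i : i \in block p k -> i \in block p l -> k = l.
Proof. by rewrite !mem_block => /eqP <- /eqP. Qed.

Definition avg p k w : R := (2 ^+ p)^-1 * \sum_(i <- block p k) sp (w i).

Lemma avg0 k w : avg 0 k w = sp (w k).
Proof. by rewrite /avg block0 big_seq1 expr0 invr1 mul1r. Qed.

Lemma avgS p k w : avg p.+1 k w = (avg p k.*2 w + avg p k.*2.+1 w) / 2.
Proof.
rewrite /avg blockS big_cat/= exprS; field.
by rewrite expf_neq0// pnatr_eq0.
Qed.

Fixpoint weight p k w : R :=
  if p is q.+1 then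
    weight q k.*2 w * weight q k.*2.+1 w * expR (t p * avg p k w ^+ 2)
  else 1.

Lemma avg_eq p k u v : (forall i, i \in block p k -> u i = v i) -> avg p k u = avg p k v.
Proof.
by move=> uv; congr (_ * _); apply: eq_big_seq => i ik; rewrite uv.
Qed.

Lemma weight_eq p k u v : (forall i, i \in block p k -> u i = v i) ->
  weight p k u = weight p k v.
Proof.
elim: p k => //= p IH k uv; rewrite (avg_eq uv) !(IH _ _)// => i ik;
  by apply: uv; rewrite mem_blockS ik ?orbT.
Qed.

(** The halves of a block are disjoint and interact only through their averages, which matches the
    recursion of [avg_int]. *)
Lemma ssum_block p k (G : R -> config -> R) w :
  ssum (block p.+1 k) (fun u => weight p.+1 k u * G (avg p.+1 k u) u) w =
  ssum (block p k.*2) (fun v => weight p k.*2 v *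
    ssum (block p k.*2.+1) (fun u => weight p k.*2.+1 u *
      (expR (t p.+1 * ((avg p k.*2 v + avg p k.*2.+1 u) / 2) ^+ 2) *
       G ((avg p k.*2 v + avg p k.*2.+1 u) / 2) u)) v) w.
Proof.
rewrite blockS ssum_cat; apply: eq_ssum => v; rewrite -ssumZ.
apply: ssum_eq => u uv.
have E i : i \in block p k.*2 -> u i = v i.
  move=> i1; apply: uv; apply/negP => i2.
  by have := block_disjoint i1 i2; lia.
by rewrite /= avgS (avg_eq E) (weight_eq E); ring.
Qed.

Lemma ssum_weight p k f w :
  ssum (block p k) (fun u => weight p k u * f (avg p k u)) w = avg_int p f.
Proof.
elim: p k f w => [|p IH] k f w.
  by rewrite block0 /= !avg0 !set_spin_at !mul1r /spin.
rewrite (ssum_block p k (fun x _ => f x)).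
rewrite -[RHS](IH k.*2 _ w); apply: eq_ssum => v; congr (_ * _).
by rewrite (IH _ (fun y => expR (t p.+1 * ((avg p k.*2 v + y) / 2) ^+ 2) *
  f ((avg p k.*2 v + y) / 2))).
Qed.

(* By exchangeability of the two halves, every spin of the block has the block
   average as its conditional mean. *)
Lemma ssum_weight_site p k i f w : i \in block p k ->
  ssum (block p k) (fun u => weight p k u * (sp (u i) * f (avg p k u))) w =
  avg_int p (fun x => x * f x).
Proof.
elim: p k f w => [|p IH] k f w ik.
  move: ik; rewrite block0 inE => /eqP ->.
  by rewrite /= !avg0 !set_spin_at !mul1r /spin.
rewrite (ssum_block p k (fun x u => sp (u i) * f x)).
pose G x y := expR (t p.+1 * ((x + y) / 2) ^+ 2) * f ((x + y) / 2).
have Gsym x y : G x y = G y x by rewrite /G addrC.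
pose X := avg_int p (fun x => avg_int p (fun y => x * G x y)).
have XY : avg_int p (fun x => avg_int p (fun y => y * G x y)) = X.
  by rewrite avg_int_exch; apply: eq_avg_int => x; apply: eq_avg_int => y; rewrite Gsym.
have -> : avg_int p.+1 (fun x => x * f x) = X.
  transitivity ((X + X) / 2); last by lra.
  rewrite -{2}XY /X -avg_intD -avg_intZr /=; apply: eq_avg_int => x.
  by rewrite -avg_intD -avg_intZr; apply: eq_avg_int => y; rewrite /G; ring.
move: ik; rewrite mem_blockS => /orP[] ik.
  have -> : X = avg_int p (fun x => x * avg_int p (G x)).
    by apply: eq_avg_int => x; rewrite avg_intZ.
  rewrite -(IH k.*2 _ w)//; apply: eq_ssum => v; congr (_ * _).
  rewrite -(ssum_weight p k.*2.+1 (G (avg p k.*2 v)) v) -ssumZ.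
  apply: ssum_eq => u uv.
  have -> : u i = v i.
    apply: uv; apply/negP => i2.
    by have := block_disjoint ik i2; lia.
  by rewrite /G; ring.
rewrite -XY -[RHS](ssum_weight p k.*2 _ w); apply: eq_ssum => v; congr (_ * _).
rewrite -(IH k.*2.+1 (G (avg p k.*2 v)) v)//; apply: eq_ssum => u.
by rewrite /G; ring.
Qed.

(** The pair coupling hidden in the squared averages: a block of 2^q spins gives each ordered pair
    the weight t q / 4^q, and all scales at which i and j share a block add up. *)
Definition block_coupling p i j : R :=
  \sum_(1 <= q < p.+1) (i %/ 2 ^ q == j %/ 2 ^ q)%N%:R * (t q / 4 ^+ q).

Lemma block_coupling_ge0 p i j : 0 <= block_coupling p i j.
Proof.
by apply: sumr_ge0 => q _; rewrite mulr_ge0 ?ler0n// divr_ge0// exprn_ge0.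
Qed.

Lemma block_couplingC p i j : block_coupling p i j = block_coupling p j i.
Proof. by apply: eq_bigr => q _; rewrite eq_sym. Qed.

Lemma block_coupling0 p i j : (i %/ 2 ^ p != j %/ 2 ^ p)%N -> block_coupling p i j = 0.
Proof.
move=> ij; rewrite /block_coupling big_nat big1// => q /andP[_ qp].
rewrite [X in X%:R](_ : _ = 0%N) ?mul0r//; apply/eqP; rewrite eqb0.
apply: contra ij => /eqP E; rewrite ltnS in qp.
by rewrite -(subnKC qp) expnD !divnMA E.
Qed.

Lemma weightE p k w : weight p k w =
  expR (\sum_(i <- block p k) \sum_(j <- block p k)
    block_coupling p i j * (sp (w i) * sp (w j))).
Proof.
elim: p k => [|p IH] k /=.
  rewrite big1_seq ?expR0// => i _; rewrite big1_seq// => j _.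
  by rewrite /block_coupling big_geq// mul0r.
rewrite !IH -!expRD; congr expR.
have E i j : i \in block p.+1 k -> j \in block p.+1 k ->
    block_coupling p.+1 i j = block_coupling p i j + t p.+1 / 4 ^+ p.+1.
  rewrite !mem_block => /eqP ip /eqP jp.
  by rewrite {1}/block_coupling big_nat_recr//= ip jp eqxx mul1r.
rewrite [RHS](eq_big_seq (fun i => \sum_(j <- block p.+1 k)
    block_coupling p i j * (sp (w i) * sp (w j)) +
    \sum_(j <- block p.+1 k) t p.+1 / 4 ^+ p.+1 * (sp (w i) * sp (w j)))); last first.
  move=> i ik /=; rewrite -big_split/=; apply: eq_big_seq => j jk.
  by rewrite E// mulrDl.
rewrite big_split/=; congr (_ + _).
  rewrite blockS big_cat/=; congr (_ + _).
    apply: eq_big_seq => i ik; rewrite big_cat/= [X in _ + X]big1_seq ?addr0//.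
    move=> j /andP[_ jk]; rewrite block_coupling0 ?mul0r//.
    by move: ik jk; rewrite !mem_block => /eqP -> /eqP ->; rewrite neq_ltn leqnn.
  apply: eq_big_seq => i ik; rewrite big_cat/= [X in X + _]big1_seq ?add0r//.
  move=> j /andP[_ jk]; rewrite block_coupling0 ?mul0r//.
  by move: ik jk; rewrite !mem_block => /eqP -> /eqP ->; rewrite neq_ltn leqnn orbT.
have -> : avg p.+1 k w ^+ 2 = (4 ^+ p.+1)^-1 *
   ((\sum_(i <- block p.+1 k) sp (w i)) * (\sum_(j <- block p.+1 k) sp (w j))).
  rewrite /avg exprMn -expr2; congr (_ * _).
  by rewrite exprVn -exprM mulnC exprM; congr ((_ ^+ _)^-1); ring.
rewrite mulrA mulr_suml mulr_sumr; apply: eq_bigr => i _.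
by rewrite !mulr_sumr; apply: eq_bigr => j _.
Qed.

Lemma avg_flip p k w : avg p k (flip w) = - avg p k w.
Proof.
by rewrite /avg -mulrN -sumrN; congr (_ * _); apply: eq_bigr => i _; exact: spin_neg.
Qed.

Lemma weight_flip p k w : weight p k (flip w) = weight p k w.
Proof. by elim: p k => //= p IH k; rewrite !IH avg_flip sqrrN. Qed.

Lemma weight_gt0 p k w : 0 < weight p k w.
Proof. by elim: p k => //= p IH k; rewrite !mulr_gt0 ?expR_gt0. Qed.

End BlockAverages.

(** * Plus magnetization against the hierarchical second moment *)

Section MagnetizationBound.
Context {R : realType}.
Variable J : site -> site -> R.
Hypothesis hJ : couplings J.
Hypothesis hF : ferromagnetic J.
Variables (beta : R) (t : nat -> R) (P n : nat).
Hypothesis beta0 : 0 <= beta.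
Hypothesis t_ge0 : forall p, 0 <= t p.
Hypothesis n0 : (0 < n)%N.
Hypothesis nP : (n.*2 <= 2 ^ P)%N.

Local Notation sp := (@spin R).
Local Notation e := (site_energy J beta).
Local Notation a := (block_coupling t P).
Local Notation W := (weight t P 0).
Local Notation m := (gam e n (spins [:: 0%N]) plus).
Local Notation M := (2 ^ P)%N.

(** The 2 appears because the exponent of the hierarchical weight runs over ordered pairs, while the
    Ising energy counts each pair once. *)
Hypothesis aJ : forall i j, i != j -> 2 * a i j <= beta * J i j.

Let nM : (n <= M)%N.
Proof. by apply: leq_trans nP; rewrite -addnn leq_addr. Qed.

Lemma blockE : block P 0 = index_iota 0 M.
Proof. by rewrite /block mul0n /index_iota subn0. Qed.

Lemma block_perm : perm_eq (block P 0) (iota n (M - n) ++ vol n).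
Proof.
rewrite /block mul0n -{1}(subnKC nM) iotaD perm_catC add0n perm_cat2l.
by rewrite perm_sym vol_perm.
Qed.

Definition outer_coupling (v : config) k j : R :=
  if j == n then 2 * \sum_(n <= l < M) a k l * sp (v l) else a k j.

Lemma weight_quad v : exists2 C : R, 0 < C & forall u, same_from n u v ->
  W u = C * expR (quad n (outer_coupling v) u).
Proof.
exists (expR (\sum_(n <= i < M) \sum_(n <= j < M) a i j * (sp (v i) * sp (v j)))).
  exact: expR_gt0.
move=> u uv; rewrite weightE -expRD blockE; congr expR.
have split (G : nat -> R) : \sum_(0 <= i < M) G i = \sum_(i < n) G i + \sum_(n <= i < M) G i.
  by rewrite (@big_cat_nat _ _ _ n 0%N M)//= big_mkord.
have uvE (F G : nat -> R) : (forall i, u i = v i -> F i = G i) ->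
    \sum_(n <= i < M) F i = \sum_(n <= i < M) G i.
  by move=> FG; apply: eq_big_nat => i /andP[ni _]; apply: FG; exact: uv.
rewrite split; under eq_bigr => i _ do rewrite split.
under [X in _ + X]eq_bigr => i _ do rewrite split.
rewrite !big_split/= addrA [RHS]addrC; congr (_ + _); last first.
  apply: (uvE) => i ->; apply: (uvE) => j ->; by [].
rewrite exchange_big/= [X in _ + _ + X]exchange_big/= -addrA.
rewrite exchange_big/= -big_split/=.
rewrite /quad -big_split/=; apply: eq_bigr => k _; rewrite mulrDr mulr_sumr.
congr (_ + _).
  by apply: eq_bigr => j _; rewrite /outer_coupling ltn_eqF//; ring.
rewrite /outer_coupling eqxx -big_split/= mulrCA mulr_sumr mulr_sumr.
apply: (uvE) => j ->; rewrite (block_couplingC _ _ j); ring.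
Qed.

Lemma outer_coupling_le v k j : (k < n)%N -> (j <= n)%N ->
  `|outer_coupling v k j| <=
  sym_coupling J beta n (fun k => a k k) (fun k => beta * outer_field J n k plus) k j.
Proof.
move=> kn jn; rewrite /outer_coupling /sym_coupling; case: eqP => [_|/eqP jn'].
  apply: (@le_trans _ _ (beta * \sum_(n <= l < M) right_coupling J k l)); last first.
    by rewrite ler_wpM2l// outer_field_ge.
  rewrite normrM ger0_norm// !mulr_sumr.
  apply: (le_trans (ler_wpM2l _ (ler_norm_sum _ _ _))) => //.
  rewrite mulr_sumr !big_nat; apply: ler_sum => l /andP[nl _].
  rewrite normrM spin_norm mulr1 ger0_norm ?block_coupling_ge0//.
  have kl : (k < l)%N by exact: leq_trans nl.
  by rewrite /right_coupling kl aJ// neq_ltn kl.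
rewrite ger0_norm ?block_coupling_ge0//.
have [->|kj] := eqVneq k j.
  by rewrite mul1r lerDr mulr_ge0 ?divr_ge0// addr_ge0//; exact: right_coupling_ge0.
rewrite mul0r addr0; have := aJ kj.
have -> : right_coupling J k j + right_coupling J j k = J k j.
  rewrite /right_coupling; case: (ltngtP k j) => [kj'|kj'|E].
  - by rewrite addr0.
  - by rewrite add0r hJ.1// eq_sym.
  - by rewrite E eqxx in kj.
by lra.
Qed.

Lemma spin0_le v :
  ssum (vol n) (fun u => W u * sp (u 0%N)) v <= m * ssum (vol n) W v.
Proof.
have [C C0 WE] := weight_quad v.
have -> : ssum (vol n) W v =
    C * ssum (vol n) (fun u => expR (quad n (outer_coupling v) u)) plus.
  rewrite (ssum_vol_eq WE) ssumZ; congr (_ * _); apply: ssum_local => x y xy.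
  by rewrite (quad_local _ xy).
have -> : ssum (vol n) (fun u => W u * sp (u 0%N)) v = C * ssum (vol n)
    (fun u => spins [:: 0%N] u * expR (quad n (outer_coupling v) u)) plus.
  rewrite -ssumZ (@ssum_local _ n _ plus v).
    apply: ssum_vol_eq => u uv; rewrite WE// /spins big_seq1; ring.
  by move=> x y xy; rewrite (quad_local _ xy) /spins !big_seq1 xy.
rewrite mulrCA ler_pM2l//; apply: griffiths_plus => // k j kn jn.
exact: outer_coupling_le.
Qed.

(** The weight is invariant under the flip, so the one-sided bound applies to v and to its flip. *)
Lemma spin0_norm v :
  `|ssum (vol n) (fun u => W u * sp (u 0%N)) v| <= m * ssum (vol n) W v.
Proof.
rewrite ler_norml spin0_le andbT lerNl.
have := spin0_le (flip v); rewrite !ssum_flip.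
under eq_ssum => u do rewrite weight_flip /flip spin_neg mulrN.
rewrite ssumN; under [in leRHS]eq_ssum => u do rewrite weight_flip.
by [].
Qed.

(** Conditionally on the spins outside the window, the spin at j is a constant sign. *)
Lemma correlation_le j : (n <= j < M)%N ->
  ssum (block P 0) (fun u => W u * (sp (u 0%N) * sp (u j))) plus <=
  m * ssum (block P 0) W plus.
Proof.
move=> /andP[nj jM]; rewrite !(ssum_perm _ _ block_perm) !ssum_cat -ssumZ.
apply: ssum_le => v _.
have -> : ssum (vol n) (fun u => W u * (sp (u 0%N) * sp (u j))) v =
    ssum (vol n) (fun u => W u * sp (u 0%N)) v * sp (v j).
  by rewrite -ssumZr; apply: ssum_vol_eq => u uv; rewrite (uv j)// mulrA.
apply: le_trans (spin0_norm v); apply: (le_trans (ler_norm _)).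
by rewrite normrM spin_norm mulr1.
Qed.

(** Summed over j, the two-point functions with site 0 give 2^P times the second moment. At most
    half of the sites lie in the window, where they are bounded by 1, and the others are bounded by
    m; thus 3/4 <= 1/2 + m/2. *)
Lemma magnetization_ge : 3 / 4 <= second_moment t P -> 1 / 2 <= m.
Proof.
move=> h; rewrite leNgt; apply/negP => m2.
set N := ssum (block P 0) W plus.
have NE : N = avg_int t P (fun=> 1).
  by rewrite -(ssum_weight t P 0 (fun=> 1) plus); apply: eq_ssum => u; rewrite mulr1.
have N0 : 0 < N by rewrite NE avg_int1_gt0.
have M0 : 0 < 2 ^+ P :> R by rewrite exprn_gt0.
have FE : \sum_(0 <= j < M) ssum (block P 0) (fun u => W u * (sp (u 0%N) * sp (u j))) plus =
    2 ^+ P * (second_moment t P * N).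
  rewrite /second_moment -NE divfK ?gt_eqF//.
  have -> : avg_int t P (fun x => x ^+ 2) = avg_int t P (fun x => x * x).
    by apply: eq_avg_int => x; rewrite expr2.
  rewrite -(@ssum_weight_site _ t P 0 0 (fun x => x) plus); last first.
    by rewrite mem_block div0n.
  rewrite -ssumZ -ssum_sum; apply: eq_ssum => u.
  rewrite /avg blockE -!mulr_sumr; field; by rewrite gt_eqF.
have bound : 2 ^+ P * (second_moment t P * N) <= n%:R * N + (2 ^+ P - n%:R) * (m * N).
  rewrite -FE (@big_cat_nat _ _ _ n 0%N M)//=; apply: lerD.
    rewrite -[n in n%:R]subn0 mulr_natl -sumr_const_nat !big_nat.
    apply: ler_sum => j _; apply: ssum_le => u _.
    have := weight_gt0 t P 0 u; rewrite -[leRHS]mulr1 => w0; rewrite ler_pM2l//.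
    by apply: (le_trans (ler_norm _)); rewrite normrM !spin_norm mulr1.
  have -> : 2 ^+ P - n%:R = (M - n)%:R :> R by rewrite natrB// natrX.
  rewrite mulr_natl -sumr_const_nat !big_nat.
  by apply: ler_sum => j jM; exact: correlation_le.
have nR : 2 * n%:R <= 2 ^+ P :> R by rewrite -natrX -natrM ler_nat mul2n.
have nR0 : 0 < n%:R :> R by rewrite ltr0n.
have : 2 ^+ P * second_moment t P <= n%:R + (2 ^+ P - n%:R) * m.
  by rewrite -(ler_pM2r N0); lra.
have : (2 ^+ P - n%:R) * m < (2 ^+ P - n%:R) * (1 / 2) by rewrite ltr_pM2l//; lra.
have : 2 ^+ P * (3 / 4) <= 2 ^+ P * second_moment t P by rewrite ler_pM2l.
lra.
Qed.

End MagnetizationBound.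

(** * Dyadic scales *)

Section Logarithms.
Context {R : realType}.

Lemma expR1_le4 : expR 1 <= 4 :> R.
Proof.
have h : 1 / 2 <= expR (- (1 / 2)) :> R by have := @expR_ge1Dx R (- (1 / 2)); lra.
have E : expR 1 * (expR (- (1 / 2)) * expR (- (1 / 2))) = 1 :> R.
  by rewrite -!expRD -[RHS]expR0; congr expR; lra.
have h2 : 1 / 4 <= expR (- (1 / 2)) * expR (- (1 / 2)) :> R by nra.
have := ler_wpM2l (expR_ge0 (1 : R)) h2; rewrite E; lra.
Qed.

Definition lnln p : R := ln (ln (2 ^+ p + 4)).

(** Follows from e <= 4 and 4^(p+4) <= (2^p + 4)^4, which is an equality at p = 2; this is why p = 0
    and p = 1 are treated apart. *)
Lemma ln_pow2_ge p : (p%:R + 4) / 4 <= ln (2 ^+ p + 4) :> R.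
Proof.
have P0 q : 0 < 2 ^+ q + 4 :> R by rewrite addr_gt0// exprn_gt0.
have key : 4 ^+ (p + 4) <= (2 ^+ p + 4) ^+ 4 :> R.
  case: p => [|[|p]]; [by rewrite expr0; lra|by rewrite expr1; lra|].
  elim: p => [|p IH]; first by lra.
  have -> : (2 ^+ p.+3 + 4 : R) = 2 * (2 ^+ p.+2 + 4) - 4 by rewrite [2 ^+ p.+3]exprS; ring.
  have h : 4 <= 2 ^+ p.+2 :> R by rewrite -[4]/(4%:R) -natrX ler_nat (@leq_pexp2l 2 2).
  rewrite addSn exprS; apply: (le_trans (ler_wpM2l _ IH)) => //.
  move: (2 ^+ p.+2) h => x h.
  have -> : 2 * (x + 4) - 4 = 2 * x + 4 by ring.
  have w : (3 / 2 * (x + 4)) ^+ 4 <= (2 * x + 4) ^+ 4.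
    by apply: lerXn2r; rewrite ?nnegrE; lra.
  by apply: le_trans w; rewrite exprMn ler_wpM2r ?exprn_ge0//; lra.
have e4 : expR (p%:R + 4) <= (2 ^+ p + 4) ^+ 4 :> R.
  apply: le_trans key; rewrite -natrD -[_%:R]mulr1 expRM_natl.
  by apply: lerXn2r; rewrite ?nnegrE ?expR_ge0 ?expR1_le4.
have := e4; rewrite -ler_ln ?posrE ?expR_gt0 ?exprn_gt0//.
by rewrite expRK lnXn//; lra.
Qed.

Lemma ln5_gt1 : 1 < ln 5 :> R.
Proof.
by rewrite -[ltLHS]expRK ltr_ln ?posrE ?expR_gt0//; have := expR1_le4; lra.
Qed.

Let pow0 : 2 ^+ 0 + 4 = 5 :> R.
Proof. by rewrite expr0; ring. Qed.

Lemma lnln0_gt0 : 0 < lnln 0.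
Proof. by apply: ln_gt0; rewrite pow0 ln5_gt1. Qed.

Lemma ln_pow2_ge5 p : ln 5 <= ln (2 ^+ p + 4) :> R.
Proof.
have : 1 <= 2 ^+ p :> R by rewrite exprn_ege1//; lra.
by move=> h; rewrite ler_ln ?posrE//; lra.
Qed.

Lemma lnln_ge0 p : lnln 0 <= lnln p.
Proof.
have h := ln_pow2_ge5 p; have h5 := ln5_gt1.
rewrite /lnln pow0 ler_ln ?posrE//; lra.
Qed.

(** Above 16, p + 4 is at most ((p + 4) / 4)^2, which gives the factor 2. The remaining p are
    absorbed into K, since [lnln] stays above [lnln 0] > 0. *)
Lemma ln_le_lnln : exists2 K : R, 0 < K &
  forall p, ln (p%:R + 4) <= K * lnln p.
Proof.
have l0 := lnln0_gt0.
have l16 : 0 < ln 16 :> R by apply: ln_gt0; lra.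
exists (2 + ln 16 / lnln 0) => [|p]; first by rewrite addr_gt0// divr_gt0.
have lp := lnln_ge0 p.
have p0 : 0 <= p%:R :> R by [].
have [h|h] := leP (p%:R + 4 : R) 16.
  have : ln (p%:R + 4) <= ln 16 :> R by rewrite ler_ln ?posrE//; lra.
  move=> /le_trans; apply; rewrite mulrDl.
  have : ln 16 <= ln 16 / lnln 0 * lnln p.
    by rewrite -mulrA ler_peMr// ?(ltW l16)// mulrC ler_pdivlMr// mul1r.
  by lra.
have : ln (p%:R + 4) <= 2 * lnln p :> R.
  have q0 : 0 < (p%:R + 4) / 4 :> R by lra.
  have h4 := ln_pow2_ge p.
  have : ln ((p%:R + 4) / 4) <= lnln p :> R by rewrite ler_ln ?posrE//; lra.
  have : ln (p%:R + 4) <= ln (((p%:R + 4) / 4) ^+ 2) :> R.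
    by rewrite ler_ln ?posrE ?exprn_gt0//; nra.
  by rewrite lnXn// mulr2n; lra.
move=> /le_trans; apply; rewrite ler_wpM2r//; first by lra.
by rewrite lerDl divr_ge0// ltW.
Qed.

(** The point of 3/2 is to be less than 2, the growth that [strength] is allowed per scale. *)
Lemma ln_succ p : ln (p.+1%:R + 4) <= 3 / 2 * ln (p%:R + 4) :> R.
Proof.
have p0 : 0 <= p%:R :> R by [].
rewrite -natr1; move: (p%:R : R) p0 => x x0.
have : ln ((x + 1 + 4) ^+ 2) <= ln ((x + 4) ^+ 3).
  by rewrite ler_ln ?posrE; [nra|apply: exprn_gt0; lra|apply: exprn_gt0; lra].
by rewrite !lnXn; lra.
Qed.

End Logarithms.

Section DyadicScales.
Context {R : realType}.
Variable c : nat -> R.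
Hypothesis c_gt0 : forall r, (0 < r)%N -> 0 < c r.
Hypothesis c_dec : forall r s, (0 < r)%N -> (r <= s)%N -> c s <= c r.

Local Notation term := (fun r : nat => ln (ln (r%:R + 4)) / (r%:R ^+ 3 * c r) : R).

Let A p : R := 4 ^+ p * c (2 ^ p).

Let A_gt0 p : 0 < A p.
Proof. by rewrite mulr_gt0 ?exprn_gt0// c_gt0// expn_gt0. Qed.

Let term_ge0 r : (0 < r)%N -> 0 <= term r.
Proof.
move=> r0; rewrite divr_ge0 ?mulr_ge0 ?exprn_ge0 ?(ltW (c_gt0 r0))//.
apply: ln_ge0; apply: (le_trans (ltW ln5_gt1)).
have : 1 <= r%:R :> R by rewrite ler1n.
by move=> h; rewrite ler_ln ?posrE; lra.
Qed.

(** Cauchy condensation: the 2^P indices in (2^P, 2^(P+1)] satisfy r^3 <= 8^(P+1) = 8 * 2^P * 4^P,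
    which leaves the factor 8. *)
Lemma condensation P :
  \sum_(0 <= p < P) lnln p / A p <= 8 * \sum_(1 <= r < (2 ^ P).+1) term r.
Proof.
elim: P => [|P IH]; first by rewrite big_geq// big_nat1 mulr_ge0// term_ge0.
have P0 : (0 < 2 ^ P)%N by rewrite expn_gt0.
have PP : (2 ^ P <= 2 ^ P.+1)%N by rewrite leq_pexp2l.
rewrite big_nat_recr//= (@big_cat_nat _ _ _ (2 ^ P).+1 1 (2 ^ P.+1).+1)//=.
rewrite mulrDr; apply: lerD => //.
have -> : lnln P / A P = 8 * \sum_((2 ^ P).+1 <= r < (2 ^ P.+1).+1) lnln P / (8 ^+ P.+1 * c (2 ^ P)).
  rewrite sumr_const_nat subSS expnS mul2n -addnn addnK -[X in 8 * X]mulr_natr natrX.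
  have -> : 8 ^+ P.+1 = 8 * (4 ^+ P * 2 ^+ P) :> R.
    by rewrite -exprMn exprS; congr (_ * _ ^+ _); ring.
  rewrite /A; field; rewrite !expf_neq0//= gt_eqF//; exact: c_gt0.
rewrite ler_pM2l// [leLHS]big_nat [leRHS]big_nat; apply: ler_sum => r /andP[Pr rP].
have r0 : (0 < r)%N by apply: leq_trans Pr.
have r0' : 0 < r%:R :> R by rewrite ltr0n.
have rR : 2 ^+ P <= r%:R :> R by rewrite -natrX ler_nat ltnW.
have l0 : 0 <= lnln P :> R by apply: le_trans (lnln_ge0 P); exact/ltW/lnln0_gt0.
apply: ler_pM => //.
- by rewrite invr_ge0 mulr_ge0 ?exprn_ge0// ltW// c_gt0.
- have h := @ln_pow2_ge5 R P; have h5 := @ln5_gt1 R.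
  have q0 : 0 < 2 ^+ P :> R by rewrite exprn_gt0.
  have : ln (2 ^+ P + 4) <= ln (r%:R + 4) :> R by rewrite ler_ln ?posrE; lra.
  by move=> h6; rewrite /lnln ler_ln ?posrE; lra.
rewrite lef_pV2 ?posrE ?mulr_gt0 ?exprn_gt0 ?c_gt0//.
apply: ler_pM; rewrite ?exprn_ge0 ?(ltW (c_gt0 _))//; last by rewrite c_dec// ltnW.
have -> : 8 ^+ P.+1 = (2 ^+ P.+1) ^+ 3 :> R.
  by rewrite -exprM mulnC exprM; congr (_ ^+ _); ring.
by apply: lerXn2r; rewrite ?nnegrE ?exprn_ge0// -natrX ler_nat.
Qed.

(* The largest minorant of 4^p c(2^p) growing at most by a factor 2 per scale. *)
Fixpoint strength p : R :=
  if p is q.+1 then Num.min (2 * strength q) (A p) else A 0.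

Lemma strength_gt0 p : 0 < strength p.
Proof. by elim: p => //= p IH; rewrite lt_min mulr_gt0//=. Qed.

Lemma strength_le p : strength p <= A p.
Proof. by case: p => //= p; rewrite ge_min lexx orbT. Qed.

Lemma strength_double p : strength p.+1 <= 2 * strength p.
Proof. by rewrite /= ge_min lexx. Qed.

(** At most doubling against 4^q means at least halving per scale, so the sum is at most twice its
    first term. It bounds the total coupling of two sites that first share a block at scale p0. *)
Lemma strength_sum p0 P :
  \sum_(p0 <= q < P) strength q / 4 ^+ q <= 2 * c (2 ^ p0).
Proof.
pose f q := strength q / 4 ^+ q.
have f0 q : 0 <= f q by rewrite divr_ge0 ?exprn_ge0 ?(ltW (strength_gt0 q)).
have fS q : 2 * f q.+1 <= f q.
  rewrite /f mulrA ler_pdivrMr ?exprn_gt0// exprS.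
  have -> : strength q / 4 ^+ q * (4 * 4 ^+ q) = 4 * strength q.
    by field; rewrite expf_neq0.
  by have := strength_double q; lra.
have fA : f p0 <= c (2 ^ p0).
  by rewrite /f ler_pdivrMr ?exprn_gt0// mulrC strength_le.
apply: (@le_trans _ _ (2 * f p0)); last by rewrite ler_pM2l.
have [Pp|pP] := leqP P p0; first by rewrite big_geq// mulr_ge0.
apply: (@le_trans _ _ (\sum_(p0 <= q < P) (2 * f q - 2 * f q.+1))).
  by rewrite [leLHS]big_nat [leRHS]big_nat; apply: ler_sum => q _; have := fS q; rewrite -/(f q); lra.
have -> : \sum_(p0 <= q < P) (2 * f q - 2 * f q.+1) = 2 * f p0 - 2 * f P.
  rewrite -[RHS]opprB -(telescope_sumr (fun q => 2 * f q) (ltnW pP)) -sumrN.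
  by apply: eq_bigr => q _; rewrite opprB.
by have := f0 P; lra.
Qed.

Let lam p : R := ln (p%:R + 4).

Let lam_ge0 p : 0 <= lam p.
Proof. by apply: ln_ge0; rewrite ler_wpDl//; lra. Qed.

(** A term is either at most 3/4 of its predecessor, by [ln_succ] and doubling, or a term of the
    condensed series. The partial sums thus satisfy s <= 3 s / 4 + Q, which keeps them below 4 Q. *)
Lemma strength_series (S : R) : (forall n, \sum_(1 <= r < n) term r <= S) ->
  exists2 Q : R, 0 < Q & forall P, \sum_(0 <= p < P) lam p / strength p <= Q.
Proof.
move=> HS; have [K K0 HK] := @ln_le_lnln R.
have S0 : 0 <= S by have := HS 1%N; rewrite big_geq.
pose Q := K * (8 * S).
have sA P : \sum_(0 <= p < P) lam p / A p <= Q.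
  apply: (@le_trans _ _ (K * \sum_(0 <= p < P) lnln p / A p)).
    rewrite mulr_sumr; apply: ler_sum => p _.
    by rewrite mulrA ler_wpM2r ?HK// invr_ge0 ltW.
  rewrite ler_pM2l//; apply: (le_trans (condensation P)).
  by rewrite ler_pM2l.
have Q0 : 0 <= Q by rewrite mulr_ge0 ?mulr_ge0// ltW.
exists (4 * Q + 1); first by lra.
suff h P : \sum_(0 <= p < P) lam p / strength p <= 4 * Q.
  by move=> P; have := h P; lra.
elim: P => [|P IH]; first by rewrite big_geq// mulr_ge0.
rewrite big_nat_recl//=.
have : \sum_(0 <= p < P) lam p.+1 / strength p.+1 <=
    3 / 4 * (\sum_(0 <= p < P) lam p / strength p) + \sum_(0 <= p < P) lam p.+1 / A p.+1.
  rewrite mulr_sumr -big_split/=; apply: ler_sum => p _.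
  have b0 := strength_gt0 p; have a0 := A_gt0 p.+1; have l1 := lam_ge0 p.+1.
  have ll : lam p.+1 <= 3 / 2 * lam p := ln_succ p.
  rewrite /Num.min; case: ifP => _; last first.
    by rewrite lerDr mulr_ge0// divr_ge0// ltW.
  have : lam p.+1 / (2 * strength p) <= 3 / 4 * (lam p / strength p).
    rewrite ler_pdivrMr ?mulr_gt0//.
    have -> : 3 / 4 * (lam p / strength p) * (2 * strength p) = 3 / 2 * lam p.
      by field; rewrite gt_eqF.
    exact: ll.
  have : 0 <= lam p.+1 / A p.+1 by rewrite divr_ge0// ltW.
  lra.
have := sA P.+1; rewrite big_nat_recl//= -/(lam 0).
lra.
Qed.

End DyadicScales.

(** * Dyson's criterion *)

Section PhaseTransition.
Context {R : realType}.
Variable J : site -> site -> R.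
Hypothesis hJ : couplings J.
Hypothesis hF : ferromagnetic J.

Hypothesis hD : decreasing_couplings J.
Let c r : R := J 0%N r.

Let dist0 r : dist 0 r = r.
Proof. by case: r => // r; rewrite dist_lt// subn0. Qed.

Let dist_neq i j : i != j -> (0 < dist i j)%N.
Proof. by rewrite lt0n /dist distn_eq0. Qed.

Let neq0 r : (0 < r)%N -> 0%N != r.
Proof. by rewrite lt0n eq_sym. Qed.

(** Monotonicity in the distance applies in both directions to pairs at equal distance, so J is
    translation invariant. *)
Let J_dist i j : i != j -> J i j = c (dist i j).
Proof.
move=> ij; have d0 := neq0 (dist_neq ij).
by apply/eqP; rewrite eq_le; apply/andP; split; apply: hD => //; rewrite dist0.
Qed.

Let c_ge0 r : (0 < r)%N -> 0 <= c r.
Proof. by move=> /neq0; exact: hF. Qed.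

Let c_dec r s : (0 < r)%N -> (r <= s)%N -> c s <= c r.
Proof.
move=> r0 rs; apply: hD; rewrite ?dist0//; apply: neq0 => //.
exact: leq_trans rs.
Qed.

Let JsupE r : (0 < r)%N -> Jsup J r = (c r)%:E.
Proof.
move=> r0; apply/eqP; rewrite eq_le; apply/andP; split; last first.
  have := Jsup_ub J 0 r; rewrite dist0; apply: le_trans; rewrite lee_fin.
  exact: ler_norm.
apply: ge_ereal_sup => _ [i [j [ijr ->]]]; rewrite lee_fin.
have ij : i != j by apply: contraTN r0 => /eqP ij; rewrite -ijr ij /dist distnn.
by rewrite ger0_norm ?hF// J_dist// ijr.
Qed.

Let c_sum n : \sum_(1 <= r < n) c r <= outer_field J 0 0 plus.
Proof.
apply: le_trans (outer_field_ge hJ hF 0 (leq0n n)).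
have [n1|n1] := leqP n 1; last first.
  rewrite [leRHS]big_ltn ?(ltnW n1)// [X in _ <= X + _]/right_coupling ltnn add0r.
  rewrite le_eqVlt; apply/orP; left; apply/eqP.
  by apply: eq_big_nat => r /andP[r0 _]; rewrite /right_coupling r0.
by rewrite big_geq// sumr_ge0// => j _; exact: right_coupling_ge0.
Qed.

(** The sites on each side of i contribute at most the sum of the c r. *)
Let row_sum i n : \sum_(0 <= j < n | j != i) `|J i j| <= 2 * outer_field J 0 0 plus.
Proof.
have E j : j != i -> `|J i j| = c (dist i j).
  by rewrite eq_sym => ij; rewrite ger0_norm ?hF// J_dist.
apply: (@le_trans _ _ (\sum_(0 <= j < n + i.+1 | j != i) `|J i j|)).
  by rewrite [leRHS](@big_cat_nat _ _ _ n)//= ?leq_addr// lerDl sumr_ge0.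
rewrite (@big_cat_nat _ _ _ i)//=; last by rewrite addnS ltnW// ltnS leq_addl.
rewrite [X in _ + X]big_ltn_cond ?eqxx/=; last by rewrite addnS ltnS leq_addl.
rewrite mulr_natl.
apply: lerD.
  apply: le_trans (c_sum i.+1); rewrite big_add1/= big_nat_rev/= add0n.
  rewrite big_mkcond [leLHS]big_nat [leRHS]big_nat; apply: ler_sum => j /andP[_ ji].
  have d : dist i (i - j.+1)%N = j.+1.
    by rewrite /dist distnC -/(dist _ _) dist_lt ?ltn_subrL; lia.
  by case: ifP => [ji'|_]; [rewrite E// d|rewrite c_ge0].
apply: le_trans (c_sum n.+1).
have -> : (n + i.+1 = n.+1 + i)%N by rewrite addnS.
rewrite -(add1n i) big_addn addnK.
rewrite big_mkcond [leLHS]big_nat [leRHS]big_nat; apply: ler_sum => j /andP[j0 _].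
have d : dist i (j + i)%N = j by rewrite dist_lt ?addnK//; lia.
by case: ifP => [ji'|_]; [rewrite E// d|rewrite c_ge0].
Qed.

Lemma unique_at_high_temperature :
  \forall beta \near 0^'+, unique_chain (ising_LSS J beta).
Proof.
set B := outer_field J 0 0 plus.
have B0 : 0 <= B by have := c_sum 1; rewrite big_geq.
(* Dobrushin's condition asks for 4 beta (2 B) <= 1/4; B + 1 instead of B avoids dividing by 0. *)
have d0 : 0 < (32 * (B + 1))^-1 by rewrite invr_gt0; lra.
near=> beta.
have b0 : 0 < beta by near: beta; exact: nbhs_right_gt.
have b1 : beta <= (32 * (B + 1))^-1 by near: beta; exact: nbhs_right_le.
apply: (unique_of_small hJ (ltW b0)) => i n.
apply: (@le_trans _ _ (4 * beta * (2 * B))).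
  by rewrite ler_wpM2l ?mulr_ge0// ?row_sum// ltW.
move: b1; rewrite -div1r ler_pdivlMr; nra.
Unshelve. all: by end_near.
Qed.

Hypothesis hS : (Dyson_series J < +oo)%E.

Let lnln_gt0 r : (0 < r)%N -> 0 < ln (ln (r%:R + 4)) :> R.
Proof.
move=> r0; apply: ln_gt0; apply: (lt_le_trans ln5_gt1).
have : 1 <= r%:R :> R by rewrite ler1n.
by move=> h; rewrite ler_ln ?posrE; lra.
Qed.

Let D r : \bar R := ((ln (ln (r%:R + 4)))%:E / ((r%:R ^+ 3)%:E * Jsup J r))%E.

Let D_ge0 r : (0 < r)%N -> (0 <= D r)%E.
Proof.
move=> r0.
by rewrite /D mule_ge0 ?lee_fin ?(ltW (lnln_gt0 r0))// inve_ge0 mule_ge0 ?Jsup_ge0.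
Qed.

Let c_gt0 r : (0 < r)%N -> 0 < c r.
Proof.
move=> r0; rewrite lt_neqAle c_ge0// andbT; apply/eqP => c0.
have Dr : D r = +oo%E.
  by rewrite /D JsupE// -c0 mule0 inve0 gt0_muley// lte_fin lnln_gt0.
have : (D r <= Dyson_series J)%E.
  rewrite /Dyson_series; apply: le_trans (nneseries_lim_ge r.+1 _); last first.
    by move=> n n0 _; exact: D_ge0.
  rewrite big_nat_recr//= -[leLHS]add0e leeD//.
  by rewrite big_nat; apply: sume_ge0 => n /andP[n0 _]; exact: D_ge0.
by rewrite Dr leye_eq => /eqP E; move: hS; rewrite E.
Qed.

Let D_sum n : \sum_(1 <= r < n) (ln (ln (r%:R + 4)) / (r%:R ^+ 3 * c r)) <=
  fine (Dyson_series J).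
Proof.
rewrite -lee_fin fineK; last first.
  rewrite ge0_fin_numE//; apply: nneseries_ge0 => r r0 _; exact: D_ge0.
rewrite -sumEFin; apply: le_trans (nneseries_lim_ge n _); last first.
  by move=> k k0 _; exact: D_ge0.
rewrite le_eqVlt; apply/orP; left; apply/eqP.
apply: eq_big_nat => r /andP[r0 _]; rewrite JsupE// -EFinM inver.
by rewrite mulf_eq0 expf_eq0/= pnatr_eq0 !gt_eqF ?c_gt0//= EFinM.
Qed.

Let b := strength c.

Section LowTemperature.
Variables (beta Q : R).
Hypothesis Q_gt0 : 0 < Q.
Hypothesis b_sum : forall P, \sum_(0 <= p < P) ln (p%:R + 4) / b p <= Q.
Hypothesis beta_large : 8 * (80 * Q) <= beta.

Let beta_gt0 : 0 < beta.
Proof. by apply: lt_le_trans beta_large; rewrite !mulr_gt0. Qed.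

(** The 4 compensates two factors 2: ordered pairs in the hierarchical weight, and the sum over
    scales in [strength_sum]. *)
Let t p := beta * b p / 4.

Let b_gt0 p : 0 < b p. Proof. exact: strength_gt0. Qed.

Let t_gt0 p : 0 < t p.
Proof. by rewrite divr_gt0 ?mulr_gt0. Qed.

Let t_ge0 p : 0 <= t p. Proof. exact: ltW. Qed.

(** The first term keeps 1 / eps polynomial in p, so that its logarithm is of order ln (p + 4); the
    second makes t eps larger than that logarithm. *)
Let eps p : R := (2 * (p%:R + 4) ^+ 2)^-1 + 20 * ln (p%:R + 4) / t p.

Let step p : second_moment t p - eps p.+1 <= second_moment t p.+1.
Proof.
set x : R := p.+1%:R + 4.
have x5 : 5 <= x.
  have : 1 <= p.+1%:R :> R by rewrite ler1n.
  by rewrite /x; lra.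
have l0 : 0 < ln x by apply: ln_gt0; lra.
have e1 : 0 < (2 * x ^+ 2)^-1 by rewrite invr_gt0 mulr_gt0 ?exprn_gt0//; lra.
have e2 : 0 < 20 * ln x / t p.+1 by rewrite divr_gt0 ?mulr_gt0.
have ep : 0 < eps p.+1 by rewrite /eps -/x; lra.
apply: second_moment_step => //.
apply: (@le_trans _ _ (20 * ln x)); last first.
  rewrite /eps -/x mulrDr.
  have -> : t p.+1 * (20 * ln x / t p.+1) = 20 * ln x by field; rewrite gt_eqF.
  by rewrite lerDr mulr_ge0 ?(ltW e1).
(* From eps >= 1 / (2 x^2), 16 / eps^3 <= 128 x^6 <= x^10 because x >= 5. Twice the exponent 10 is
   the 20 in [eps]. *)
suff : ln (16 / eps p.+1 ^+ 3) <= ln (x ^+ 10) by rewrite lnXn; lra.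
rewrite ler_ln ?posrE ?divr_gt0 ?exprn_gt0//; try lra.
rewrite ler_pdivrMr ?exprn_gt0//.
have : ((2 * x ^+ 2)^-1) ^+ 3 <= eps p.+1 ^+ 3.
  by apply: lerXn2r; rewrite ?nnegrE /eps -/x; lra.
have x10 : 0 < x ^+ 10 by rewrite exprn_gt0; lra.
move/(ler_wpM2l (ltW x10)); apply: le_trans.
have -> : x ^+ 10 * (2 * x ^+ 2)^-1 ^+ 3 = x ^+ 4 / 8 by field; lra.
have : 5 ^+ 4 <= x ^+ 4 by apply: lerXn2r; rewrite ?nnegrE; lra.
lra.
Qed.

Let eps_sum P : \sum_(1 <= p < P) eps p <= 1 / 4.
Proof.
rewrite big_split/=.
have h1 : \sum_(1 <= p < P) (2 * (p%:R + 4) ^+ 2)^-1 <= 1 / 8 :> R.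
  (* The terms are dominated by the decrements of f, and f 1 = 1/8. *)
  pose f p : R := (2 * (p%:R + 3))^-1.
  have f0 p : 0 < f p by rewrite invr_gt0 mulr_gt0// ltr_wpDl.
  have [P1|P1] := leqP P 1; first by rewrite big_geq//; lra.
  apply: (@le_trans _ _ (\sum_(1 <= p < P) (f p - f p.+1))).
    apply: ler_sum => p _; rewrite /f -(natr1 p).
    have : 0 <= p%:R :> R by [].
    move: (p%:R) => x x0.
    have -> : (2 * (x + 3))^-1 - (2 * (x + 1 + 3))^-1 = (2 * ((x + 3) * (x + 4)))^-1.
      by field; lra.
    by rewrite lef_pV2 ?posrE; nra.
  have -> : \sum_(1 <= p < P) (f p - f p.+1) = f 1%N - f P.
    rewrite -[RHS]opprB -(telescope_sumr f (ltnW P1)) -sumrN.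
    by apply: eq_bigr => q _; rewrite opprB.
  have := f0 P; have : f 1%N = 1 / 8 by rewrite /f div1r; congr (_^-1); ring.
  lra.
(* 80 is the 20 of [eps] times the 4 of [t]; the lower bound on beta brings the sum below 1/8. *)
have h2 : \sum_(1 <= p < P) (20 * ln (p%:R + 4) / t p) <= 1 / 8 :> R.
  have -> : \sum_(1 <= p < P) (20 * ln (p%:R + 4) / t p) =
      80 / beta * \sum_(1 <= p < P) (ln (p%:R + 4) / b p).
    rewrite mulr_sumr; apply: eq_bigr => p _; rewrite /t.
    by field; rewrite !gt_eqF.
  have : \sum_(1 <= p < P) (ln (p%:R + 4) / b p) <= Q.
    have [P1|P1] := leqP P 1; first by rewrite big_geq// ltW.
    apply: le_trans (b_sum P); rewrite [leRHS]big_ltn ?(ltnW P1)// lerDr.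
    by rewrite divr_ge0 ?(ltW (b_gt0 _))// ln_ge0//; lra.
  have b80 : 0 < 80 / beta by rewrite divr_gt0.
  rewrite -(ler_pM2l b80) => /le_trans; apply.
  by rewrite mulrAC ler_pdivrMr//; have := beta_large; lra.
lra.
Qed.

Let second_moment_ge P : 3 / 4 <= second_moment t P.
Proof.
suff : 1 - \sum_(1 <= p < P.+1) eps p <= second_moment t P.
  by have := eps_sum P.+1; lra.
elim: P => [|P IH]; first by rewrite big_geq// second_moment0 subr0.
by rewrite big_nat_recr//=; have := step P; lra.
Qed.

(** Let p0 be the first scale at which i and j share a block. Their distance is at most 2^p0, so J i
    j >= c (2^p0), and the scales from p0 on together cost no more than this. *)
Let coupling_le P i j : i != j -> 2 * block_coupling t P i j <= beta * J i j.
Proof.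
move=> ij.
have ex : exists q, (i %/ 2 ^ q == j %/ 2 ^ q)%N.
  exists (i + j)%N; have lt2 n m : (n <= m)%N -> (n < 2 ^ m)%N.
    by move=> nm; apply: (leq_trans (ltn_expl n (ltnSn 1))); rewrite leq_pexp2l.
  by rewrite !divn_small// lt2// ?leq_addr ?leq_addl.
case: (ex_minnP ex) => p0 ijp0 p0_min.
have p01 : (0 < p0)%N.
  by rewrite lt0n; apply: contraNneq ij => p00; move: ijp0; rewrite p00 !divn1.
have dp : (dist i j <= 2 ^ p0)%N.
  have pw : (0 < 2 ^ p0)%N by rewrite expn_gt0.
  have := divn_eq i (2 ^ p0); have := divn_eq j (2 ^ p0).
  have := ltn_pmod i pw; have := ltn_pmod j pw.
  rewrite (eqP ijp0) /dist; move: (2 ^ p0)%N (j %/ _)%N => x y; lia.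
have cJ : c (2 ^ p0)%N <= J i j by rewrite J_dist// c_dec// dist_neq.
have : block_coupling t P i j <= beta / 4 * \sum_(p0 <= q < P.+1) b q / 4 ^+ q.
  have F q : 0 <= b q / 4 ^+ q by rewrite divr_ge0 ?exprn_ge0// ltW.
  rewrite mulr_sumr /block_coupling.
  have z q : (q < p0)%N -> (i %/ 2 ^ q == j %/ 2 ^ q)%N%:R * (t q / 4 ^+ q) = 0.
    move=> qp; case: eqP => [/eqP/p0_min|_]; last by rewrite mul0r.
    by rewrite leqNgt qp.
  have le q : (i %/ 2 ^ q == j %/ 2 ^ q)%N%:R * (t q / 4 ^+ q) <= beta / 4 * (b q / 4 ^+ q).
    have -> : beta / 4 * (b q / 4 ^+ q) = t q / 4 ^+ q by rewrite /t; ring.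
    apply: ler_piMl; first by rewrite divr_ge0 ?exprn_ge0.
    by case: eqP.
  have [Pp|pP] := leqP P.+1 p0.
    rewrite [leRHS]big_geq// big_nat big1// => q /andP[_ qP].
    by apply: z; exact: leq_trans Pp.
  rewrite (@big_cat_nat _ _ _ p0 1)//=; last exact: ltnW.
  rewrite [X in X + _]big_nat big1 ?add0r => [|q /andP[_ qp]]; last exact: z.
  by apply: ler_sum => q _; exact: le.
have : \sum_(p0 <= q < P.+1) b q / 4 ^+ q <= 2 * c (2 ^ p0)%N.
  exact: strength_sum.
have b4 : 0 < beta / 4 by rewrite divr_gt0.
rewrite -(ler_pM2l b4) => h1 h2.
rewrite -(ler_pM2l beta_gt0) in cJ; lra.
Qed.

Lemma multiple_at_low_temperature : multiple_chains (ising_LSS J beta).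
Proof.
apply: (multiple_of_magnetization hJ hF (ltW beta_gt0) (m0 := 1 / 2)) => [|n n0].
  by lra.
apply: (@magnetization_ge _ _ hJ hF beta t n.+1) => //.
- exact: ltW.
- by rewrite expnS mul2n leq_double ltnW// ltn_expl.
- by move=> i j; exact: coupling_le.
Qed.

End LowTemperature.

Lemma multiple_near_infinity :
  \forall beta \near +oo, multiple_chains (ising_LSS J beta).
Proof.
have [Q Q0 HQ] := strength_series c_gt0 c_dec D_sum.
near=> beta; apply: (multiple_at_low_temperature Q0 HQ).
by near: beta; apply: nbhs_pinfty_ge; exact: num_real.
Unshelve. all: by end_near.
Qed.

End PhaseTransition.

Theorem theorem2 (R : realType) (J : site -> site -> R) (hJ : couplings J) :
  (ferromagnetic J -> decreasing_couplings J ->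
     (Dyson_series J < +oo)%E ->
     (\forall beta \near +oo, multiple_chains (ising_LSS J beta)) /\
     (\forall beta \near 0^'+, unique_chain (ising_LSS J beta)))
  /\
  ((forall C : R, 0 < C -> exp_series J C = +oo%E) ->
     forall beta : R, 0 < beta -> unique_chain (ising_LSS J beta)).
Proof.
split=> [hF hD hS|hE beta beta0]; last exact: unique_of_exp_series.
by split; [exact: multiple_near_infinity|exact: unique_at_high_temperature].
Qed.
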